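(* Let $T>0$, $H\in(1/2,1)$, $\alpha\in(1-H,1/2)$, $X_0\in\mathbb{R}$ (non-random), and let $a,c:[0,T]\times\mathbb{R}\to\mathbb{R}$ be functions such that $c$ is differentiable in $x$ and for some constants $C>0$ and $\beta\in(1-H,1)$ the following hold for all $s,t\in[0,T]$ and $x,x_1,x_2\in\mathbb{R}$: (1) $|a(t,x)|+|c(t,x)|\le C(1+|x|)$ and $|\partial_x c(t,x)|\le C$; (2) $|a(t,x_1)-a(t,x_2)|+|\partial_x c(t,x_1)-\partial_x c(t,x_2)|\le C|x_1-x_2|$; (3) $|a(s,x)-a(t,x)|+|c(s,x)-c(t,x)|+|\partial_x c(s,x)-\partial_x c(t,x)|\le C|s-t|^\beta$. Let $B^H$ be an $\mathbb{F}$-adapted continuous fractional Brownian motion with Hurst parameter $H$. Then the solution $X$ of $$X_t = X_0+\int_0^t a(s,X_s)\,ds+\int_0^t c(s,X_s)\,dB^H_s,\quad t\in[0,T],$$ satisfies, for each $p>0$, $$\mathsf{E}\big[\|X\|_{\infty;T}^p\big]<\infty,$$ where $$\|f\|_{\infty;T}=\sup_{s\le T}|f(s)|+\sup_{s\le T}\int_0^s\frac{|f(s)-f(u)|}{(s-u)^{1+\alpha}}\,du;$$ in particular, $\mathsf{E}\big[\sup_{t\in[0,T]}|X_t|^p\big]<\infty$.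
   Context: All processes are defined on a complete filtered probability space $(\Omega,\mathcal{F},\mathbb{F}=\{\mathcal{F}_t\}_{t\ge0},\mathsf{P})$ satisfying the usual assumptions. A fractional Brownian motion with Hurst parameter $H$ is a centered Gaussian process with covariance $\mathsf{E}[B^H_tB^H_s]=\frac12(s^{2H}+t^{2H}-|t-s|^{2H})$; its paths are taken continuous (they are a.s. Hölder continuous of any order less than $H$). Solution. A process $X$ is a solution if it is $\mathbb{F}$-adapted, its paths on $[0,T]$ are a.s. Hölder continuous of some order $\kappa>1-H$ (with a random Hölder constant), and the equation holds almost surely for all $t\in[0,T]$. Under conditions (1)–(3) the equation has a unique solution. Integral. The integral with respect to $B^H$ is the pathwise generalized Lebesgue–Stieltjes integral $$\int_a^b f\,dg=e^{i\pi\alpha}\int_a^b (D^\alpha_{a+}f)(x)\,(D^{1-\alpha}_{b-}g_{b-})(x)\,dx,\qquad g_{b-}(x)=g(x)-g(b),$$ defined whenever, for some order $\alpha\in(0,1)$ (which may differ from the $\alpha$ in the claim), $D^\alpha_{a+}f\in L_1[a,b]$ and $D^{1-\alpha}_{b-}g_{b-}\in L_\infty[a,b]$, where $$(D^\alpha_{a+}f)(x)=\frac1{\Gamma(1-\alpha)}\Big(\frac{f(x)}{(x-a)^\alpha}+\alpha\int_a^x\frac{f(x)-f(u)}{(x-u)^{1+\alpha}}du\Big),$$ $$(D^{1-\alpha}_{b-}g)(x)=\frac{e^{-i\pi\alpha}}{\Gamma(\alpha)}\Big(\frac{g(x)}{(b-x)^{1-\alpha}}+(1-\alpha)\int_x^b\frac{g(x)-g(u)}{(u-x)^{2-\alpha}}du\Big).$$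 For $g=B^H$ and $f$ Hölder continuous of order $\gamma>1-H$, it is the limit of forward integral sums $\sum_k f(t_k)(B^H_{t_{k+1}}-B^H_{t_k})$. *)

(* Defs.v *)
From HB Require Import structures.
From mathcomp Require Import all_boot all_order all_algebra.
From mathcomp Require Import all_classical all_reals all_analysis.

Set Implicit Arguments.
Unset Strict Implicit.
Unset Printing Implicit Defensive.

Import Order.TTheory GRing.Theory Num.Theory.
Import numFieldNormedType.Exports.

Local Open Scope classical_set_scope.
Local Open Scope ring_scope.

(* Filtrations and processes are families indexed by all of R; only the
   indices t >= 0 (or t in [0, T]) are ever constrained. *)

Record usual_filtration (d : measure_display) (Omega : measurableType d)
    (R : realType) (P : probability Omega R) (F : R -> set (set Omega)) : Prop := {
  filtration_sigma_algebra : forall t, 0 <= t -> sigma_algebra setT (F t);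
  filtration_measurable : forall t, 0 <= t -> F t `<=` measurable;
  filtration_nondecreasing :
    forall s t, 0 <= s -> s <= t -> F s `<=` F t;
  filtration_right_continuous :
    forall t, 0 <= t -> \bigcap_(s in `]t, +oo[) F s = F t;
  filtration_null_sets : forall N, P.-negligible N -> F 0 N
}.

Definition adapted (d : measure_display) (Omega : measurableType d)
    (R : realType) (F : R -> set (set Omega)) (I : set R)
    (X : R -> Omega -> R) : Prop :=
  forall t, I t -> forall A : set R, measurable A -> F t (X t @^-1` A).

(* The law of a Gaussian variable may be degenerate (B_0 = 0 below), and
   [normal_prob m 0] is by convention not the Dirac mass. *)
Definition gaussian (d : measure_display) (Omega : measurableType d)
    (R : realType) (P : probability Omega R) (Y : Omega -> R) : Prop :=
  measurable_fun setT Y /\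
  exists m sigma : R, forall A : set R, measurable A ->
    P (Y @^-1` A) = if sigma == 0 then \d_m A else normal_prob m sigma A.

Definition gaussian_process (d : measure_display) (Omega : measurableType d)
    (R : realType) (P : probability Omega R) (B : R -> Omega -> R) : Prop :=
  forall (n : nat) (t k : 'I_n -> R), (forall i, 0 <= t i) ->
    gaussian P (fun w => \sum_(i < n) k i * B (t i) w).

Record continuous_fbm (d : measure_display) (Omega : measurableType d)
    (R : realType) (P : probability Omega R) (H : R)
    (B : R -> Omega -> R) : Prop := {
  fbm_gaussian : gaussian_process P B;
  fbm_centered : forall t, 0 <= t -> ('E_P[B t] = 0)%E;
  fbm_covariance : forall s t, 0 <= s -> 0 <= t ->
    ('E_P[fun w => (B t w * B s w)%R] =
      (2^-1 * (s `^ (2 * H) + t `^ (2 * H) - `|t - s| `^ (2 * H)))%:E)%E;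
  fbm_continuous :
    forall w, {within `[0, +oo[, continuous (fun t => B t w)}
}.

Section generalized_lebesgue_stieltjes.
Context {R : realType}.
Local Notation mu := (@lebesgue_measure R).

Definition Gamma (z : R) : R :=
  \int[mu]_(x in `]0, +oo[) (x `^ (z - 1) * expR (- x)).

Definition left_frac_deriv (alpha a : R) (f : R -> R) (x : R) : R :=
  (Gamma (1 - alpha))^-1 *
  (f x / (x - a) `^ alpha +
   alpha * \int[mu]_(u in `]a, x[) ((f x - f u) / (x - u) `^ (1 + alpha))).

(* Order 1 - alpha, without the factor e^{-i pi alpha}. *)
Definition right_frac_deriv (alpha b : R) (g : R -> R) (x : R) : R :=
  (Gamma alpha)^-1 *
  (g x / (b - x) `^ (1 - alpha) +
   (1 - alpha) * \int[mu]_(u in `]x, b[) ((g x - g u) / (u - x) `^ (2 - alpha))).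

(* D^alpha_{a+} f in L_1[a, b] and D^{1-alpha}_{b-} g in L_oo[a, b], the terms
   of both derivatives being absolutely convergent Lebesgue integrals.  Mere
   integrability of the a.e. values would not do: if sigma is a singular
   measure and f = I^alpha_{a+} sigma, then D^alpha_{a+} f = 0 a.e. even though
   f may be Hoelder continuous, and the integral would depend on alpha. *)
Definition left_frac_L1 (alpha a b : R) (f : R -> R) : Prop :=
  measurable_fun `[a, b] f /\
  (\int[mu]_(x in `]a, b[)
     ((`|f x| / (x - a) `^ alpha)%:E +
      alpha%:E * \int[mu]_(u in `]a, x[)
        (`|f x - f u| / (x - u) `^ (1 + alpha))%:E) < +oo)%E.

Definition right_frac_Loo (alpha a b : R) (g : R -> R) : Prop :=
  measurable_fun `[a, b] g /\
  exists M : R, {ae mu, forall x, x \in `]a, b[ ->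
    ((`|g x| / (b - x) `^ (1 - alpha))%:E +
     (1 - alpha)%:E * \int[mu]_(u in `]x, b[)
       (`|g x - g u| / (u - x) `^ (2 - alpha))%:E <= M%:E)%E}.

(* [is_gls_integral a b f g v]: the integral of f dg over [a, b] is defined,
   for some order alpha, and equals v.
   The sign is (-1)^alpha (-1)^(1-alpha) = e^{i pi alpha} e^{i pi (1-alpha)},
   the product of the factor in front of the integral and of the one in
   D^{1-alpha}_{b-}: it makes the integral of 1 dg equal to g b - g a, and the
   integral of f dg the limit of its forward sums.  (With e^{-i pi alpha} as
   the second factor one would get the opposite of that limit.) *)
Definition is_gls_integral (a b : R) (f g : R -> R) (v : R) : Prop :=
  exists alpha : R,
    let g_b := fun x => g x - g b in
    [/\ 0 < alpha < 1, left_frac_L1 alpha a b f, right_frac_Loo alpha a b g_b &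
        v = - \int[mu]_(x in `]a, b[)
                (left_frac_deriv alpha a f x * right_frac_deriv alpha b g_b x)].

(* The norm ||f||_{oo;T} of order alpha, possibly +oo. *)
Definition sup_norm (T : R) (f : R -> R) : \bar R :=
  ereal_sup [set `|f s|%:E | s in `[0, T]].

Definition frac_sup_norm (alpha T : R) (f : R -> R) : \bar R :=
  (sup_norm T f +
   ereal_sup [set \int[mu]_(u in `]0%R, s[)
                    (`|f s - f u| / (s - u) `^ (1 + alpha))%:E
             | s in `[0%R, T]])%E.

End generalized_lebesgue_stieltjes.

(* The order kappa is deterministic, the Hoelder constant K depends on w. *)
Record sde_solution (d : measure_display) (Omega : measurableType d)
    (R : realType) (P : probability Omega R) (F : R -> set (set Omega))
    (B : R -> Omega -> R) (T H x0 : R) (a c : R -> R -> R)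
    (X : R -> Omega -> R) : Prop := {
  solution_adapted : adapted F `[0, T] X;
  solution_hoelder : exists2 kappa : R, 1 - H < kappa <= 1 &
    {ae P, forall w, exists K : R, forall s t, s \in `[0, T] -> t \in `[0, T] ->
      `|X s w - X t w| <= K * `|s - t| `^ kappa};
  solution_equation :
    {ae P, forall w, forall t, t \in `[0, T] ->
      lebesgue_measure.-integrable `[0, t] (fun s => (a s (X s w))%:E) /\
      exists2 v : R,
        is_gls_integral 0 t (fun s => c s (X s w)) (fun s => B s w) v &
        X t w = x0 + \int[lebesgue_measure]_(s in `[0, t]) a s (X s w) + v}
}.

(* Main.v *)
(** Let f, g be bounded on ]lo, hi[, and c(r) the integral of
    f(x) (g(min(x + r, hi)) - g(x)).  Expanding both fractional derivatives and
    exchanging integrals, the generalized Lebesgue-Stieltjes integral of order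
    alpha is, up to Gamma factors, the integral of
    p^(-1-alpha) q^(-2+alpha) (c(p) + c(q) - c(p + q)).  Whenever c(r) / r tends
    to l this equals l, whatever alpha is.  For f, g Hoelder of orders gamma and
    lambda with gamma + lambda > 1, c is approximately additive, so the limit
    exists, is additive in the interval, and
    |int_s^t f dg - f(s) (g(t) - g(s))| <= C L K (t - s)^(gamma + lambda).

    Let K be a Hoelder constant of B of order lambda in (1/2, H).  On an interval
    of length of order K^(-1/lambda) this estimate, applied to f = c(., X), shows
    that 1 + |X| grows by a factor at most 4; hence ||X|| <= exp(C K^(1/lambda))
    with 1/lambda < 2.

    Let S be the sum over the dyadic increments xi of level n of
    4^-n exp(xi^2 / (360 Var xi)).  It is integrable, and by dyadic chaining
    K^2 <= C (1 + ln S).  So ||X||^p <= C S. *)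

(* In [is_gls_integral] the order of the fractional derivatives is existentially quantified, so it
   may change with t and with the path, and the equation speaks only of integrals over [0, t]. No
   calculus at a fixed order can compare v t with v s. Passing through c(r) removes the order and
   replaces the integral over [s, t] by a limit slope that is additive in the interval.

   The Hoelder constant of X is finite on almost every path but comes with no moment bound, and the
   Hoelder order of X may be below alpha. Both are used only qualitatively: they make the slopes
   exist and start self-improving estimates whose limit forgets them. What results depends on the
   data and on K alone, and has order lambda.

   Since lambda > 1/2, K^(1/lambda) is o(K^2), hence o(ln S), which is why every p is reached.
   Besides, lambda has to exceed 1 - gamma for the Young estimate and alpha for the fractional norm,
   and to stay below H; the assumptions alpha < 1/2 < H leave room for all of this. *)
Require Import Defs.
From HB Require Import structures.
From mathcomp Require Import all_boot all_order all_algebra.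
From mathcomp Require Import all_classical all_reals all_analysis.
From mathcomp Require Import measurable_realfun ring lra.

Set Implicit Arguments.
Unset Strict Implicit.
Unset Printing Implicit Defensive.

Import Order.TTheory GRing.Theory Num.Theory.
Import numFieldNormedType.Exports.

Local Open Scope classical_set_scope.
Local Open Scope ring_scope.

(** * Lebesgue integrals and power kernels *)

Section lebesgue_tools.
Context {R : realType}.
Local Notation mu := (@lebesgue_measure R).

(** The image of k mu under x |-> k x + t gives ]a, b] the mass b - a, so it is mu by uniqueness of
    Lebesgue measure. *)
Lemma ge0_integral_affine (f : R -> \bar R) (k t : R) : 0 < k ->
  measurable_fun setT f -> (forall x, 0 <= f x)%E ->
  (k%:E * \int[mu]_x f (k * x + t)%R = \int[mu]_x f x)%E.
Proof.
move=> k0 mf f0.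
pose ph : measurableTypeR R -> measurableTypeR R := fun x => k * x + t.
have mph : measurable_fun setT ph.
  by apply: measurable_funD => //; exact: mulrl_measurable.
pose m := mscale (NngNum (ltW k0)) mu.
have mE : forall A, measurable A -> pushforward m ph A = mu A.
  move=> A mA; apply/esym/lebesgue_measure_unique => //= _ [[a b]] _ <-.
rewrite /pushforward /m /mscale /=.
  have -> : ph @^-1` `]a, b] = `](a - t) / k, (b - t) / k]%classic.
    apply/seteqP; split=> x /=; rewrite !in_itv/= /ph ltr_pdivrMr// ler_pdivlMr//;
    by rewrite ltrBlDr lerBrDr (mulrC x).
  rewrite !lebesgue_measure_itv/= !lte_fin ltr_pM2r ?invr_gt0// ltrD2r.
  case: ifPn => _; last by rewrite mule0.
  rewrite -!EFinB -EFinM; congr EFin.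
  by rewrite -mulrBl mulrCA divff ?gt_eqF// mulr1; ring.
rewrite [RHS](_ : _ = \int[pushforward m ph]_x f x)%E; last first.
  by apply: eq_measure_integral => //= A mA _; exact/esym/mE.
rewrite ge0_integral_pushforward//= preimage_setT ge0_integral_mscale//.
exact: (measurableT_comp mf mph).
Qed.

Lemma ge0_integral_opp (f : R -> \bar R) :
  measurable_fun setT f -> (forall x, 0 <= f x)%E ->
  (\int[mu]_x f (- x)%R = \int[mu]_x f x)%E.
Proof.
move=> mf f0.
rewrite [RHS](_ : _ = \int[pushforward mu (-%R : measurableTypeR R -> measurableTypeR R)]_x f x)%E; last first.
  by apply: eq_measure_integral => //= A mA _; exact/esym/lebesgue_measureN.
by rewrite ge0_integral_pushforward.
Qed.

Lemma RintegralE (f : R -> R) : measurable_fun setT f ->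
  \int[mu]_x f x = fine ((\int[mu]_x (Num.max (f x) 0)%:E) - \int[mu]_x (Num.max (- f x) 0)%:E)%E.
Proof.
move=> mf; rewrite /Rintegral integralE; congr (fine (_ - _)%E);
  by apply: eq_integral => x _; rewrite ?funepos.unlock ?funeneg.unlock ?EFin_max.
Qed.

(** This holds without integrability: a factor k > 0 keeps infinite parts infinite, so both sides
    take the default value 0 of [fine] together. *)
Lemma Rintegral_affine (f : R -> R) (k t : R) : 0 < k -> measurable_fun setT f ->
  k * \int[mu]_x f (k * x + t) = \int[mu]_x f x.
Proof.
move=> k0 mf; rewrite !RintegralE//; last first.
  apply: measurableT_comp => //; apply: measurable_funD => //.
have mp : measurable_fun setT (fun x => (Num.max (f x) 0)%:E).
  by apply/measurable_EFinP/measurable_maxr.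
have mn : measurable_fun setT (fun x => (Num.max (- f x) 0)%:E).
  by apply/measurable_EFinP/measurable_maxr => //; exact: measurableT_comp.
rewrite -(ge0_integral_affine t k0 mp); last by move=> x; rewrite lee_fin le_max lexx orbT.
rewrite -(ge0_integral_affine t k0 mn); last by move=> x; rewrite lee_fin le_max lexx orbT.
move: (\int[_]_x _)%E (\int[_]_x _)%E => u v.
case: u => [u| |]; case: v => [v| |] //=;
  rewrite ?gt0_muley ?gt0_muleNy ?lte_fin //= ?mulr0//.
by rewrite mulrBr.
Qed.

(** The integrals of the positive and negative parts are measurable by Tonelli even where they are
    infinite, and [fine] of their difference stays measurable. *)
Lemma measurable_Rintegral_param d (T : measurableType d) (F : T * R -> R) :
  measurable_fun setT F -> measurable_fun setT (fun t => \int[mu]_x F (t, x)).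
Proof.
move=> mF.
have -> : (fun t => \int[mu]_x F (t, x)) = fine \o
   (fun t => (\int[mu]_x ((EFin \o F)^\+ (t, x)) - \int[mu]_x ((EFin \o F)^\- (t, x)))%E).
  apply/funext => t; rewrite /Rintegral [LHS]/= [in LHS]integralE [in RHS]/=.
  congr (fine (_ - _)%E).
  - by apply: eq_integral => x _; rewrite !funeposE.
  - by apply: eq_integral => x _; rewrite !funenegE.
apply: measurableT_comp => //.
apply: emeasurable_funB; apply: measurable_fun_fubini_tonelli_F => //.
- by apply: measurable_funepos; exact/measurable_EFinP.
- by apply: measurable_funeneg; exact/measurable_EFinP.
Qed.

Lemma Rintegral_fubini (F : R * R -> R) : measurable_fun setT F ->
  (\int[mu]_x \int[mu]_y `|F (x, y)|%:E < +oo)%E ->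
  \int[mu]_x (\int[mu]_y F (x, y)) = \int[mu]_y (\int[mu]_x F (x, y)).
Proof.
move=> mF Foo.
have iF : (mu \x mu)%E.-integrable setT (EFin \o F).
  by apply/integrable12ltyP => //; exact/measurable_EFinP.
have H := Fubini iF.
rewrite /Rintegral.
transitivity (fine (\int[mu]_x \int[mu]_y (F (x, y))%:E)).
  (* Real and extended inner integrals agree wherever the slice is integrable, hence almost
     everywhere. *)
  congr fine; apply: ae_eq_integral => //.
  - apply/measurable_EFinP. exact: measurable_Rintegral_param.
  - exact: (measurable_fubini_F iF).
  - apply: filterS (ae_integrable1 iF) => x ix _; rewrite fineK//.
    exact: integrable_fin_num ix.
rewrite H; congr fine; apply: ae_eq_integral => //.
- exact: (measurable_fubini_G iF).
- apply/measurable_EFinP.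
  have mS : measurable_fun setT (F \o (fun z : R * R => (z.2, z.1))).
    by apply: measurableT_comp => //; exact: measurable_swap.
  exact: (measurable_Rintegral_param mS).
- apply: filterS (ae_integrable2 iF) => x ix _; rewrite fineK//.
  exact: integrable_fin_num ix.
Qed.

End lebesgue_tools.

(** * Integrals of power functions *)

Section kernels.
Context {R : realType}.
Local Notation mu := (@lebesgue_measure R).

Lemma is_derive_powR_div (s x : R) : s != 0 -> 0 < x ->
  is_derive x 1 (fun x => x `^ s / s) (x `^ (s - 1)).
Proof.
move=> s0 x0; have H := is_derive1_powR s x0.
have := @is_deriveM R R^o (@powR R ^~ s) (cst s^-1) x 1 _ _ H (is_derive_cst _ _ _).
rewrite scaler0 add0r /GRing.scale/= mulrA mulVf// mul1r.
exact.
Qed.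

Lemma powR_continuous_at (s x : R) : 0 < x -> {for x, continuous (@powR R ^~ s)}.
Proof.
move=> x0; apply: differentiable_continuous; apply/derivable1_diffP.
by apply: derivable_powR; rewrite in_itv/= x0.
Qed.

Lemma integral_powR_Icc (s x y : R) : s != 0 -> 0 < x -> x < y ->
  (\int[mu]_(p in `[x, y]) (p `^ (s - 1))%:E = ((y `^ s - x `^ s) / s)%:E)%E.
Proof.
move=> s0 x0 xy; rewrite mulrBl EFinB.
apply: (@continuous_FTC2 _ _ (fun x => x `^ s / s)) => //.
- apply: continuous_in_subspaceT => z; rewrite inE/= in_itv/= => /andP[xz _].
  by apply: powR_continuous_at; exact: lt_le_trans xz.
- split.
  + move=> z; rewrite in_itv/= => /andP[xz _].
    by apply: ex_derive; apply: is_derive_powR_div => //; exact: lt_trans xz.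
  + apply: cvg_at_right_filter; apply: cvgM; last exact: cvg_cst.
    exact: powR_continuous_at.
  + apply: cvg_at_left_filter; apply: cvgM; last exact: cvg_cst.
    by apply: powR_continuous_at; exact: lt_trans xy.
- move=> z; rewrite in_itv/= => /andP[xz _].
  rewrite derive1E; apply: derive_val.
  by apply: is_derive_powR_div => //; exact: lt_trans xz.
Qed.

Lemma powRN_cvg0 (s : R) : 0 < s -> x `^ (- s) @[x --> +oo] --> (0 : R).
Proof.
move=> s0; apply/cvgrPdist_le => e e0; near=> x.
have x0 : 0 < x by near: x; apply: nbhs_pinfty_gt; rewrite num_real.
rewrite sub0r normrN ger0_norm ?powR_ge0// powRN.
rewrite -[leRHS]invrK lef_pV2 ?posrE ?invr_gt0// ?powR_gt0//.
have -> : e^-1 = (e^-1 `^ s^-1) `^ s.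
  by rewrite -powRrM mulVf ?gt_eqF// powRr1// invr_ge0 ltW.
apply: ge0_ler_powR; rewrite ?nnegrE ?powR_ge0// ltW//.
Unshelve. all: by end_near. Qed.

Lemma integral_powR_tail (a y : R) : 0 < a -> 0 < y ->
  (\int[mu]_(p in `]y, +oo[) (p `^ (- (1 + a)))%:E = (y `^ (- a) / a)%:E)%E.
Proof.
move=> a0 y0.
have ma : measurable_fun setT (fun p : R => p `^ (- (1 + a))) by exact: measurable_powR.
rewrite integral_itv_obnd_cbnd; last by apply/measurable_EFinP; apply: measurable_funTS.
have E : - (1 + a) = (- a) - 1 by rewrite opprD addrC.
have a0' : - a != 0 by rewrite oppr_eq0 gt_eqF.
rewrite (@ge0_continuous_FTC2y _ _ (fun x => x `^ (- a) / (- a)) y 0).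
- by rewrite sub0e -EFinN invrN mulrN opprK.
- by move=> x _; exact: powR_ge0.
- apply: continuous_in_subspaceT => z; rewrite inE/= in_itv/= andbT => xz.
  by apply: powR_continuous_at; exact: lt_le_trans xz.
- rewrite -(mul0r (- a)^-1); apply: cvgM; last exact: cvg_cst.
  exact: powRN_cvg0.
- move=> x yx; apply: ex_derive; apply: is_derive_powR_div => //; exact: lt_trans yx.
- apply: cvg_at_right_filter; apply: cvgM; last exact: cvg_cst.
  exact: powR_continuous_at.
- move=> z; rewrite in_itv/= andbT => xz.
  rewrite derive1E E; apply: derive_val.
  by apply: is_derive_powR_div => //; exact: lt_trans xz.
Qed.

(** For b < 1 the integrand is singular at 0, so the fundamental theorem is applied on intervals
    exhausting ]0, y], followed by monotone convergence. *)
Lemma integral_powR_head (b y : R) : 0 < b -> 0 < y ->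
  (\int[mu]_(p in `]0%R, y]) (p `^ (b - 1))%:E <= (y `^ b / b)%:E)%E.
Proof.
move=> b0 y0.
have mb : measurable_fun setT (fun p : R => p `^ (b - 1)) by exact: measurable_powR.
(* [i.+2] keeps the left end strictly below y, as [integral_powR_Icc] asks. *)
pose F (i : nat) := `[y / i.+2%:R, y]%classic.
have FE : `]0%R, y]%classic = \bigcup_i F i.
  apply/seteqP; split=> [p /=|p [i _]]; rewrite /F/= !in_itv/=.
    move=> /andP[p0 py].
    exists (Num.truncn (y / p)).+1 => //=; rewrite in_itv/= py andbT.
    rewrite ler_pdivrMr// mulrC -ler_pdivrMr//.
    rewrite ltW// (lt_trans (truncnS_gt _))// ltr_nat//.
  by move=> /andP[yp ->]; rewrite andbT (lt_le_trans _ yp)// divr_gt0.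
rewrite FE.
have ndF : nondecreasing_seq F.
  move=> i j ij; rewrite subsetEset => p; rewrite /F/= !in_itv/= => /andP[yp ->].
  rewrite andbT (le_trans _ yp)// ler_pM2l// lef_pV2 ?posrE ?ltr0n//.
  by rewrite ler_nat.
have mF i : measurable (F i) by exact: measurable_itv.
have cv : (\int[mu]_(p in F i) (p `^ (b - 1))%:E @[i --> \oo] -->
    \int[mu]_(p in \bigcup_i F i) (p `^ (b - 1))%:E)%E.
  apply: ge0_nondecreasing_set_cvg_integral => //.
  - by move=> i; apply/measurable_EFinP; exact: measurable_funTS.
  - by move=> i x _; rewrite lee_fin powR_ge0.
rewrite -(cvg_lim _ cv)//; apply: lime_le; first by apply: cvgP cv.
near=> i; rewrite integral_powR_Icc//.
- by rewrite lee_fin ler_pM2r ?invr_gt0// lerBlDr lerDl powR_ge0.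
- by rewrite gt_eqF.
- by rewrite divr_gt0.
- by rewrite ltr_pdivrMr// ltr_pMr// ltr1n.
Unshelve. all: by end_near. Qed.

End kernels.

(** * The Gamma integral of the fractional kernel *)

Section gamma_kernel.
Context {R : realType}.
Local Notation mu := (@lebesgue_measure R).

(** The value 0 on [r <= 0] replaces the conventional values of [powR] there, so that kernel
    integrals run over the whole line and translations and dilations act on them freely. *)
Definition ppow (s r : R) : R := if 0 < r then r `^ s else 0.

Lemma ppow_ge0 s r : 0 <= ppow s r.
Proof. by rewrite /ppow; case: ifP => // _; exact: powR_ge0. Qed.

Lemma ppowE s r : 0 < r -> ppow s r = r `^ s.
Proof. by rewrite /ppow => ->. Qed.

Lemma measurable_ppow s : measurable_fun setT (ppow s).
Proof.
apply: measurable_fun_ifT => //; exact: measurable_fun_ltr.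
Qed.

Lemma integral_ifE (D : set R) (P : pred R) (h : R -> \bar R) :
  (forall x, D x <-> P x) ->
  (\int[mu]_(x in D) h x = \int[mu]_x (if P x then h x else 0))%E.
Proof.
move=> DP; rewrite integral_mkcond; apply: eq_integral => x _; rewrite patchE.
case: ifPn => [|]; first by rewrite inE => /DP ->.
by rewrite notin_setE => nD; case: ifPn => // /DP.
Qed.

Lemma integral_expRN_oo (p : R) : 0 < p ->
  (\int[mu]_(y in `]0%R, p[) (expR (- y))%:E = (1 - expR (- p))%:E)%E.
Proof.
move=> p0.
have mE : measurable_fun setT (fun y : R => (expR (- y))%:E).
  by apply/measurable_EFinP; apply: measurableT_comp => //; exact: measurable_expR.
transitivity (\int[mu]_(y in `[0%R, p]) (expR (- y))%:E)%E.
  by rewrite [RHS](@integral_itv_bndoo _ _ _ _ true false)//; exact: measurable_funTS.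
have cE : continuous (fun x : R => expR (- x)).
  move=> z; apply: (@cvg_comp _ _ _ (fun x : R => - x) expR _ (nbhs (- z))); last exact: continuous_expR.
  by apply: cvgN; exact: cvg_id.
rewrite (@continuous_FTC2 _ _ (fun y => - expR (- y)))//.
- by rewrite oppr0 expR0 -EFinB opprK addrC.
- exact: continuous_subspaceT.
- split.
  + by move=> z _; exact: ex_derive.
  + by apply: cvg_at_right_filter; apply: cvgN; exact: cE.
  + by apply: cvg_at_left_filter; apply: cvgN; exact: cE.
- move=> z _; rewrite derive1E derive_val /GRing.scale/=; ring.
Qed.

(** Write 1 - exp(-p) as the integral of exp(-y) over ]0, p[ and exchange by Tonelli: the inner
    integral becomes the tail y^(-a) / a, and what remains is the Gamma integral of 1 - a.
    Positivity allows division by the Gamma factors later. *)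
Lemma integral_gamma_kernel (a : R) : 0 < a < 1 ->
  (\int[mu]_p (ppow (- (1 + a)) p * (1 - expR (- p)))%:E =
     (Gamma (1 - a) / a)%:E)%E /\ 0 < Gamma (1 - a).
Proof.
move=> /andP[a0 a1].
pose k := ppow (- (1 + a)).
have mk : measurable_fun setT k by exact: measurable_ppow.
have me : measurable_fun setT (fun y : R => expR (- y)).
  by apply: measurableT_comp => //; exact: measurable_expR.
pose F (z : R * R) := (k z.1 * (if (0 < z.2) && (z.2 < z.1) then expR (- z.2) else 0))%:E.
have F0 z : (0 <= F z)%E.
  by rewrite lee_fin mulr_ge0 ?ppow_ge0//; case: ifP => // _; exact: expR_ge0.
have mF : measurable_fun setT F.
  apply/measurable_EFinP; apply: measurable_funM; first exact: measurableT_comp.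
  apply: measurable_fun_ifT => //; last by apply: (measurableT_comp me).
  by apply: measurable_and; exact: measurable_fun_ltr.
have L : (\int[mu]_p \int[mu]_y F (p, y) =
   \int[mu]_p (k p * (1 - expR (- p)))%:E)%E.
  apply: eq_integral => p _; rewrite /F/=.
  have [p0|p0] := ltP 0 p; last first.
    rewrite {2}/k /ppow ltNge p0 /= mul0r; apply: integral0_eq => y _.
    by rewrite /k /ppow ltNge p0 /= mul0r.
  under eq_integral do rewrite EFinM.
  rewrite ge0_integralZl//=; last 3 first.
  - apply/measurable_EFinP; apply: measurable_fun_ifT => //.
    by apply: measurable_and; exact: measurable_fun_ltr.
  - by move=> y _; rewrite lee_fin; case: ifP => // _; exact: expR_ge0.
  - by rewrite lee_fin ppow_ge0.
  rewrite EFinM -integral_expRN_oo//; congr (_ * _)%E.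
  rewrite (@integral_ifE _ (fun y => (0 < y) && (y < p))); last first.
    by move=> y /=; rewrite in_itv/=.
  by apply: eq_integral => y _; case: ifP.
pose G := (\int[mu]_(x in `]0%R, +oo[) (x `^ (1 - a - 1) * expR (- x))%:E)%E.
have Rt : (\int[mu]_y \int[mu]_p F (p, y) = (a^-1)%:E * G)%E.
  rewrite /G -ge0_integralZl//=; last 3 first.
  - apply/measurable_EFinP; apply: measurable_funTS.
    by apply: measurable_funM => //; exact: measurable_powR.
  - by move=> y _; rewrite lee_fin mulr_ge0 ?powR_ge0 ?expR_ge0.
  - by rewrite lee_fin invr_ge0 ltW.
  rewrite [RHS](@integral_ifE _ (fun y => (0 < y))); last first.
    by move=> y /=; rewrite in_itv/= andbT.
  apply: eq_integral => y _; rewrite /F/=; case: ifPn => y0; last first.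
    by apply: integral0_eq => p _; rewrite mulr0.
  transitivity (\int[mu]_(p in `]y, +oo[) ((expR (- y))%:E * (p `^ (- (1 + a)))%:E))%E.
    rewrite (@integral_ifE _ (fun p => (y < p))); last first.
      by move=> p /=; rewrite in_itv/= andbT.
    apply: eq_integral => p _ /=; case: ifP => yp; last by rewrite mulr0.
    by rewrite -EFinM mulrC /k ppowE// (lt_trans y0).
  rewrite ge0_integralZl//=; last 2 first.
  - by apply/measurable_EFinP; apply: measurable_funTS; exact: measurable_powR.
  - by move=> p _; rewrite lee_fin powR_ge0.
  rewrite integral_powR_tail// -!EFinM; congr EFin.
  by rewrite (_ : 1 - a - 1 = - a); ring.
have LR : (\int[mu]_p (k p * (1 - expR (- p)))%:E = (a^-1)%:E * G)%E.
  by rewrite -L -Rt; exact: fubini_tonelli.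
have mke : measurable_fun setT (fun p => k p * (1 - expR (- p))).
  by apply: measurable_funM => //; exact: measurable_funB.
have kge0 p : 0 <= k p * (1 - expR (- p)).
  have [p0|p0] := ltP 0 p; last by rewrite /k /ppow ltNge p0 mul0r.
  by rewrite mulr_ge0 ?ppow_ge0// subr_ge0 -expR0 ler_expR oppr_le0 ltW.
(* Were the integral infinite, [fine] would send [Gamma] to 0. It is finite since 1 - exp(-p) is at
   most p on ]0, 1] and at most 1 beyond. *)
have Lfin : (\int[mu]_p (k p * (1 - expR (- p)))%:E < +oo)%E.
  apply: (@le_lt_trans _ _ (\int[mu]_(p in `]0%R, 1%R]) (p `^ (1 - a - 1))%:E +
     \int[mu]_(p in `]1%R, +oo[) (p `^ (- (1 + a)))%:E)%E); last first.
    rewrite integral_powR_tail//; apply: lte_add_pinfty; last exact: ltry.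
    by apply: le_lt_trans (integral_powR_head _ _) _; rewrite ?ltry ?subr_gt0.
  rewrite (@integral_ifE `]0%R, 1%R]%classic (fun p => 0 < p <= 1)); last by move=> p /=; rewrite in_itv/=.
  rewrite (@integral_ifE `]1%R, +oo[%classic (fun p => 1 < p)); last by move=> p /=; rewrite in_itv/= andbT.
  rewrite -ge0_integralD//=; last 4 first.
  - by move=> p _; case: ifP => // _; rewrite lee_fin powR_ge0.
  - apply: measurable_fun_ifT => //.
      by apply: measurable_and; [exact: measurable_fun_ltr|exact: measurable_fun_ler].
    by apply/measurable_EFinP; exact: measurable_powR.
  - by move=> p _; case: ifP => // _; rewrite lee_fin powR_ge0.
  - apply: measurable_fun_ifT => //; first exact: measurable_fun_ltr.
    by apply/measurable_EFinP; exact: measurable_powR.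
  apply: ge0_le_integral => //.
  - by move=> p _; rewrite lee_fin.
  - exact/measurable_EFinP.
  - apply: emeasurable_funD; apply: measurable_fun_ifT => //;
      try (by apply/measurable_EFinP; exact: measurable_powR).
      by apply: measurable_and; [exact: measurable_fun_ltr|exact: measurable_fun_ler].
    exact: measurable_fun_ltr.
  move=> p _; have [p0|p0] := ltP 0 p; last first.
    by rewrite /k /ppow ltNge p0 mul0r /= ltNge (le_trans p0)// adde0.
  rewrite /k ppowE//=; have [p1|p1] := leP p 1.
    rewrite adde0 lee_fin.
    rewrite (_ : 1 - a - 1 = - (1 + a) + 1); last by ring.
    rewrite powRD; last by apply/implyP => _; rewrite gt_eqF.
    rewrite powRr1 ?(ltW p0)// ler_wpM2l ?powR_ge0//.
    by have := expR_ge1Dx (- p); lra.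
  by rewrite add0e lee_fin ler_piMr ?powR_ge0// gerBl expR_ge0.
have LG : (G = a%:E * \int[mu]_p (k p * (1 - expR (- p)))%:E)%E.
  by rewrite LR muleA -EFinM mulfV ?gt_eqF// mul1e.
have Lge0 : (0 <= \int[mu]_p (k p * (1 - expR (- p)))%:E)%E.
  by apply: integral_ge0 => p _; rewrite lee_fin.
have Lpos : (0 < \int[mu]_p (k p * (1 - expR (- p)))%:E)%E.
  apply: (@lt_le_trans _ _ (\int[mu]_(p in `]1%R, +oo[) ((1 - expR (- 1))%:E * (p `^ (- (1 + a)))%:E))%E).
    have e1 : 0 < 1 - expR (- 1) :> R by rewrite subr_gt0 -[ltRHS]expR0 ltr_expR oppr_lt0.
    rewrite ge0_integralZl//=; last 2 first.
    - by apply/measurable_EFinP; apply: measurable_funTS; exact: measurable_powR.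
    - by move=> p _; rewrite lee_fin powR_ge0.
    by rewrite integral_powR_tail// -EFinM lte_fin mulr_gt0// divr_gt0// powR_gt0.
  rewrite (@integral_ifE `]1%R, +oo[%classic (fun p => 1 < p)); last by move=> p /=; rewrite in_itv/= andbT.
  apply: ge0_le_integral => //.
  - move=> p _; case: ifP => // _; rewrite -EFinM lee_fin mulr_ge0 ?powR_ge0//.
  - apply: measurable_fun_ifT => //; first exact: measurable_fun_ltr.
    by apply/measurable_EFinP; apply: measurable_funM => //; exact: measurable_powR.
  - exact/measurable_EFinP.
  move=> p _; case: ifPn => p1; last by rewrite lee_fin.
  rewrite -EFinM lee_fin mulrC /k ppowE ?(lt_trans _ p1)//.
  by rewrite ler_wpM2l ?powR_ge0// lerB// ler_expR lerN2 ltW.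
have GE : Gamma (1 - a) = fine G by [].
have Lnum : (\int[mu]_p (k p * (1 - expR (- p)))%:E \is a fin_num)%E.
  by rewrite ge0_fin_numE.
have GF : (Gamma (1 - a) = a * fine (\int[mu]_p (k p * (1 - expR (- p)))%:E)%E)%R.
  by rewrite GE LG fineM.
split.
  by rewrite GF mulrC mulrA mulVf ?gt_eqF// mul1r fineK.
by rewrite GF mulr_gt0// fine_gt0// Lpos Lfin.
Qed.

End gamma_kernel.

Section Rintegral_complements.
Context {R : realType}.
Local Notation mu := (@lebesgue_measure R).

Lemma RintegralZl_gt0 (f : R -> R) (k : R) : 0 < k -> measurable_fun setT f ->
  \int[mu]_x (k * f x) = k * \int[mu]_x f x.
Proof.
move=> k0 mf; rewrite !RintegralE//; last exact: measurable_funM.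
have mp : measurable_fun setT (fun x => (Num.max (f x) 0)%:E).
  by apply/measurable_EFinP/measurable_maxr.
have mn : measurable_fun setT (fun x => (Num.max (- f x) 0)%:E).
  by apply/measurable_EFinP/measurable_maxr => //; exact: measurableT_comp.
have E x : Num.max (k * x) 0 = k * Num.max x 0.
  by rewrite maxr_pMr ?mulr0// ltW.
under eq_integral do rewrite E EFinM.
under [X in (_ - X)%E]eq_integral do rewrite -mulrN E EFinM.
rewrite !ge0_integralZl//=; try by [rewrite lee_fin ltW|move=> x _; rewrite lee_fin le_max lexx orbT].
move: (\int[_]_x _)%E (\int[_]_x _)%E => u v.
case: u => [u| |]; case: v => [v| |] //=;
  rewrite ?gt0_muley ?gt0_muleNy ?lte_fin //= ?mulr0//.
by rewrite mulrBr.
Qed.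

Lemma measurable_integral1 d (T : measurableType d) (f : T * R -> \bar R) :
  measurable_fun setT f -> (forall z, 0 <= f z)%E ->
  measurable_fun setT (fun x => \int[mu]_y f (x, y))%E.
Proof. by move=> mf f0; exact: measurable_fun_fubini_tonelli_F. Qed.

Lemma measurable_integral2 (f : R * R -> \bar R) :
  measurable_fun setT f -> (forall z, 0 <= f z)%E ->
  measurable_fun setT (fun y => \int[mu]_x f (x, y))%E.
Proof. by move=> mf f0; exact: measurable_fun_fubini_tonelli_G. Qed.

Lemma integral_tonelli (f : R * R -> \bar R) :
  measurable_fun setT f -> (forall z, 0 <= f z)%E ->
  (\int[mu]_x \int[mu]_y f (x, y) = \int[mu]_y \int[mu]_x f (x, y))%E.
Proof. by move=> mf f0; exact: fubini_tonelli. Qed.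

Lemma integrable_prodP (F : R * R -> R) : measurable_fun setT F ->
  (mu \x mu)%E.-integrable setT (EFin \o F) <->
  (\int[mu]_x \int[mu]_y `|F (x, y)|%:E < +oo)%E.
Proof. by move=> mF; rewrite integrable12ltyP//; exact/measurable_EFinP. Qed.

Lemma integrable_prodP2 (F : R * R -> R) : measurable_fun setT F ->
  (mu \x mu)%E.-integrable setT (EFin \o F) <->
  (\int[mu]_y \int[mu]_x `|F (x, y)|%:E < +oo)%E.
Proof. by move=> mF; rewrite integrable21ltyP//; exact/measurable_EFinP. Qed.

Lemma Rintegral_prod (F : R * R -> R) : measurable_fun setT F ->
  (mu \x mu)%E.-integrable setT (EFin \o F) ->
  \int[mu]_x (\int[mu]_y F (x, y)) = \int[(mu \x mu)%E]_z F z.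
Proof.
move=> mF iF; rewrite /Rintegral -(integral12_prod_meas1 iF); congr fine.
apply: ae_eq_integral => //.
- by apply/measurable_EFinP; exact: measurable_Rintegral_param.
- exact: (measurable_fubini_F iF).
- apply: filterS (ae_integrable1 iF) => x ix _; rewrite fineK//.
  exact: integrable_fin_num ix.
Qed.

Lemma Rintegral_ae_eq (f g : R -> R) : measurable_fun setT f -> measurable_fun setT g ->
  {ae mu, forall x, f x = g x} -> \int[mu]_x f x = \int[mu]_x g x.
Proof.
move=> mf mg fg; rewrite /Rintegral; congr fine; apply: ae_eq_integral => //.
- exact/measurable_EFinP.
- exact/measurable_EFinP.
- case: fg => N [mN N0 fgN]; exists N; split => // x /= nfg; apply: fgN => /= fgx.
  by apply: nfg => _; rewrite fgx.
Qed.

Lemma Rintegral_eq0 (h : R -> R) : (forall x, h x = 0) -> \int[mu]_x h x = 0.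
Proof.
move=> h0; transitivity (\int[mu]_x (cst 0 x : R)); first exact: eq_Rintegral.
by rewrite Rintegral_cst//= mul0r.
Qed.

Lemma bounded_integrable_itv (f : R -> R) (x y B : R) (b0 b1 : bool) :
  measurable_fun [set` Interval (BSide b0 x) (BSide b1 y)] f ->
  (forall s, x <= s <= y -> `|f s| <= B) ->
  mu.-integrable [set` Interval (BSide b0 x) (BSide b1 y)] (EFin \o f).
Proof.
move=> mf fB; apply: measurable_bounded_integrable => //.
- by rewrite /= lebesgue_measure_itv/=; case: ifPn => _; rewrite ?ltry// -EFinB ltry.
exists B; split; first exact: num_real.
move=> B' /ltW BB' s /= sxy; apply: le_trans BB'; apply: fB.
by move: sxy; rewrite in_itv/=; case: b0 b1 mf => -[] _ /andP[? ?]; apply/andP; split => //;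
  exact: ltW.
Qed.

Lemma le_normr_Rintegral_itv (f : R -> R) (x y B : R) (b0 b1 : bool) : x <= y ->
  measurable_fun [set` Interval (BSide b0 x) (BSide b1 y)] f ->
  (forall s, x <= s <= y -> `|f s| <= B) ->
  `|\int[mu]_(s in [set` Interval (BSide b0 x) (BSide b1 y)]) f s| <= B * (y - x).
Proof.
move=> xy mf fB; have If := bounded_integrable_itv mf fB.
apply: le_trans (le_normr_Rintegral _ If) _ => //.
have -> : B * (y - x) = \int[mu]_(s in [set` Interval (BSide b0 x) (BSide b1 y)]) B.
  rewrite Rintegral_cst//= lebesgue_measure_itv/= lte_fin.
  by move: xy; rewrite le_eqVlt => /predU1P[->|->]; rewrite ?ltxx ?subrr.
apply: le_Rintegral => //.
- exact: integrable_norm If.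
- by apply: (@bounded_integrable_itv (cst B) _ _ `|B|).
move=> s /= sxy; apply: fB.
by move: sxy; rewrite in_itv/=; case: b0 b1 mf If => -[] _ _ /andP[? ?]; apply/andP; split => //;
  exact: ltW.
Qed.

Lemma bounded_support_integrable (f : R -> R) (x y B : R) :
  measurable_fun setT f -> (forall s, `|f s| <= B) ->
  (forall s, ~~ (x <= s <= y) -> f s = 0) ->
  mu.-integrable setT (EFin \o f).
Proof.
move=> mf fB f0.
have H : mu.-integrable `[x, y] (EFin \o f).
  by apply: (@bounded_integrable_itv _ _ _ B) => //; exact: measurable_funTS.
move/integrable_mkcond : H => /(_ (measurable_itv _)); apply: eq_integrable => // s _.
rewrite patchE mem_setE in_itv/=; case: ifPn => // /f0 fs.
by rewrite /= fs.
Qed.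

Lemma le_normr_Rintegral_support (f : R -> R) (x y B : R) : x <= y ->
  measurable_fun setT f -> (forall s, x <= s <= y -> `|f s| <= B) ->
  (forall s, ~~ (x <= s <= y) -> f s = 0) ->
  `|\int[mu]_s f s| <= B * (y - x).
Proof.
move=> xy mf fB f0.
have -> : \int[mu]_s f s = \int[mu]_(s in `[x, y]) f s.
  rewrite [RHS]Rintegral_mkcond; apply: eq_Rintegral => s _.
  by rewrite patchE mem_setE in_itv/=; case: ifPn => // /f0 ->.
by apply: le_normr_Rintegral_itv => //; exact: measurable_funTS.
Qed.

End Rintegral_complements.

(* The function h below is the integrand of the double integral restricted to a
   ray (z q, q).  Rescaling turns the truncated integral of each of its three
   terms into one of q^-2 c(q); they cancel except near 0 and near infinity. *)
Section frullani.
Context {R : realType}.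
Local Notation mu := (@lebesgue_measure R).
Variables (c : R -> R) (M : R).
Hypotheses (mc : measurable_fun setT c) (cM : forall r, `|c r| <= M).

Let k : R -> R := ppow (-2).

Let kE (s : R) : 0 < s -> k s = s ^- 2.
Proof. by move=> s0; rewrite /k ppowE// powR_invn// ltW. Qed.

Let mk : measurable_fun setT k. Proof. exact: measurable_ppow. Qed.

Let A x y := \int[mu]_(s in `[x, y]) (k s * c s).

Let M0 : 0 <= M. Proof. exact: le_trans (cM 0). Qed.

Let k_le (x s : R) : 0 < x -> x <= s -> k s <= x ^- 2.
Proof.
move=> x0 xs; have s0 : 0 < s by exact: lt_le_trans xs.
by rewrite kE// lef_pV2 ?posrE ?exprn_gt0// ler_pXn2r// nnegrE ltW.
Qed.

Let mkc w : measurable_fun setT (fun s => k s * c (w * s)).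
Proof.
apply: measurable_funM => //.
by apply: measurableT_comp => //; exact: mulrl_measurable.
Qed.

Let ikc (w x y : R) : 0 < x -> mu.-integrable `[x, y] (EFin \o (fun s => k s * c (w * s))).
Proof.
move=> x0; apply: (@bounded_integrable_itv _ _ _ _ (x ^- 2 * M)).
  exact: measurable_funTS.
move=> s /andP[xs _].
rewrite normrM ger0_norm ?ppow_ge0//.
by apply: ler_pM => //; [exact: ppow_ge0|exact: k_le].
Qed.

Let ikc1 (x y : R) : 0 < x -> mu.-integrable `[x, y] (EFin \o (fun s => k s * c s)).
Proof. by move=> /(@ikc 1 x y); apply: eq_integrable => // s _ /=; rewrite mul1r. Qed.

Let A_scale w x y : 0 < w -> 0 < x ->
  \int[mu]_(q in `[x, y]) (k q * c (w * q)) = w * A (w * x) (w * y).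
Proof.
move=> w0 x0; rewrite /A Rintegral_mkcond [in RHS]Rintegral_mkcond.
pose f := (fun s => k s * c s) \_ `[w * x, w * y].
have mf : measurable_fun setT f.
  by apply/(measurable_restrictT _ _).1 => //; apply: measurable_funTS; exact: measurable_funM.
rewrite -[X in _ = w * X](Rintegral_affine 0 w0 mf).
rewrite mulrA -RintegralZl_gt0 ?mulr_gt0//; last first.
  by apply: measurableT_comp => //; apply: measurable_funD => //; exact: mulrl_measurable.
apply: eq_Rintegral => q _; rewrite addr0 /f !patchE.
have -> : (w * q \in `[w * x, w * y]%classic) = (q \in `[x, y]%classic).
  by apply/idP/idP; rewrite !inE/= !in_itv/= !ler_pM2l.
case: ifPn => [|_]; last by rewrite mulr0.
rewrite inE/= in_itv/= => /andP[xq _].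
have q0 : 0 < q by exact: lt_le_trans xq.
rewrite !kE ?mulr_gt0// !mulrA; congr (_ * _).
by field; rewrite !gt_eqF.
Qed.

Let A_chasles (x y w : R) : 0 < x -> x <= y -> y <= w -> A x w = A x y + A y w.
Proof.
move=> x0 xy yw; apply/eqP; rewrite -subr_eq0 opprD addrA subr_eq0; apply/eqP.
rewrite /A Rintegral_itvB ?bnd_simp//; last exact: ikc1.
rewrite Rintegral_itv_obnd_cbnd//.
by apply: integrableS (ikc1 w x0) => //; apply: subset_itvr; rewrite bnd_simp.
Qed.

Let A_bound (x y B : R) : 0 < x -> x <= y -> (forall s, x <= s <= y -> `|k s * c s| <= B) ->
  `|A x y| <= B * (y - x).
Proof.
move=> x0 xy H; apply: le_normr_Rintegral_itv => //; apply: measurable_funTS.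
by apply: measurable_funM.
Qed.

Hypothesis c_o : forall e : R, 0 < e -> exists2 d : R, 0 < d & forall r, 0 < r < d -> `|c r| <= e * r.

Variables (z : R) (z0 : 0 < z).

Let h q := k q * (c (z * q) + c q - c ((1 + z) * q)).

(** Rescaling gives the three integrals of s^-2 c(s) the weights z, 1 and -(1 + z). These sum to 0,
    so the common part drops out and only windows of bounded ratio at x and at y are left. *)
Let trunc_integral (x y : R) : 0 < x -> x <= y ->
  \int[mu]_(q in `[x, y]) h q =
  z * (A (z * x) ((1 + z) * x) - A (z * y) ((1 + z) * y)) +
  (A x ((1 + z) * x) - A y ((1 + z) * y)).
Proof.
move=> x0 xy.
have y0 : 0 < y by exact: lt_le_trans xy.
have E : \int[mu]_(q in `[x, y]) h q = \int[mu]_(q in `[x, y])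
    ((k q * c (z * q) + k q * c (1 * q)) - k q * c ((1 + z) * q)).
  by apply: eq_Rintegral => q _; rewrite /h mul1r; ring.
have z1 : 0 < 1 + z by rewrite addr_gt0.
rewrite E RintegralB//; [|exact: (integrableD _ (ikc _ _ x0) (ikc _ _ x0))|exact: ikc].
rewrite RintegralD//; [|exact: ikc|exact: ikc].
rewrite !A_scale// !mul1r.
have H1 : A (z * x) (z * y) - A ((1 + z) * x) ((1 + z) * y) =
          A (z * x) ((1 + z) * x) - A (z * y) ((1 + z) * y).
  apply/eqP; rewrite subr_eq addrAC -subr_eq opprK; apply/eqP.
  rewrite -!A_chasles ?mulr_gt0// ?ler_pM2l// ?ler_pM2r// ?lerDr//.
have H2 : A x y - A ((1 + z) * x) ((1 + z) * y) =
          A x ((1 + z) * x) - A y ((1 + z) * y).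
  apply/eqP; rewrite subr_eq addrAC -subr_eq opprK; apply/eqP.
  by rewrite -!A_chasles ?mulr_gt0// ?ler_pM2l// ?ler_peMl ?lerDl ?(ltW z0) ?(ltW x0) ?(ltW y0).
by rewrite -H1 -H2; ring.
Qed.

(** On a window at x of bounded ratio, c(s) = o(s) makes the integral of s^-2 c(s) tend to 0; on a
    window at y, boundedness of c gives O(1 / y). *)
Let trunc_small (e : R) : 0 < e -> exists2 d : R, 0 < d &
  forall x y, 0 < x < d -> d^-1 < y -> `|\int[mu]_(q in `[x, y]) h q| <= e.
Proof.
move=> e0; have z1 : 0 < 1 + z by rewrite addr_gt0.
have M1 : 0 < M + 1 by rewrite ltr_pwDr.
pose e1 := e / (2 * (1 + z)).
have e10 : 0 < e1 by rewrite divr_gt0// mulr_gt0.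
have [d1 d10 Hd1] := c_o e10.
pose d2 := e / (2 * ((M + 1) * (z^-1 + z))).
have zz0 : 0 < z^-1 + z by rewrite addr_gt0// invr_gt0.
have d20 : 0 < d2 by rewrite divr_gt0// !mulr_gt0.
exists (Num.min 1 (Num.min (d1 / (1 + z)) d2)).
  by rewrite !lt_min ltr01 d20 divr_gt0.
set d := Num.min _ _ => x y /andP[x0 xd] dy.
have d0 : 0 < d by exact: lt_trans xd.
have d1' : d <= 1 by rewrite /d ge_min lexx.
have dd1 : d <= d1 / (1 + z) by rewrite /d ge_min ge_min lexx orbT.
have dd2 : d <= d2 by rewrite /d ge_min ge_min lexx !orbT.
have y0 : 0 < y by apply: lt_trans dy; rewrite invr_gt0.
have y1 : 1 <= y by apply: le_trans (ltW dy); rewrite invf_ge1.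
have xy : x <= y by apply: le_trans (ltW xd) (le_trans d1' y1).
have xd1 : (1 + z) * x < d1.
  by rewrite mulrC -ltr_pdivlMr//; exact: lt_le_trans xd dd1.
have yV : y^-1 <= d2.
  by apply: le_trans dd2; rewrite -[leRHS]invrK lef_pV2 ?posrE ?invr_gt0// ltW.
rewrite trunc_integral//.
have small (s0 s1 : R) : 0 < s0 -> s0 <= s1 -> s1 < d1 -> `|A s0 s1| <= e1 / s0 * (s1 - s0).
  move=> s00 s01 s1d; apply: A_bound => // s /andP[s0s ss1].
  have sp : 0 < s by exact: lt_le_trans s0s.
  rewrite normrM kE// ger0_norm ?invr_ge0 ?exprn_ge0 ?(ltW sp)//.
  apply: (@le_trans _ _ (s ^- 2 * (e1 * s))).
    rewrite ler_wpM2l ?invr_ge0 ?exprn_ge0 ?(ltW sp)//.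
    by apply: Hd1; rewrite sp (le_lt_trans ss1).
  have -> : s ^- 2 * (e1 * s) = e1 / s by field; rewrite gt_eqF.
  by rewrite ler_pM2l// lef_pV2.
have large (s0 s1 : R) : 0 < s0 -> s0 <= s1 -> `|A s0 s1| <= (s0 ^- 2 * M) * (s1 - s0).
  move=> s00 s01; apply: A_bound => // s /andP[s0s ss1].
  rewrite normrM ger0_norm ?ppow_ge0//.
  by apply: ler_pM => //; [exact: ppow_ge0|exact: k_le].
have T1 : `|A (z * x) ((1 + z) * x)| <= e1 / z.
  apply: le_trans (small _ _ _ _ xd1) _; rewrite ?mulr_gt0// ?ler_pM2r ?lerDr//.
  by rewrite le_eqVlt; apply/orP; left; apply/eqP; field; rewrite !gt_eqF.
have T2 : `|A x ((1 + z) * x)| <= e1 * z.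
  apply: le_trans (small _ _ _ _ xd1) _ => //.
    by rewrite ler_peMl ?lerDl ?(ltW z0)// ltW.
  by rewrite le_eqVlt; apply/orP; left; apply/eqP; field; rewrite !gt_eqF.
have T3 : `|A (z * y) ((1 + z) * y)| <= M / (z ^+ 2) * y^-1.
  apply: le_trans (large _ _ _ _) _; rewrite ?mulr_gt0// ?ler_pM2r ?lerDr//.
  by rewrite le_eqVlt; apply/orP; left; apply/eqP; field; rewrite !gt_eqF.
have T4 : `|A y ((1 + z) * y)| <= M * z * y^-1.
  apply: le_trans (large _ _ _ _) _ => //.
    by rewrite ler_peMl ?lerDl ?(ltW z0)// ltW.
  by rewrite le_eqVlt; apply/orP; left; apply/eqP; field; rewrite !gt_eqF.
apply: (@le_trans _ _ (z * (e1 / z + M / (z ^+ 2) * y^-1) + (e1 * z + M * z * y^-1))).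
  apply: le_trans (ler_normD _ _) _; apply: lerD.
    rewrite normrM (ger0_norm (ltW z0)) ler_pM2l//.
    by apply: le_trans (ler_normB _ _) _; exact: lerD.
  by apply: le_trans (ler_normB _ _) _; exact: lerD.
have -> : z * (e1 / z + M / (z ^+ 2) * y^-1) + (e1 * z + M * z * y^-1) =
   e1 * (1 + z) + M * (z^-1 + z) * y^-1 by field; rewrite !gt_eqF.
have -> : e = e1 * (1 + z) + (M + 1) * (z^-1 + z) * d2.
  have -> : e1 * (1 + z) = e / 2 by rewrite /e1; field; rewrite gt_eqF.
  have E (m w : R) : 0 < m -> 0 < w -> m * w * (e / (2 * (m * w))) = e / 2.
    by move=> m0 w0; field; rewrite !gt_eqF.
  by rewrite /d2 E//; field.
rewrite lerD2l; apply: ler_pM => //; first by rewrite mulr_ge0// ltW.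
  by rewrite invr_ge0 ltW.
by rewrite ler_pM2r// lerDl.
Qed.

Lemma frullani0 : mu.-integrable setT (EFin \o h) -> \int[mu]_q h q = 0.
Proof.
move=> ih.
pose D (n : nat) := `[(n.+1%:R : R)^-1, n.+1%:R]%classic.
pose f_ n x := (((h \_ (D n)) x)%:E).
have mh : measurable_fun setT h by apply/measurable_EFinP; exact: measurable_int ih.
have mhk n : measurable_fun setT (f_ n).
  apply/measurable_EFinP; apply/(measurable_restrictT _ _).1; first exact: measurable_itv.
  exact: measurable_funTS.
have hneg x : x <= 0 -> h x = 0 by move=> x0; rewrite /h /k /ppow ltNge x0 mul0r.
have [] := @dominated_convergence _ _ _ mu setT measurableT f_ (EFin \o h) (abse \o (EFin \o h)) mhk.
- exact: measurable_int ih.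
- apply: aeW => x _ /=.
  apply: cvg_near_cst; near=> n; rewrite /f_ patchE.
  have [x0|x0] := ltP 0 x; last by case: ifP => _ //; rewrite hneg.
  rewrite ifT// inE /D/= in_itv/=; apply/andP; split.
    rewrite -[leRHS]invrK lef_pV2 ?posrE ?invr_gt0//.
    apply/ltW/(lt_trans (truncnS_gt _)); rewrite ltr_nat ltnS.
    by near: n; exact: nbhs_infty_gt.
  apply/ltW/(lt_trans (truncnS_gt _)); rewrite ltr_nat ltnS.
  by near: n; exact: nbhs_infty_gt.
- exact: integrable_abse.
- apply: aeW => x n _ /=; rewrite /f_ patchE; case: ifP => _ //=.
  by rewrite lee_fin; apply: le_trans (normr_ge0 (h x)); rewrite normr_le0; apply/eqP.
move=> _ _ cv.
have E n : (\int[mu]_x f_ n x = (\int[mu]_(x in D n) h x)%:E)%E.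
  rewrite /Rintegral fineK; last first.
    by apply: integrable_fin_num; [exact: measurable_itv|apply: integrableS ih => //; exact: measurable_itv].
  by rewrite [RHS]integral_mkcond; apply: eq_integral => x _; rewrite /f_ restrict_EFin.
have cv' : (\int[mu]_(x in D n) h x)%:E @[n --> \oo] --> (\int[mu]_x h x)%:E.
  rewrite {2}/Rintegral fineK; last exact: integrable_fin_num.
  by apply: cvg_trans cv; apply: near_eq_cvg; near=> n; rewrite /= E.
have cv1 : \int[mu]_(x in D n) h x @[n --> \oo] --> \int[mu]_x h x by exact: (fine_cvg cv').
apply: (@cvg_unique _ _ _ _ _ _ cv1) => //.
apply/cvgrPdist_le => e e0.
have [d d0 Hd] := trunc_small e0; near=> n; rewrite sub0r normrN.
have dn : d^-1 < n.+1%:R.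
  apply/(lt_trans (truncnS_gt _)); rewrite ltr_nat ltnS.
  by near: n; exact: nbhs_infty_gt.
apply: Hd => //; rewrite invr_gt0 ltr0n/=.
by rewrite -[ltRHS]invrK ltf_pV2 ?posrE ?invr_gt0.
Unshelve. all: by end_near. Qed.

End frullani.

(** * The generalized Lebesgue-Stieltjes integral and forward integrals *)

Section kernel_pairing.
Context {R : realType}.
Local Notation mu := (@lebesgue_measure R).
Variables (a : R) (a01 : 0 < a < 1).

Let k1 : R -> R := ppow (- (1 + a)).
Let k2 : R -> R := ppow (- (1 + (1 - a))).

(** The exponent 2 - a is written [1 + (1 - a)], so that k2 is the kernel k1 at order 1 - a and the
    same lemmas serve both. *)
Definition defect_kernel (c : R -> R) (z : R * R) : R :=
  k1 z.1 * k2 z.2 * (c z.1 + c z.2 - c (z.1 + z.2)).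

Lemma measurable_defect_kernel c : measurable_fun setT c ->
  measurable_fun setT (defect_kernel c).
Proof.
move=> mc; apply: measurable_funM.
  by apply: measurable_funM; [exact: (measurableT_comp (measurable_ppow _))|
    exact: (measurableT_comp (measurable_ppow _))].
apply: measurable_funB; first by apply: measurable_funD; exact: (measurableT_comp mc).
by apply: (measurableT_comp mc); exact: measurable_funD.
Qed.

Lemma ppowM (s x y : R) : 0 < y -> ppow s (y * x) = ppow s y * ppow s x.
Proof.
move=> y0; rewrite /ppow y0 pmulr_rgt0//; case: ifPn => x0; last by rewrite mulr0.
by rewrite powRM// ltW.
Qed.

(** In the coordinates p = z q, the two powers of total degree -3 and the Jacobian q leave q^-2
    whatever a is. This is where the order disappears, and the form that [frullani0] integrates to
    0. *)
Lemma defect_kernel_scale c (q z : R) : 0 < q ->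
  q * defect_kernel c (q * z, q) =
  k1 z * (ppow (-2) q * (c (z * q) + c q - c ((1 + z) * q))).
Proof.
move=> q0; rewrite /defect_kernel/= /k1 ppowM// (mulrC z) (mulrDl 1) mul1r (mulrC z).
rewrite (addrC q).
have E : q * (ppow (- (1 + a)) q * k2 q) = ppow (-2) q.
  rewrite /k2 !ppowE// -powRD; last by rewrite (gt_eqF q0) implybT.
  rewrite -{1}(powRr1 (ltW q0)) -powRD; last by rewrite (gt_eqF q0) implybT.
  by congr powR; ring.
by rewrite -E; ring.
Qed.

(** Integrate along rays: after p = z q and Fubini, the inner integral in q vanishes by [frullani0]
    for almost every z > 0. *)
Lemma defect_integral_eq0 (c : R -> R) (M : R) :
  measurable_fun setT c -> (forall r, `|c r| <= M) ->
  (forall e : R, 0 < e -> exists2 d : R, 0 < d & forall r, 0 < r < d -> `|c r| <= e * r) ->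
  (mu \x mu)%E.-integrable setT (EFin \o defect_kernel c) ->
  \int[mu]_p (\int[mu]_q defect_kernel c (p, q)) = 0.
Proof.
move=> mc cM co iN.
have mN := measurable_defect_kernel mc.
rewrite Rintegral_fubini//; last exact/integrable_prodP.
pose Q (w : R * R) := (if 0 < w.2 then w.2 * defect_kernel c (w.2 * w.1, w.2) else 0).
have mQ : measurable_fun setT Q.
  apply: measurable_fun_ifT => //; first exact: measurable_fun_ltr.
  apply: measurable_funM => //; apply: (measurableT_comp mN).
  by apply: measurable_fun_pair => //; exact: measurable_funM.
have N0 p q : q <= 0 -> defect_kernel c (p, q) = 0.
  by move=> q0; rewrite /defect_kernel/= /k2 /ppow (ltNge _ q) q0 mulr0 mul0r.
have mNq q : measurable_fun setT (fun p => defect_kernel c (p, q)).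
  by apply: (measurableT_comp mN); exact: measurable_fun_pair.
have mQq q : measurable_fun setT (fun z => Q (z, q)).
  by apply: (measurableT_comp mQ); exact: measurable_fun_pair.
have E1 q : \int[mu]_p defect_kernel c (p, q) = \int[mu]_z Q (z, q).
  have [q0|q0] := ltP 0 q; last first.
    by apply: eq_Rintegral => p _; rewrite /Q/= !N0// ltNge q0.
  rewrite -[LHS](Rintegral_affine 0 q0 (mNq q)) -RintegralZl_gt0//; last first.
    apply: (measurableT_comp (mNq q)); apply: measurable_funD => //; exact: mulrl_measurable.
  by apply: eq_Rintegral => z _; rewrite /Q/= q0 addr0.
have -> : \int[mu]_q \int[mu]_p defect_kernel c (p, q) = \int[mu]_q \int[mu]_z Q (z, q).
  by apply: eq_Rintegral => q _; exact: E1.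
have iQ : (\int[mu]_q \int[mu]_z `|Q (z, q)|%:E < +oo)%E.
  apply: le_lt_trans ((integrable_prodP2 mN).1 iN).
  rewrite le_eqVlt; apply/orP; left; apply/eqP; apply: eq_integral => q _.
  have [q0|q0] := ltP 0 q; last first.
    by apply: eq_integral => p _; rewrite /Q/= !N0// ltNge q0.
  rewrite -[RHS](@ge0_integral_affine _ _ q 0)//; last first.
    by apply/measurable_EFinP; apply: measurableT_comp => //; exact: mNq.
  rewrite -ge0_integralZl//=.
  - by apply: eq_integral => z _; rewrite /Q/= q0 addr0 normrM ger0_norm ?(ltW q0).
  - apply/measurable_EFinP; apply: measurableT_comp => //.
    apply: (measurableT_comp (mNq q)); apply: measurable_funD => //; exact: mulrl_measurable.
  - by rewrite lee_fin ltW.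
have iQ1 : (mu \x mu)%E.-integrable setT (EFin \o Q).
  by apply/integrable_prodP2.
rewrite -Rintegral_fubini//; last exact/integrable_prodP.
rewrite (@Rintegral_ae_eq _ _ (cst 0))//.
- by rewrite Rintegral_cst//= mul0r.
- exact: measurable_Rintegral_param.
apply: filterS (ae_integrable1 iQ1) => z iz /=.
have [z0|z0] := ltP 0 z; last first.
  transitivity (\int[mu]_q (cst 0 q : R)); last by rewrite Rintegral_cst//= mul0r.
  apply: eq_Rintegral => q _; rewrite /Q/=; case: ifPn => // q0.
  by rewrite defect_kernel_scale// /k1 /ppow (ltNge _ z) z0 mul0r.
pose h q := ppow (-2) q * (c (z * q) + c q - c ((1 + z) * q)).
have QE q : Q (z, q) = k1 z * h q.
  rewrite /Q/=; case: ifPn => q0; first by rewrite defect_kernel_scale.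
  by rewrite /h /ppow (negbTE q0) mul0r mulr0.
have k1z : 0 < k1 z by rewrite /k1 ppowE// powR_gt0.
have ih : mu.-integrable setT (EFin \o h).
  have := integrableZl measurableT (k1 z)^-1 iz; apply: eq_integrable => // q _ /=.
  by rewrite QE -EFinM mulKf// gt_eqF.
transitivity (\int[mu]_q (k1 z * h q)); first by apply: eq_Rintegral => q _; rewrite QE.
by rewrite RintegralZl// (frullani0 mc cM co z0 ih) mulr0.
Qed.

(** The reference function: it has slope 1 at 0, and its defect factors as (1 - exp(-p)) (1 -
    exp(-q)), so that its double integral is a product of two Gamma integrals. *)
Let c1 (r : R) := if 0 < r then 1 - expR (- r) else 0.

Let mc1 : measurable_fun setT c1.
Proof.
apply: measurable_fun_ifT => //; first exact: measurable_fun_ltr.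
apply: measurable_funB => //; apply: measurableT_comp => //; exact: measurable_expR.
Qed.

Let N1E p q : defect_kernel c1 (p, q) =
   (k1 p * (1 - expR (- p))) * (k2 q * (1 - expR (- q))).
Proof.
rewrite /defect_kernel/=.
have [p0|p0] := ltP 0 p; last by rewrite /k1 /ppow (ltNge _ p) p0 !mul0r.
have [q0|q0] := ltP 0 q; last by rewrite /k2 /ppow (ltNge _ q) q0 mulr0 !mul0r mulr0.
by rewrite /c1 p0 q0 addr_gt0// (opprD p) expRD; ring.
Qed.

Let me1 : measurable_fun setT (fun p => k1 p * (1 - expR (- p))).
Proof.
apply: measurable_funM; first exact: measurable_ppow.
apply: measurable_funB => //; apply: measurableT_comp => //; exact: measurable_expR.
Qed.

Let me2 : measurable_fun setT (fun p => k2 p * (1 - expR (- p))).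
Proof.
apply: measurable_funM; first exact: measurable_ppow.
apply: measurable_funB => //; apply: measurableT_comp => //; exact: measurable_expR.
Qed.

Let e_ge0 (s p : R) : 0 <= ppow s p * (1 - expR (- p)).
Proof.
have [p0|p0] := ltP 0 p; last by rewrite /ppow ltNge p0 mul0r.
by rewrite mulr_ge0 ?ppow_ge0// subr_ge0 -expR0 ler_expR oppr_le0 ltW.
Qed.

Let G1 := Gamma (1 - a) / a.
Let G2 := Gamma a / (1 - a).

Let I1 : (\int[mu]_p (k1 p * (1 - expR (- p)))%:E = G1%:E)%E.
Proof. by have [] := integral_gamma_kernel a01. Qed.

Let I2 : (\int[mu]_p (k2 p * (1 - expR (- p)))%:E = G2%:E)%E.
Proof.
have a01' : 0 < 1 - a < 1 by move: a01 => /andP[? ?]; apply/andP; split; lra.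
by have [] := integral_gamma_kernel a01'; rewrite subKr.
Qed.

Lemma defect_integral_eval (c : R -> R) (M l : R) :
  measurable_fun setT c -> (forall r, `|c r| <= M) ->
  (forall e : R, 0 < e -> exists2 d : R, 0 < d &
     forall r, 0 < r < d -> `|c r - l * r| <= e * r) ->
  (mu \x mu)%E.-integrable setT (EFin \o defect_kernel c) ->
  \int[mu]_p (\int[mu]_q defect_kernel c (p, q)) =
    l * (Gamma (1 - a) / a * (Gamma a / (1 - a))).
Proof.
move=> mc cM cl iN.
have mN1 := measurable_defect_kernel mc1.
have iN1 : (mu \x mu)%E.-integrable setT (EFin \o defect_kernel c1).
  apply/integrable_prodP => //.
  apply: (@le_lt_trans _ _ (\int[mu]_p ((k1 p * (1 - expR (- p)))%:E * G2%:E))%E).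
    rewrite le_eqVlt; apply/orP; left; apply/eqP; apply: eq_integral => p _.
    rewrite -I2 -ge0_integralZl//=; last 3 first.
    - exact/measurable_EFinP.
    - by move=> q _; rewrite lee_fin e_ge0.
    - by rewrite lee_fin e_ge0.
    by apply: eq_integral => q _; rewrite N1E normrM !ger0_norm ?e_ge0.
  rewrite ge0_integralZr//; last 3 first.
  - exact/measurable_EFinP.
  - by move=> q _; rewrite lee_fin e_ge0.
  - by rewrite -I2; apply: integral_ge0 => q _; rewrite lee_fin e_ge0.
  by rewrite I1 -EFinM ltry.
(* Subtracting l c1 leaves slope 0 at the origin, so [defect_integral_eq0] applies to c0 and only
   the explicit integral of c1 remains. *)
pose c0 r := c r - l * c1 r.
have mc0 : measurable_fun setT c0 by apply: measurable_funB => //; exact: measurable_funM.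
have N0E z : defect_kernel c0 z = defect_kernel c z - l * defect_kernel c1 z.
  by rewrite /defect_kernel /c0; ring.
have ilN1 : (mu \x mu)%E.-integrable setT (EFin \o (fun z => l * defect_kernel c1 z)).
  by have := integrableZl measurableT l iN1; apply: eq_integrable => // q _ /=.
have iN0 : (mu \x mu)%E.-integrable setT (EFin \o defect_kernel c0).
  have := integrableB measurableT iN ilN1; apply: eq_integrable => // z _ /=.
  by rewrite N0E.
have c1_b r : `|c1 r| <= 1.
  rewrite /c1; case: ifPn => r0; last by rewrite normr0.
  rewrite ger0_norm ?gerBl ?expR_ge0//.
  by rewrite subr_ge0 -expR0 ler_expR oppr_le0 ltW.
have := @defect_integral_eq0 c0 (M + `|l|) mc0 _ _ iN0.
rewrite Rintegral_prod//; last exact: measurable_defect_kernel.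
rewrite (_ : \int[_]_z _ = \int[(mu \x mu)%E]_z (defect_kernel c z - l * defect_kernel c1 z)); last first.
  by apply: eq_Rintegral => z _; rewrite N0E.
rewrite RintegralB// RintegralZl// => H.
rewrite Rintegral_prod//; last exact: measurable_defect_kernel.
have {}H := subr0_eq (H _ _).
rewrite H.
- congr (_ * _); rewrite -Rintegral_prod//.
  transitivity (\int[mu]_p ((k1 p * (1 - expR (- p))) * G2)).
    apply: eq_Rintegral => p _.
    rewrite /Rintegral; under eq_integral do rewrite N1E EFinM.
    rewrite ge0_integralZl//=; last 3 first.
    - exact/measurable_EFinP.
    - by move=> q _; rewrite lee_fin e_ge0.
    - by rewrite lee_fin e_ge0.
    by rewrite I2.
  rewrite /Rintegral; under eq_integral do rewrite EFinM.
  rewrite ge0_integralZr//=; last 3 first.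
  - exact/measurable_EFinP.
  - by move=> q _; rewrite lee_fin e_ge0.
  - by rewrite -I2; apply: integral_ge0 => q _; rewrite lee_fin e_ge0.
  by rewrite I1.
- move=> r; rewrite /c0; apply: le_trans (ler_normB _ _) _; apply: lerD => //.
  by rewrite normrM ler_piMr.
move=> e e0; have e20 : 0 < e / 2 by rewrite divr_gt0.
have [d d0 Hd] := cl _ e20.
exists (Num.min d (e / (2 * (`|l| + 1)))).
  by rewrite lt_min d0 divr_gt0// mulr_gt0// ltr_wpDl.
move=> r /andP[r0]; rewrite lt_min => /andP[rd re].
rewrite (_ : c0 r = (c r - l * r) + l * (r - c1 r)); last by rewrite /c0; ring.
rewrite (splitr e) mulrDl; apply: le_trans (ler_normD _ _) _; apply: lerD.
  by apply: Hd; rewrite r0.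
rewrite normrM /c1 r0.
have B1 : `|r - (1 - expR (- r))| <= r ^+ 2.
  have H1 := expR_ge1Dx (- r); have H2 := expR_ge1Dx r.
  rewrite ger0_norm; last by lra.
  have r10 : 0 < 1 + r by lra.
  have : expR (- r) <= (1 + r)^-1 by rewrite expRN lef_pV2 ?posrE ?expR_gt0.
  have : (1 + r)^-1 <= 1 - r + r ^+ 2.
    rewrite -[leLHS]mul1r ler_pdivrMr//.
    have -> : (1 - r + r ^+ 2) * (1 + r) = 1 + r ^+ 3 by ring.
    by rewrite lerDl exprn_ge0// ltW.
  by lra.
apply: (@le_trans _ _ (`|l| * r ^+ 2)); first exact: ler_wpM2l.
rewrite expr2 mulrA ler_pM2r//.
have : r * (2 * (`|l| + 1)) < e by rewrite -ltr_pdivlMr// mulr_gt0// ltr_wpDl.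
have := normr_ge0 l; nra.
Qed.

End kernel_pairing.

(** * Fubini for an integrable factor paired with an essentially bounded one *)

Section bilinear_fubini.
Context {R : realType}.
Local Notation mu := (@lebesgue_measure R).

Lemma le_normr_Rintegral_abs (f : R -> R) : measurable_fun setT f ->
  (`|\int[mu]_x f x|%:E <= \int[mu]_x `|f x|%:E)%E.
Proof.
move=> mf.
have := @le_abse_integral _ _ _ mu setT (EFin \o f) measurableT.
move=> /(_ (proj2 (measurable_EFinP _ _) mf)) H.
rewrite /Rintegral; case: (\int[mu]_x (f x)%:E)%E H => [r| |] H //=;
  by rewrite ?normr0; apply: integral_ge0.
Qed.

Variables (F G E : R * R -> R) (M : R).
Hypotheses (mF : measurable_fun setT F) (mG : measurable_fun setT G)
  (mE : measurable_fun setT E).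
Hypothesis iF : (\int[mu]_x \int[mu]_p `|F (x, p)|%:E < +oo)%E.
Hypothesis M0 : 0 <= M.
Hypothesis GM : {ae mu, forall x, (\int[mu]_q `|G (x, q)|%:E <= M%:E)%E}.
Hypothesis EE : forall p q, E (p, q) = \int[mu]_x (F (x, p) * G (x, q)).

Let iF' : (mu \x mu)%E.-integrable setT (EFin \o F).
Proof. exact/integrable_prodP. Qed.

Let mFp p : measurable_fun setT (fun x => F (x, p)).
Proof. by apply: (measurableT_comp mF); exact: measurable_fun_pair. Qed.
Let mFx x : measurable_fun setT (fun p => F (x, p)).
Proof. by apply: (measurableT_comp mF); exact: measurable_fun_pair. Qed.
Let mGq q : measurable_fun setT (fun x => G (x, q)).
Proof. by apply: (measurableT_comp mG); exact: measurable_fun_pair. Qed.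
Let mGx x : measurable_fun setT (fun q => G (x, q)).
Proof. by apply: (measurableT_comp mG); exact: measurable_fun_pair. Qed.

Let mabs (H : R * R -> R) : measurable_fun setT H ->
  measurable_fun setT (fun x => \int[mu]_q `|H (x, q)|%:E)%E.
Proof.
move=> mH; have mA : measurable_fun setT (fun z => `|H z|%:E).
  by apply/measurable_EFinP; exact: measurableT_comp.
by apply: (measurable_integral1 mA) => z; rewrite lee_fin.
Qed.

Let mabs2 (H : R * R -> R) : measurable_fun setT H ->
  measurable_fun setT (fun p => \int[mu]_x `|H (x, p)|%:E)%E.
Proof.
move=> mH; have mA : measurable_fun setT (fun z => `|H z|%:E).
  by apply/measurable_EFinP; exact: measurableT_comp.
by apply: (measurable_integral2 mA) => z; rewrite lee_fin.
Qed.

Let FG_le (h : R -> R) : measurable_fun setT h ->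
  (\int[mu]_x \int[mu]_q `|h x * G (x, q)|%:E <= M%:E * \int[mu]_x `|h x|%:E)%E.
Proof.
move=> mh; rewrite -ge0_integralZl//=; last first.
  by apply/measurable_EFinP; exact: measurableT_comp.
have mhG : measurable_fun setT (fun z : R * R => h z.1 * G z).
  by apply: measurable_funM => //; exact: measurableT_comp.
apply: ae_ge0_le_integral => //.
- by move=> x _; apply: integral_ge0.
- exact: (mabs mhG).
- by move=> x _; rewrite mule_ge0// lee_fin.
- apply: measurable_funeM => //.
  by apply/measurable_EFinP; exact: measurableT_comp.
case: GM => N [mN N0 GN]; exists N; split => // x /= nfg; apply: GN => /= fgx.
apply: nfg => _; under eq_integral do rewrite normrM EFinM.
rewrite ge0_integralZl//=; last first.
  by apply/measurable_EFinP; apply: measurableT_comp => //; exact: mGx.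
by rewrite muleC lee_wpmul2r// lee_fin.
Qed.

(** By Tonelli and the almost sure bound on G, the integral of |E(p, .)| is at most M times that of
    |F(., p)|, which is integrable in p. The hypotheses on F and G mirror the L_1 and L_oo
    conditions on the two fractional derivatives. *)
Lemma integrable_bilinear : (mu \x mu)%E.-integrable setT (EFin \o E).
Proof.
apply/integrable_prodP => //.
apply: (@le_lt_trans _ _ (\int[mu]_p (M%:E * \int[mu]_x `|F (x, p)|%:E))%E); last first.
  rewrite ge0_integralZl//=; last 2 first.
  - exact: mabs2.
  - by move=> p _; exact: integral_ge0.
  rewrite lte_mul_pinfty//.
  have := (integrable_prodP2 mF).1 iF'; exact.
apply: ge0_le_integral => //.
- by move=> p _; exact: integral_ge0.
- exact: mabs.
- by apply: measurable_funeM; exact: mabs2.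
move=> p _; apply: le_trans (FG_le (mFp p)).
have mFG : measurable_fun setT (fun z : R * R => (F (z.1, p) * G z)).
  by apply: measurable_funM => //; apply: (measurableT_comp (mFp p)).
have mFGa : measurable_fun setT (fun z : R * R => `|F (z.1, p) * G z|%:E).
  by apply/measurable_EFinP; apply: measurableT_comp.
have -> : (\int[mu]_x \int[mu]_q `|F (x, p) * G (x, q)|%:E =
    \int[mu]_q \int[mu]_x `|F (x, p) * G (x, q)|%:E)%E.
  by apply: (integral_tonelli mFGa) => z; rewrite lee_fin.
apply: ge0_le_integral => //.
- apply/measurable_EFinP; apply: measurableT_comp => //.
  by apply: (measurableT_comp mE); exact: measurable_fun_pair.
- exact: (mabs2 mFG).
move=> q _; rewrite EE; apply: le_normr_Rintegral_abs.
by apply: measurable_funM.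
Qed.

Let psi x := \int[mu]_q G (x, q).

Let mpsi : measurable_fun setT psi. Proof. exact: measurable_Rintegral_param. Qed.

Let psi_M : {ae mu, forall x, `|psi x| <= M}.
Proof.
case: GM => N [mN N0 GN]; exists N; split => // x /= nfg; apply: GN => /= fgx.
apply: nfg; rewrite -lee_fin; apply: le_trans fgx.
exact: le_normr_Rintegral_abs.
Qed.

(** The x-integral moves inside in two planar exchanges: past p with [psi] kept as a bounded factor,
    then past q for almost every p. *)
Lemma bilinear_fubini :
  \int[mu]_x ((\int[mu]_p F (x, p)) * (\int[mu]_q G (x, q))) =
  \int[mu]_p (\int[mu]_q E (p, q)).
Proof.
have mFpsi : measurable_fun setT (fun z : R * R => F z * psi z.1).
  by apply: measurable_funM => //; exact: measurableT_comp.
transitivity (\int[mu]_x \int[mu]_p (F (x, p) * psi x)).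
  apply: Rintegral_ae_eq.
  - by apply: measurable_funM => //; exact: measurable_Rintegral_param.
  - exact: (measurable_Rintegral_param mFpsi).
  apply: filterS (ae_integrable1 iF') => x ix; rewrite RintegralZr//.
rewrite (Rintegral_fubini mFpsi); last first.
  apply: (@le_lt_trans _ _ (\int[mu]_x (M%:E * \int[mu]_p `|F (x, p)|%:E))%E); last first.
    rewrite ge0_integralZl//=; last 2 first.
    - exact: mabs.
    - by move=> p _; exact: integral_ge0.
    by rewrite lte_mul_pinfty//.
  apply: ae_ge0_le_integral => //.
  - by move=> x _; exact: integral_ge0.
  - exact: (mabs mFpsi).
  - by move=> x _; rewrite mule_ge0// ?lee_fin// integral_ge0.
  - by apply: measurable_funeM; exact: mabs.
  case: psi_M => N [mN N0 GN]; exists N; split => // x /= nfg; apply: GN => /= fgx.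
  apply: nfg => _; under eq_integral do rewrite normrM EFinM.
  rewrite ge0_integralZr//=; last first.
    by apply/measurable_EFinP; apply: measurableT_comp => //; exact: mFx.
  by rewrite muleC lee_wpmul2r// ?lee_fin// integral_ge0.
apply: Rintegral_ae_eq.
- apply: (@measurable_Rintegral_param _ _ _ (fun z => F (z.2, z.1) * psi z.2)).
  exact: (measurableT_comp mFpsi (@measurable_swap _ _ _ _)).
- exact: measurable_Rintegral_param.
apply: filterS (ae_integrable2 iF') => p ip.
have mFG : measurable_fun setT (fun z : R * R => (F (z.1, p) * G z)).
  by apply: measurable_funM => //; apply: (measurableT_comp (mFp p)).
transitivity (\int[mu]_x \int[mu]_q (F (x, p) * G (x, q))); last first.
  rewrite (Rintegral_fubini mFG).
    by apply: eq_Rintegral => q _; rewrite EE.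
  apply: le_lt_trans (FG_le (mFp p)) _; rewrite lte_mul_pinfty//.
  by have /integrableP[] := ip.
apply: Rintegral_ae_eq.
- by apply: measurable_funM => //; exact: mFp.
- exact: (measurable_Rintegral_param mFG).
case: GM => N [mN N0 GN]; exists N; split => // x /= nfg; apply: GN => /= fgx.
apply: nfg; rewrite /psi RintegralZl//; apply/integrableP; split.
  by apply/measurable_EFinP; exact: mGx.
exact: le_lt_trans fgx (ltry _).
Qed.

End bilinear_fubini.

(* Both fractional derivatives have the form of the right-hand side of frac_split:
   beyond the end of the interval (p >= y) the increment of the function extended
   by 0 is the constant v, which produces the boundary term v / y^s. *)
Section frac_split.
Context {R : realType}.
Local Notation mu := (@lebesgue_measure R).

Lemma Rintegral_opp (f : R -> R) : measurable_fun setT f ->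
  \int[mu]_x f (- x) = \int[mu]_x f x.
Proof.
move=> mf; rewrite !RintegralE//; last exact: measurableT_comp.
have mp : measurable_fun setT (fun x => (Num.max (f x) 0)%:E).
  by apply/measurable_EFinP/measurable_maxr.
have mn : measurable_fun setT (fun x => (Num.max (- f x) 0)%:E).
  by apply/measurable_EFinP/measurable_maxr => //; exact: measurableT_comp.
rewrite -(ge0_integral_opp mp); last by move=> x; rewrite lee_fin le_max lexx orbT.
by rewrite -(ge0_integral_opp mn)// => x; rewrite lee_fin le_max lexx orbT.
Qed.

Lemma Rintegral_reflect (f : R -> R) (x : R) : measurable_fun setT f ->
  \int[mu]_u f (x - u) = \int[mu]_p f p.
Proof.
move=> mf; rewrite -(Rintegral_opp mf).
have mg : measurable_fun setT (fun p : R => f (- p)) by exact: measurableT_comp.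
rewrite -(Rintegral_affine (- x) ltr01 mg) mul1r; apply: eq_Rintegral => u _.
by rewrite mul1r opprD opprK addrC.
Qed.

Lemma Rintegral_translate (f : R -> R) (x : R) : measurable_fun setT f ->
  \int[mu]_u f (u + x) = \int[mu]_p f p.
Proof.
move=> mf; rewrite -(Rintegral_affine x ltr01 mf) mul1r; apply: eq_Rintegral => u _.
by rewrite mul1r.
Qed.

Lemma ge0_integral_reflect (f : R -> \bar R) (x : R) : measurable_fun setT f ->
  (forall p, 0 <= f p)%E ->
  (\int[mu]_u f (x - u)%R = \int[mu]_p f p)%E.
Proof.
move=> mf f0; rewrite -(ge0_integral_opp mf)//.
have mg : measurable_fun setT (fun p : R => f (- p)%R) by exact: measurableT_comp.
rewrite -(ge0_integral_affine (- x) ltr01 mg)// mul1e; apply: eq_integral => u _.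
by rewrite mul1r opprD opprK addrC.
Qed.

Lemma ge0_integral_translate (f : R -> \bar R) (x : R) : measurable_fun setT f ->
  (forall p, 0 <= f p)%E ->
  (\int[mu]_u f (u + x)%R = \int[mu]_p f p)%E.
Proof.
move=> mf f0; rewrite -(ge0_integral_affine x ltr01 mf)// mul1e; apply: eq_integral => u _.
by rewrite mul1r.
Qed.

Variables (phi : R -> R) (s y v : R).
Hypotheses (mphi : measurable_fun setT phi) (s0 : 0 < s) (y0 : 0 < y).
Hypothesis phiv : forall p, y <= p -> phi p = v.

Let k : R -> R := ppow (- (1 + s)).
Let mk : measurable_fun setT k. Proof. exact: measurable_ppow. Qed.

Let tailE : (\int[mu]_p (if y < p then k p else 0)%:E = (y `^ (- s) / s)%:E)%E.
Proof.
rewrite -integral_powR_tail// (@integral_ifE _ `]y, +oo[%classic (fun p => y < p)); last first.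
  by move=> p /=; rewrite in_itv/= andbT.
apply: eq_integral => p _; case: ifP => // yp.
by rewrite /k ppowE// (lt_trans y0).
Qed.

Let low p := if p < y then phi p * k p else 0.
Let high p := if y < p then k p else 0.

Let mlow : measurable_fun setT low.
Proof.
apply: measurable_fun_ifT => //; first exact: measurable_fun_ltr.
exact: measurable_funM.
Qed.

Let mhigh : measurable_fun setT high.
Proof. by apply: measurable_fun_ifT => //; exact: measurable_fun_ltr. Qed.

Let splitE : {ae mu, forall p, phi p * k p = low p + v * high p}.
Proof.
exists [set y]; split => //; first exact: lebesgue_measure_set1.
move=> p /= np; apply: contrapT => py; apply: np; rewrite /low /high.
have [py1|py1|//] := ltgtP p y; first by rewrite mulr0 addr0.
by rewrite phiv ?ltW// add0r.
Qed.

Lemma frac_split_abs :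
  (s%:E * \int[mu]_p (`|phi p| * k p)%:E =
   (`|v| / y `^ s)%:E + s%:E * \int[mu]_p `|low p|%:E)%E.
Proof.
have mak : measurable_fun setT (fun p => `|phi p| * k p).
  by apply: measurable_funM => //; exact: measurableT_comp.
have mal : measurable_fun setT (fun p => `|low p|) by exact: measurableT_comp.
have h0 p : 0 <= high p by rewrite /high; case: ifP => // _; exact: ppow_ge0.
rewrite (_ : (\int[mu]_p (`|phi p| * k p)%:E =
    \int[mu]_p (`|low p|%:E + (`|v| * high p)%:E))%E); last first.
  apply: ge0_ae_eq_integral => //.
  - exact/measurable_EFinP.
  - by apply: emeasurable_funD; apply/measurable_EFinP => //; exact: measurable_funM.
  - by move=> p _; rewrite lee_fin mulr_ge0 ?ppow_ge0.
  - by move=> p _; rewrite adde_ge0// lee_fin mulr_ge0.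
  exists [set y]; split => //; first exact: lebesgue_measure_set1.
  move=> p /= np; apply: contrapT => py; apply: np => _; rewrite /low /high -EFinD.
  have [py1|py1|//] := ltgtP p y.
    by rewrite mulr0 addr0 normrM (ger0_norm (ppow_ge0 _ _)).
  by rewrite phiv ?ltW// normr0 add0r.
rewrite ge0_integralD//=; last 3 first.
- exact/measurable_EFinP.
- by move=> p _; rewrite lee_fin mulr_ge0.
- by apply/measurable_EFinP; exact: measurable_funM.
under [X in (_ + X)%E]eq_integral do rewrite EFinM.
rewrite ge0_integralZl//=; last 2 first.
- exact/measurable_EFinP.
- by move=> p _; rewrite lee_fin.
rewrite tailE ge0_muleDr//; last 2 first.
- exact: integral_ge0.
- by rewrite -EFinM lee_fin !mulr_ge0 ?powR_ge0// invr_ge0 ltW.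
rewrite addeC; congr (_ + _)%E; rewrite -!EFinM; congr EFin.
by rewrite powRN; field; rewrite !gt_eqF// powR_gt0.
Qed.

Lemma frac_split :
  (\int[mu]_p (`|phi p| * k p)%:E < +oo)%E ->
  s * \int[mu]_p (phi p * k p) = v / y `^ s + s * \int[mu]_p low p.
Proof.
move=> fin.
have ik : mu.-integrable setT (EFin \o (fun p => phi p * k p)).
  apply/integrableP; split; first by apply/measurable_EFinP; exact: measurable_funM.
  apply: le_lt_trans fin; rewrite le_eqVlt; apply/orP; left; apply/eqP.
  by apply: eq_integral => p _ /=; rewrite normrM (ger0_norm (ppow_ge0 _ _)).
have il : mu.-integrable setT (EFin \o low).
  apply: le_integrable ik => //; first exact/measurable_EFinP.
  move=> p _ /=; rewrite lee_fin /low; case: ifP => // _.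
  by rewrite normr0.
have ih : mu.-integrable setT (EFin \o high).
  apply/integrableP; split; first exact/measurable_EFinP.
  rewrite (_ : (\int[mu]_x _)%E = (\int[mu]_p (if (y < p)%R then k p else 0%R)%:E)%E).
    by rewrite tailE ltry.
  apply: eq_integral => p _ /=; rewrite /high; case: ifP; rewrite ?normr0// => _.
  by rewrite (ger0_norm (ppow_ge0 _ _)).
have ivh : mu.-integrable setT (EFin \o (fun p => v * high p)).
  by have := integrableZl measurableT v ih; apply: eq_integrable => // q _ /=.
rewrite (@Rintegral_ae_eq _ _ (fun p => low p + v * high p))//.
- rewrite RintegralD// RintegralZl// mulrDr addrC; congr (_ + _).
  rewrite {1}/Rintegral /high tailE/= powRN.
  by field; rewrite !gt_eqF// powR_gt0.
- exact: measurable_funM.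
- by apply: measurable_funD => //; exact: measurable_funM.
Qed.

End frac_split.

Lemma onem_in01 {R : realType} (a : R) : 0 < a < 1 -> 0 < 1 - a < 1.
Proof. by move=> /andP[? ?]; apply/andP; split; lra. Qed.

Lemma gamma_factors_mul {R : realType} (a b x y u v : R) :
  x^-1 * (a * u) * (y^-1 * (b * v)) = (a / x * (b / y)) * (u * v).
Proof. ring. Qed.

Lemma gamma_factors_cancel {R : realType} (a b x y l : R) :
  0 < a -> 0 < b -> 0 < x -> 0 < y ->
  (a / x * (b / y)) * (l * (x / a * (y / b))) = l.
Proof. by move=> a0 b0 x0 y0; field; rewrite !gt_eqF. Qed.

(** * From fractional derivatives to the forward integral *)

Section forward_integral.
Context {R : realType}.
Local Notation mu := (@lebesgue_measure R).

(** Extension by 0 turns the boundary terms of the fractional derivatives into tails of increment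
    integrals. Applied to g - g hi, it amounts to freezing g at the value g hi beyond hi. *)
Definition cut (lo hi : R) (f : R -> R) (x : R) : R := if lo < x < hi then f x else 0.

Definition fwd_integral (lo hi : R) (f g : R -> R) (r : R) : R :=
  \int[mu]_x (cut lo hi f x *
    (cut lo hi (fun y => g y - g hi) (x + r) - cut lo hi (fun y => g y - g hi) x)).

Lemma measurable_cut (lo hi : R) (f : R -> R) :
  measurable_fun `[lo, hi] f -> measurable_fun setT (cut lo hi f).
Proof.
move=> mf.
have -> : cut lo hi f = f \_ `]lo, hi[.
  by apply/funext => x; rewrite /cut patchE mem_setE in_itv/=.
apply/(measurable_restrictT _ _).1; first exact: measurable_itv.
by apply: measurable_funS mf => //; exact: subset_itv_oo_cc.
Qed.

(** Substitute p = x - u; for p >= x - lo the cut function vanishes and [frac_split] gives back the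
    boundary term. The first identity holds in [0, +oo], and it is what yields the finiteness that
    the second one assumes. *)
Lemma frac_deriv_left (al lo hi : R) (f : R -> R) (x : R) :
  0 < al < 1 -> measurable_fun `[lo, hi] f -> lo < x < hi ->
  (((`|f x| / (x - lo) `^ al)%:E + al%:E * \int[mu]_(u in `]lo, x[)
        (`|f x - f u| / (x - u) `^ (1 + al))%:E) =
   al%:E * \int[mu]_p (`|cut lo hi f x - cut lo hi f (x - p)| * ppow (- (1 + al)) p)%:E)%E /\
  ((\int[mu]_p (`|cut lo hi f x - cut lo hi f (x - p)| * ppow (- (1 + al)) p)%:E < +oo)%E ->
   left_frac_deriv al lo f x = (Gamma (1 - al))^-1 * (al *
     \int[mu]_p ((cut lo hi f x - cut lo hi f (x - p)) * ppow (- (1 + al)) p))).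
Proof.
move=> /andP[al0 al1] mf /andP[lox xhi].
pose phi p := cut lo hi f x - cut lo hi f (x - p).
have mphi : measurable_fun setT phi.
  apply: measurable_funB => //; apply: (measurableT_comp (measurable_cut mf)).
  exact: measurable_funB.
have cx : cut lo hi f x = f x by rewrite /cut lox xhi.
have y0 : 0 < x - lo by rewrite subr_gt0.
have phiv p : x - lo <= p -> phi p = f x.
  by move=> h; rewrite /phi cx {1}/cut ltNge (_ : x - p <= lo)/= ?subr0//; lra.
pose low p := if p < x - lo then phi p * ppow (- (1 + al)) p else 0.
have mlow : measurable_fun setT low.
  apply: measurable_fun_ifT => //; first exact: measurable_fun_ltr.
  by apply: measurable_funM => //; exact: measurable_ppow.
have lowE u : low (x - u) = if lo < u < x then (f x - f u) / (x - u) `^ (1 + al) else 0.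
  rewrite /low; have -> : (x - u < x - lo) = (lo < u) by apply/idP/idP; lra.
  case: ifPn => //= lou; rewrite /phi cx subKr /ppow subr_gt0.
  case: ifPn => ux; last by rewrite mulr0.
  by rewrite /cut lou (lt_trans ux)//= powRN.
split.
  rewrite (frac_split_abs mphi al0 y0 phiv); congr (_ + _ * _)%E.
  rewrite -(ge0_integral_reflect x); last 2 first.
  - by apply/measurable_EFinP; exact: measurableT_comp.
  - by move=> p; rewrite lee_fin.
  rewrite (@integral_ifE _ `]lo, x[%classic (fun u => lo < u < x)); last first.
    by move=> u /=; rewrite in_itv/=.
  apply: eq_integral => u _; rewrite -/(low (x - u)) lowE.
  case: ifPn => [_|]; last by rewrite normr0.
  by rewrite normrM (@ger0_norm _ ((x - u) `^ (1 + al))^-1)// invr_ge0 powR_ge0.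
move=> fin; rewrite /left_frac_deriv; congr (_ * _).
rewrite (frac_split mphi al0 y0 phiv fin); congr (_ + _ * _).
rewrite -(Rintegral_reflect x mlow) Rintegral_mkcond; apply: eq_Rintegral => u _.
by rewrite lowE patchE mem_setE in_itv/=.
Qed.

Lemma frac_deriv_right (al lo hi : R) (g : R -> R) (x : R) :
  0 < al < 1 -> measurable_fun `[lo, hi] g -> lo < x < hi ->
  (((`|g x| / (hi - x) `^ (1 - al))%:E + (1 - al)%:E * \int[mu]_(u in `]x, hi[)
        (`|g x - g u| / (u - x) `^ (2 - al))%:E) =
   (1 - al)%:E * \int[mu]_p (`|cut lo hi g x - cut lo hi g (x + p)| * ppow (- (1 + (1 - al))) p)%:E)%E /\
  ((\int[mu]_p (`|cut lo hi g x - cut lo hi g (x + p)| * ppow (- (1 + (1 - al))) p)%:E < +oo)%E ->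
   right_frac_deriv al hi g x = (Gamma al)^-1 * ((1 - al) *
     \int[mu]_p ((cut lo hi g x - cut lo hi g (x + p)) * ppow (- (1 + (1 - al))) p))).
Proof.
move=> /andP[al0 al1] mg /andP[lox xhi].
pose phi p := cut lo hi g x - cut lo hi g (x + p).
have mphi : measurable_fun setT phi.
  apply: measurable_funB => //; apply: (measurableT_comp (measurable_cut mg)).
  exact: measurable_funD.
have be0 : 0 < 1 - al by rewrite subr_gt0.
have cx : cut lo hi g x = g x by rewrite /cut lox xhi.
have y0 : 0 < hi - x by rewrite subr_gt0.
have phiv p : hi - x <= p -> phi p = g x.
  by move=> h; rewrite /phi cx {1}/cut (ltNge _ hi) (_ : hi <= x + p)/= ?andbF ?subr0//; lra.
pose low p := if p < hi - x then phi p * ppow (- (1 + (1 - al))) p else 0.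
have mlow : measurable_fun setT low.
  apply: measurable_fun_ifT => //; first exact: measurable_fun_ltr.
  by apply: measurable_funM => //; exact: measurable_ppow.
have lowE u : low (u - x) = if x < u < hi then (g x - g u) / (u - x) `^ (2 - al) else 0.
  rewrite /low; have -> : (u - x < hi - x) = (u < hi) by apply/idP/idP; lra.
  rewrite andbC; case: ifPn => //= uhi; rewrite /phi cx subrKC /ppow subr_gt0.
  case: ifPn => xu; last by rewrite mulr0.
  by rewrite /cut uhi (lt_trans lox)//= powRN (_ : 1 + (1 - al) = 2 - al)//; ring.
split.
  rewrite (frac_split_abs mphi be0 y0 phiv); congr (_ + _ * _)%E.
  rewrite -(ge0_integral_translate (- x)); last 2 first.
  - by apply/measurable_EFinP; exact: measurableT_comp.
  - by move=> p; rewrite lee_fin.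
  rewrite (@integral_ifE _ `]x, hi[%classic (fun u => x < u < hi)); last first.
    by move=> u /=; rewrite in_itv/=.
  apply: eq_integral => u _; rewrite -/(low (u - x)) lowE.
  case: ifPn => [_|]; last by rewrite normr0.
  by rewrite normrM (@ger0_norm _ ((u - x) `^ (2 - al))^-1)// invr_ge0 powR_ge0.
move=> fin; rewrite /right_frac_deriv; congr (_ * _).
rewrite (frac_split mphi be0 y0 phiv fin); congr (_ + _ * _).
rewrite -(Rintegral_translate (- x) mlow) Rintegral_mkcond; apply: eq_Rintegral => u _.
by rewrite lowE patchE mem_setE in_itv/=.
Qed.

Section identification.
Variables (lo hi M : R) (f g : R -> R).
Hypotheses (lohi : lo < hi) (mf : measurable_fun `[lo, hi] f)
  (mg0 : measurable_fun `[lo, hi] (fun y => g y - g hi)).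
Hypotheses (M0 : 0 <= M) (fM : forall x, lo < x < hi -> `|f x| <= M)
  (gM : forall x, lo < x < hi -> `|g x - g hi| <= M).

Let f1 := cut lo hi f.
Let g1 := cut lo hi (fun y => g y - g hi).
Let c := fwd_integral lo hi f g.

Let mf1 : measurable_fun setT f1. Proof. exact: measurable_cut. Qed.
Let mg1 : measurable_fun setT g1. Proof. exact: measurable_cut. Qed.

Let f1M x : `|f1 x| <= M.
Proof.
by rewrite /f1 /cut; case: ifPn => [xD|_]; [exact: fM|rewrite normr0].
Qed.
Let g1M x : `|g1 x| <= M.
Proof.
by rewrite /g1 /cut; case: ifPn => [xD|_]; [exact: gM|rewrite normr0].
Qed.
Let f10 x : ~~ (lo <= x <= hi) -> f1 x = 0.
Proof.
by rewrite /f1 /cut; case: ifPn => // /andP[? ?]; rewrite !ltW.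
Qed.

Let mshift t : measurable_fun setT (fun x : R => x + t).
Proof. exact: measurable_funD. Qed.

Let mfg (s t : R) : measurable_fun setT (fun x : R => f1 (x + s) * g1 (x + t)).
Proof.
by apply: measurable_funM; [apply: (measurableT_comp mf1)|apply: (measurableT_comp mg1)];
  exact: mshift.
Qed.

Let i_fg s t : mu.-integrable setT (EFin \o (fun x => f1 (x + s) * g1 (x + t))).
Proof.
apply: (@bounded_support_integrable _ _ (lo - s) (hi - s) (M * M)) => //.
- by move=> x; rewrite normrM; apply: ler_pM.
- by move=> x xD; rewrite f10 ?mul0r//; apply: contra xD => /andP[? ?]; apply/andP; split; lra.
Qed.

Let A s t := \int[mu]_x (f1 (x + s) * g1 (x + t)).

Let A_shift s t : A s t = A 0 (t - s).
Proof.
rewrite /A -(Rintegral_translate s (mfg 0 (t - s))).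
by apply: eq_Rintegral => x _; congr (f1 _ * g1 _); ring.
Qed.

Let cE r : c r = A 0 r - A 0 0.
Proof.
rewrite /c /fwd_integral -/f1 -/g1 /A -RintegralB//.
by apply: eq_Rintegral => x _; rewrite !addr0 mulrBr.
Qed.

Let c_bound r : `|c r| <= (M * (M + M)) * (hi - lo).
Proof.
rewrite /c /fwd_integral -/f1 -/g1.
apply: le_normr_Rintegral_support; first exact: ltW.
- apply: measurable_funM => //; apply: measurable_funB => //.
  by apply: (measurableT_comp mg1); exact: mshift.
- move=> x _; rewrite normrM; apply: ler_pM => //.
  by apply: le_trans (ler_normB _ _) _; exact: lerD.
- by move=> x xD; rewrite f10// mul0r.
Qed.

Let mc : measurable_fun setT c.
Proof.
apply: (@measurable_Rintegral_param _ _ _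
  (fun z : R * R => f1 z.2 * (g1 (z.2 + z.1) - g1 z.2))).
apply: measurable_funM; first exact: (measurableT_comp mf1).
apply: measurable_funB; last exact: (measurableT_comp mg1).
by apply: (measurableT_comp mg1); exact: measurable_funD.
Qed.

Variables (al : R) (al01 : 0 < al < 1).

Let k1 : R -> R := ppow (- (1 + al)).
Let k2 : R -> R := ppow (- (1 + (1 - al))).
Let mk1 : measurable_fun setT k1. Proof. exact: measurable_ppow. Qed.
Let mk2 : measurable_fun setT k2. Proof. exact: measurable_ppow. Qed.

Let inD (x : R) : bool := lo < x < hi.

Let minD : measurable_fun setT inD.
Proof. by apply: measurable_and; exact: measurable_fun_ltr. Qed.

Let F (z : R * R) := (if inD z.1 then f1 z.1 - f1 (z.1 - z.2) else 0) * k1 z.2.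
Let G (z : R * R) := (if inD z.1 then g1 z.1 - g1 (z.1 + z.2) else 0) * k2 z.2.

Let mF : measurable_fun setT F.
Proof.
apply: measurable_funM; last exact: (measurableT_comp mk1).
apply: measurable_fun_ifT => //; first exact: (measurableT_comp minD).
apply: measurable_funB; first exact: (measurableT_comp mf1).
by apply: (measurableT_comp mf1); exact: measurable_funB.
Qed.

Let mG : measurable_fun setT G.
Proof.
apply: measurable_funM; last exact: (measurableT_comp mk2).
apply: measurable_fun_ifT => //; first exact: (measurableT_comp minD).
apply: measurable_funB; first exact: (measurableT_comp mg1).
by apply: (measurableT_comp mg1); exact: measurable_funD.
Qed.

(** The product of a backward increment of f1 and a forward increment of g1 expands into four
    correlations A. By translation invariance these depend only on the lags 0, p, q and p + q, and
    they combine to minus the defect of c. *)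
Let FG_defect p q : - defect_kernel al c (p, q) = \int[mu]_x (F (x, p) * G (x, q)).
Proof.
rewrite /defect_kernel/= -/k1 -/k2.
have [p0|p0] := ltP 0 p; last first.
  rewrite {1}/k1 {1}/ppow (ltNge 0 p) p0/= !mul0r oppr0 Rintegral_eq0// => x.
  by rewrite /F/= /k1 /ppow (ltNge 0 p) p0/= mulr0 mul0r.
have [q0|q0] := ltP 0 q; last first.
  rewrite {1}/k2 {1}/ppow (ltNge 0 q) q0/= mulr0 !mul0r oppr0 Rintegral_eq0// => x.
  by rewrite /G/= /k2 /ppow (ltNge 0 q) q0/= !mulr0.
transitivity (k1 p * k2 q * (A 0 0 - A 0 q - A (- p) 0 + A (- p) q)).
  by rewrite !(A_shift (- p)) !opprK add0r !cE (addrC q); ring.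
have k0 : 0 < k1 p * k2 q by rewrite mulr_gt0// /k1 /k2 ppowE// powR_gt0.
have i1 : mu.-integrable setT (EFin \o
    (fun x => f1 (x + 0) * g1 (x + 0) - f1 (x + 0) * g1 (x + q))).
  exact: (integrableB _ (i_fg _ _) (i_fg _ _)).
have i2 : mu.-integrable setT (EFin \o
    (fun x => f1 (x + 0) * g1 (x + 0) - f1 (x + 0) * g1 (x + q) - f1 (x + (- p)) * g1 (x + 0))).
  exact: (integrableB _ i1 (i_fg _ _)).
rewrite /A -RintegralB// -RintegralB// -RintegralD//.
rewrite -RintegralZl_gt0//; last first.
  by apply: measurable_funD; last exact: mfg; apply: measurable_funB; last exact: mfg;
    apply: measurable_funB; exact: mfg.
apply: eq_Rintegral => x _; rewrite !addr0 /F /G/= /inD.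
case: ifPn => xD; first by ring.
(* Restricting to [inD] loses nothing: left of lo both values of f1 vanish, right of hi both values
   of g1 do. *)
rewrite !mul0r; apply/eqP; rewrite mulf_eq0 gt_eqF//=; apply/eqP.
have [lox|xlo] := ltP lo x; last first.
  have f1x : f1 x = 0 by rewrite /f1 /cut ltNge xlo.
  have f1xp : f1 (x - p) = 0 by rewrite /f1 /cut ltNge (_ : x - p <= lo)//; lra.
  by rewrite f1x f1xp !mul0r !subr0 addr0.
have hix : hi <= x by move: xD; rewrite lox/= -leNgt.
have g1x : g1 x = 0 by rewrite /g1 /cut (ltNge _ hi) hix andbF.
have g1xq : g1 (x + q) = 0.
  by rewrite /g1 /cut (ltNge _ hi) (_ : hi <= x + q) ?andbF//; lra.
by rewrite g1x g1xq !mulr0 !subr0 addr0.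
Qed.

Let LD x := if inD x then left_frac_deriv al lo f x else 0.
Let RD x := if inD x then right_frac_deriv al hi (fun y => g y - g hi) x else 0.

Let mLD : measurable_fun setT LD.
Proof.
pose low (z : R * R) := if lo < z.2 < z.1 then (f1 z.1 - f1 z.2) / (z.1 - z.2) `^ (1 + al) else 0.
have mlow : measurable_fun setT low.
  apply: measurable_fun_ifT => //.
    by apply: measurable_and; exact: measurable_fun_ltr.
  apply: measurable_funM.
    by apply: measurable_funB; exact: (measurableT_comp mf1).
  under [X in measurable_fun _ X]eq_fun do rewrite -powRN.
  by apply: (measurableT_comp (measurable_powR _)); exact: measurable_funB.
have -> : LD = (fun x => if inD x then (Gamma (1 - al))^-1 *
   (f1 x / (x - lo) `^ al + al * \int[mu]_u low (x, u)) else 0).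
  apply/funext => x; rewrite /LD; case: ifPn => // xD.
  have f1x : f1 x = f x by rewrite /f1 /cut; move: xD; rewrite /inD => ->.
  rewrite /left_frac_deriv f1x; congr (_ * (_ + _ * _)).
  rewrite Rintegral_mkcond; apply: eq_Rintegral => u _.
  rewrite patchE mem_setE in_itv/= /low/=; case: ifPn => // /andP[lou ux].
  by rewrite f1x /f1 /cut lou/= (lt_trans ux)//; case/andP: xD.
apply: measurable_fun_ifT => //; apply: measurable_funM => //; apply: measurable_funD.
  apply: measurable_funM => //.
  under [X in measurable_fun _ X]eq_fun do rewrite -powRN.
  by apply: (measurableT_comp (measurable_powR _)); exact: measurable_funB.
by apply: measurable_funM => //; exact: measurable_Rintegral_param.
Qed.

Let mRD : measurable_fun setT RD.
Proof.
pose low (z : R * R) := if z.1 < z.2 < hi then (g1 z.1 - g1 z.2) / (z.2 - z.1) `^ (2 - al) else 0.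
have mlow : measurable_fun setT low.
  apply: measurable_fun_ifT => //.
    by apply: measurable_and; exact: measurable_fun_ltr.
  apply: measurable_funM.
    by apply: measurable_funB; exact: (measurableT_comp mg1).
  under [X in measurable_fun _ X]eq_fun do rewrite -powRN.
  by apply: (measurableT_comp (measurable_powR _)); exact: measurable_funB.
have -> : RD = (fun x => if inD x then (Gamma al)^-1 *
   (g1 x / (hi - x) `^ (1 - al) + (1 - al) * \int[mu]_u low (x, u)) else 0).
  apply/funext => x; rewrite /RD; case: ifPn => // xD.
  have g1x : g1 x = g x - g hi by rewrite /g1 /cut; move: xD; rewrite /inD => ->.
  rewrite /right_frac_deriv g1x; congr (_ * (_ + _ * _)).
  rewrite Rintegral_mkcond; apply: eq_Rintegral => u _.
  rewrite patchE mem_setE in_itv/= /low/=; case: ifPn => // /andP[xu uhi].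
  by rewrite g1x /g1 /cut uhi/= (lt_trans _ xu)//; case/andP: xD.
apply: measurable_fun_ifT => //; apply: measurable_funM => //; apply: measurable_funD.
  apply: measurable_funM => //.
  under [X in measurable_fun _ X]eq_fun do rewrite -powRN.
  by apply: (measurableT_comp (measurable_powR _)); exact: measurable_funB.
by apply: measurable_funM => //; exact: measurable_Rintegral_param.
Qed.

Let FxE x : inD x -> (\int[mu]_p `|F (x, p)|%:E)%E =
  (\int[mu]_p (`|cut lo hi f x - cut lo hi f (x - p)| * ppow (- (1 + al)) p)%:E)%E.
Proof.
move=> xD; apply: eq_integral => p _.
by rewrite /F/= xD normrM (ger0_norm (ppow_ge0 _ _)).
Qed.

Let GxE x : inD x -> (\int[mu]_p `|G (x, p)|%:E)%E =
  (\int[mu]_p (`|g1 x - g1 (x + p)| * ppow (- (1 + (1 - al))) p)%:E)%E.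
Proof.
move=> xD; apply: eq_integral => p _.
by rewrite /G/= xD normrM (ger0_norm (ppow_ge0 _ _)).
Qed.

(** The minus sign compensates the one in [FG_defect], and the Gamma factors of the two derivatives
    compensate those of [defect_integral_eval]; so the value l does not remember al. *)
Lemma gls_value (l : R) :
  left_frac_L1 al lo hi f -> right_frac_Loo al lo hi (fun y => g y - g hi) ->
  (forall e : R, 0 < e -> exists2 d : R, 0 < d &
     forall r, 0 < r < d -> `|c r - l * r| <= e * r) ->
  - (\int[mu]_(x in `]lo, hi[)
      (left_frac_deriv al lo f x * right_frac_deriv al hi (fun y => g y - g hi) x)) = l.
Proof.
have /andP[al0 al1] := al01.
have be0 : 0 < 1 - al by rewrite subr_gt0.
move=> [_ L1] [_ [B HB]] cl.
have iF : (\int[mu]_x \int[mu]_p `|F (x, p)|%:E < +oo)%E.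
  have mFa : measurable_fun setT (fun z => `|F z|%:E).
    by apply/measurable_EFinP; exact: measurableT_comp.
  (* The identity of [frac_deriv_left] carries the factor al, so finiteness is shown for the product
     and al > 0 is then removed. *)
  have H : (al%:E * (\int[mu]_x \int[mu]_p `|F (x, p)|%:E) < +oo)%E.
    rewrite -ge0_integralZl//=; last 3 first.
    - by apply: (measurable_integral1 mFa) => z; rewrite lee_fin.
    - by move=> x _; apply: integral_ge0 => p _; rewrite lee_fin.
    - by rewrite lee_fin ltW.
    apply: le_lt_trans L1.
    rewrite (@integral_ifE _ `]lo, hi[%classic inD); last first.
      by move=> x /=; rewrite in_itv/=.
    rewrite le_eqVlt; apply/orP; left; apply/eqP; apply: eq_integral => x _.
    case: ifPn => xD.
      by rewrite (frac_deriv_left al01 mf xD).1 FxE.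
    rewrite integral0_eq ?mule0// => p _.
    by rewrite /F/= (negbTE xD) mul0r normr0.
  move: H; case: (\int[mu]_x _)%E => [r||]//; first by rewrite !ltry.
  by rewrite gt0_muley// lte_fin.
have GB : {ae mu, forall x, (\int[mu]_q `|G (x, q)|%:E <= (`|B| / (1 - al))%:E)%E}.
  case: HB => N [mN N0 GN]; exists N; split => // x /= nfg; apply: GN => /= fgx.
  apply: nfg; case: (boolP (inD x)) => xD; last first.
    rewrite integral0_eq ?lee_fin ?divr_ge0 ?(ltW be0)// => p _.
    by rewrite /G/= (negbTE xD) mul0r normr0.
  have := fgx; rewrite in_itv/= => /(_ xD).
  rewrite (frac_deriv_right al01 mg0 xD).1 GxE// => H.
  rewrite -(@lee_pmul2l _ (1 - al)%:E)//.
  apply: le_trans H _; rewrite -EFinM lee_fin mulrC divfK ?ler_norm//.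
  by rewrite gt_eqF.
have mE : measurable_fun setT (fun z : R * R => - defect_kernel al c z).
  by apply: measurableT_comp => //; exact: measurable_defect_kernel.
have B0 : 0 <= `|B| / (1 - al) by rewrite divr_ge0 ?(ltW be0).
have BF := bilinear_fubini mF mG mE iF B0 GB FG_defect.
have iE := integrable_bilinear mF mG mE iF B0 GB FG_defect.
have iD : (mu \x mu)%E.-integrable setT (EFin \o defect_kernel al c).
  have := integrableN iE; apply: eq_integrable => // z _ /=.
  by rewrite opprK.
have V := defect_integral_eval al01 mc c_bound cl iD.
have [_ G1] := integral_gamma_kernel al01.
have al01' := onem_in01 al01.
have [_ G2] := integral_gamma_kernel al01'.
rewrite subKr in G2.
have mFp : measurable_fun setT (fun x => \int[mu]_p F (x, p)).
  exact: measurable_Rintegral_param.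
have mGp : measurable_fun setT (fun x => \int[mu]_p G (x, p)).
  exact: measurable_Rintegral_param.
transitivity (- \int[mu]_x ((al / Gamma (1 - al) * ((1 - al) / Gamma al)) *
    ((\int[mu]_p F (x, p)) * (\int[mu]_q G (x, q))))).
  congr (- _); transitivity (\int[mu]_x (LD x * RD x)).
    rewrite Rintegral_mkcond; apply: eq_Rintegral => x _.
    rewrite patchE mem_setE in_itv/= /LD /RD -/(inD x); case: ifPn => //.
    by rewrite mulr0.
  apply: Rintegral_ae_eq.
  - exact: (measurable_funM mLD mRD).
  - exact: (measurable_funM (measurable_cst _) (measurable_funM mFp mGp)).
  have iF' := (integrable_prodP mF).2 iF.
  have A1 := ae_integrable1 iF'.
  case: A1 => N1 [mN1 N10 GN1]; case: GB => N2 [mN2 N20 GN2].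
  exists (N1 `|` N2); split.
  - exact: measurableU.
  - by rewrite null_set_setU.
  move=> x /= nfg; apply: contrapT => /not_orP[x1 x2]; apply: nfg.
  have ix : mu.-integrable setT (fun p => (F (x, p))%:E).
    by apply: contrapT => h; apply: x1; apply: GN1.
  have gx : (\int[mu]_q `|G (x, q)|%:E <= (`|B| / (1 - al))%:E)%E.
    by apply: contrapT => h; apply: x2; apply: GN2.
  case: (boolP (inD x)) => xD; last first.
    have -> : LD x = 0 by rewrite /LD (negbTE xD).
    have -> : \int[mu]_p F (x, p) = 0.
      by apply: Rintegral_eq0 => p; rewrite /F/= (negbTE xD) mul0r.
    by rewrite !mul0r mulr0.
  have -> : LD x = (Gamma (1 - al))^-1 * (al * \int[mu]_p F (x, p)).
    rewrite /LD xD (frac_deriv_left al01 mf xD).2; last first.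
      by rewrite -FxE//; have /integrableP[] := ix.
    by congr (_ * (_ * _)); apply: eq_Rintegral => p _; rewrite /F/= xD.
  have -> : RD x = (Gamma al)^-1 * ((1 - al) * \int[mu]_p G (x, p)).
    rewrite /RD xD (frac_deriv_right al01 mg0 xD).2; last first.
      by rewrite -GxE//; exact: le_lt_trans gx (ltry _).
    by congr (_ * (_ * _)); apply: eq_Rintegral => p _; rewrite /G/= xD.
  exact: gamma_factors_mul.
rewrite RintegralZl_gt0; last 2 first.
- exact: (mulr_gt0 (divr_gt0 al0 G1) (divr_gt0 be0 G2)).
- exact: (measurable_funM mFp mGp).
rewrite BF.
have -> : \int[mu]_p \int[mu]_q (- defect_kernel al c (p, q)) =
   - \int[mu]_p \int[mu]_q defect_kernel al c (p, q).
  rewrite (Rintegral_prod (F := fun z => - defect_kernel al c z))//.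
  rewrite Rintegral_prod//; last exact: measurable_defect_kernel.
  by rewrite /Rintegral; under eq_integral do rewrite EFinN; rewrite integralN ?fineN//;
    exact: integrable_add_def.
by rewrite V mulrN opprK gamma_factors_cancel.
Qed.

End identification.
End forward_integral.

(** * The Young estimate *)

Section geometric_increments.
Context {R : realType}.

Lemma geometric_sum_le (A q : R) n : 0 <= A -> 0 <= q < 1 ->
  \sum_(0 <= i < n) A * q ^+ i <= A / (1 - q).
Proof.
move=> A0 /andP[q0 q1]; rewrite -big_distrr/= ler_wpM2l//.
have q1' : 0 < 1 - q by rewrite subr_gt0.
rewrite -[leRHS]mul1r ler_pdivlMr// mulrC big_mkord -opprB mulNr -subrX1 opprB.
by rewrite lerBlDr lerDl exprn_ge0.
Qed.

Lemma geometric_increments_le (u : R^nat) (A q : R) n m : 0 <= A -> 0 <= q < 1 ->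
  (forall n, `|u n.+1 - u n| <= A * q ^+ n) ->
  `|u (n + m)%N - u n| <= A * q ^+ n / (1 - q).
Proof.
move=> A0 q01 Hu; have /andP[q0 q1] := q01.
apply: (@le_trans _ _ (\sum_(0 <= i < m) (A * q ^+ n) * q ^+ i)); last first.
  by apply: geometric_sum_le => //; rewrite mulr_ge0// exprn_ge0.
elim: m => [|m IH]; first by rewrite addn0 subrr normr0 big_geq.
rewrite big_nat_recr//= addnS.
have -> : u (n + m).+1 - u n = (u (n + m)%N - u n) + (u (n + m).+1 - u (n + m)%N) by ring.
apply: le_trans (ler_normD _ _) _; apply: lerD => //.
by apply: le_trans (Hu _) _; rewrite exprD mulrA.
Qed.

Lemma geometric_increments_cvg (u : R^nat) (A q : R) : 0 <= A -> 0 <= q < 1 ->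
  (forall n, `|u n.+1 - u n| <= A * q ^+ n) -> cvg (u @ \oo).
Proof.
move=> A0 /andP[q0 q1] Hu.
have H1 : cvgn (series (fun n => `|telescope u n|)).
  apply: (@series_le_cvg _ _ (geometric A q)) => //.
  - by move=> n; rewrite /geometric/= mulr_ge0// exprn_ge0.
  - by apply: is_cvg_geometric_series; rewrite ger0_norm.
have H2 : cvgn (series (telescope u)) by exact: normed_cvg H1.
have -> : u = (fun n => u 0%N + series (telescope u) n).
  by apply/funext => n; rewrite -eq_sum_telescope.
by apply: is_cvgD => //; exact: is_cvg_cst.
Qed.

Lemma geometric_increments_lim (u : R^nat) (l A q : R) n : 0 <= A -> 0 <= q < 1 ->
  (forall n, `|u n.+1 - u n| <= A * q ^+ n) -> u @ \oo --> l ->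
  `|l - u n| <= A * q ^+ n / (1 - q).
Proof.
move=> A0 q01 Hu ul.
have H : (`|u m - u n| @[m --> \oo]) --> `|l - u n|.
  by apply: cvg_norm; apply: cvgB => //; exact: cvg_cst.
rewrite -(cvg_lim _ H)//; apply: limr_le; first exact: cvgP H.
near=> m; have nm : (n <= m)%N by near: m; exact: nbhs_infty_ge.
by rewrite -(subnKC nm); exact: geometric_increments_le.
Unshelve. all: by end_near. Qed.

End geometric_increments.

(** * Sewing of approximately additive functions *)

Section approximate_additivity.
Context {R : realType}.

(** The sum of the geometric series of ratio 2^(1 - d): halving doubles the number of pieces and
    divides each error by 2^d. *)
Definition sewing_cst (d : R) : R := (1 - 2 `^ (1 - d))^-1.

Lemma two_powR_lt1 (d : R) : 1 < d -> 0 <= (2 : R) `^ (1 - d) < 1.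
Proof.
move=> d1; rewrite powR_ge0/= -[ltRHS](powRr0 2) /powR gt_eqF//.
by rewrite ltr_expR mul0r pmulr_llt0 ?subr_lt0// ln_gt0// ltr1n.
Qed.

Lemma sewing_cst_gt0 (d : R) : 1 < d -> 0 < sewing_cst d.
Proof. by move=> /two_powR_lt1/andP[_ h]; rewrite invr_gt0 subr_gt0. Qed.

(** The gap U r - r U 1 is additive in r and vanishes at integers, so n times the gap at r is the
    gap at the fractional part of n r. It is therefore at most M + |U 1| for every n. *)
Lemma additive_bounded_linear (U : R -> R) (M : R) :
  (forall r s, 0 < r -> 0 < s -> U (r + s) = U r + U s) ->
  (forall r, 0 < r <= 1 -> `|U r| <= M) ->
  forall r, 0 < r -> U r = r * U 1.
Proof.
move=> Uadd UM r r0.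
have UMn n s : 0 < s -> U (n.+1%:R * s) = n.+1%:R * U s.
  move=> s0; elim: n => [|n IH]; first by rewrite !mul1r.
  rewrite -natr1 mulrDl mul1r Uadd ?IH//; last by rewrite mulr_gt0// ltr0n.
  by rewrite mulrDl mul1r.
have M0 : 0 <= M by apply: le_trans (UM 1 _); rewrite // ltr01 lexx.
apply/eqP; rewrite -subr_eq0 -normr_le0; apply/ler_addgt0Pl => e e0; rewrite addr0.
pose B := M + `|U 1|.
have B0 : 0 <= B by rewrite addr_ge0.
pose n := Num.truncn (B / e).
have nB : B / e < n.+1%:R by exact: truncnS_gt.
have n0 : 0 < n.+1%:R :> R by rewrite ltr0n.
rewrite -(ler_pM2l n0) -[X in X * `|_|]ger0_norm ?(ltW n0)// -normrM mulrBr -UMn//.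
apply: (@le_trans _ _ B); last by rewrite -ler_pdivrMr// ltW.
set x := n.+1%:R * r; have x0 : 0 < x by rewrite mulr_gt0.
rewrite (mulrA _ r) -/x.
have /andP[kx xk] := truncn_itv (ltW x0).
move: kx xk; case: (Num.truncn x) => [|k] kx xk.
  apply: le_trans (ler_normB _ _) _; apply: lerD.
    by apply: UM; rewrite x0 ltW.
  by rewrite normrM ler_piMl// ger0_norm ?ltW.
(* The case x = k + 1 is separate because U is additive only at positive arguments. *)
have : U x - x * U 1 = (if x == k.+1%:R then 0 else U (x - k.+1%:R)) - (x - k.+1%:R) * U 1.
  case: eqP => [->|/eqP xk1].
    by rewrite subrr mul0r subr0 -[in U _](mulr1 k.+1%:R) UMn// subrr.
  have d0 : 0 < x - k.+1%:R by rewrite subr_gt0 lt_neqAle eq_sym xk1.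
  have -> : U x = U (x - k.+1%:R) + U k.+1%:R.
    by rewrite -Uadd ?subrK// ltr0n.
  by rewrite -[in U k.+1%:R](mulr1 k.+1%:R) UMn//; ring.
have xk1 : x - k.+1%:R <= 1 by rewrite lerBlDr -[1]/(1%:R) -natrD add1n ltW.
move=> ->; apply: le_trans (ler_normB _ _) _; apply: lerD.
  case: eqP => [_|/eqP xk2]; first by rewrite normr0.
  by apply: UM; rewrite xk1 subr_gt0 lt_neqAle eq_sym xk2 kx.
by rewrite normrM ler_piMl// ger0_norm// subr_ge0.
Qed.

(* 2^n c(r / 2^n) converges geometrically to an additive function of r, which is
   linear because c is bounded. *)
Lemma approx_additive (c : R -> R) (M Th g l : R) : 0 <= Th ->
  (forall r, 0 < r -> `|c r| <= M) -> 1 < g + l ->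
  (forall r s, 0 < r -> 0 < s -> `|c (r + s) - c r - c s| <= Th * (r `^ g * s `^ l)) ->
  exists J, forall r, 0 < r -> `|c r - J * r| <= sewing_cst (g + l) * Th * r `^ (g + l).
Proof.
move=> Th0 cM gl1 cadd.
set d := g + l; pose q := (2 : R) `^ (1 - d).
have q01 : 0 <= q < 1 by exact: two_powR_lt1.
pose u r n := 2 ^+ n * c (r / 2 ^+ n).
have pow_half (r : R) n : 0 < r -> (r / 2 ^+ n) `^ d * 2 ^+ n = r `^ d * q ^+ n.
  move=> r0; rewrite powRM ?(ltW r0)// -mulrA; congr (_ * _).
  rewrite -[2 ^+ n]powR_mulrn// -powRN -powRrM -powRD; last by rewrite pnatr_eq0 implybT.
  by rewrite /q -[RHS]powR_mulrn ?powR_ge0// -powRrM; congr (_ `^ _); ring.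
have uS r n : 0 < r -> `|u r n.+1 - u r n| <= (Th * r `^ d) * q ^+ n.
  move=> r0; pose x := r / 2 ^+ n.+1.
  have x0 : 0 < x by rewrite divr_gt0.
  have E : u r n.+1 - u r n = - (2 ^+ n * (c (x + x) - c x - c x)).
    have -> : x + x = r / 2 ^+ n by rewrite /x exprS; field; rewrite expf_neq0.
    by rewrite /u -/x exprS; ring.
  rewrite E normrN normrM ger0_norm// mulrC.
  apply: (@le_trans _ _ (Th * (x `^ g * x `^ l) * 2 ^+ n)).
    by rewrite ler_pM2r//; exact: cadd.
  rewrite -powRD; last by rewrite (gt_eqF x0) implybT.
  rewrite -/d -!mulrA ler_wpM2l// -pow_half// ler_pM2r//.
  apply: ge0_ler_powR; rewrite ?nnegrE ?divr_ge0 ?(ltW r0)//.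
    by rewrite (le_trans ler01)// ltW.
  by rewrite ler_pM2l// lef_pV2 ?posrE// exprS ler_peMl// ler1n.
pose U (r : R) : R := lim (u r @ \oo).
have cvU r : 0 < r -> u r @ \oo --> U r.
  move=> r0; apply: (@geometric_increments_cvg _ _ (Th * r `^ d) q) => //.
    by rewrite mulr_ge0// powR_ge0.
  by move=> n; exact: uS.
have Uc r : 0 < r -> `|c r - U r| <= sewing_cst d * Th * r `^ d.
  move=> r0; rewrite distrC.
  have := @geometric_increments_lim _ (u r) (U r) (Th * r `^ d) q 0%N _ q01 _ (cvU r r0).
  rewrite /u expr0 divr1 mul1r mulr1 => H; apply: le_trans (H _ _) _.
  - by rewrite mulr_ge0// powR_ge0.
  - by move=> n; exact: uS.
  - by rewrite /sewing_cst -/q mulrC mulrA.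
have Uadd r s : 0 < r -> 0 < s -> U (r + s) = U r + U s.
  move=> r0 s0; have rs0 : 0 < r + s by rewrite addr_gt0.
  have H : u (r + s) n - u r n - u s n @[n --> \oo] --> U (r + s) - U r - U s.
    by apply: cvgB; [apply: cvgB|]; exact: cvU.
  have H0 : u (r + s) n - u r n - u s n @[n --> \oo] --> (0 : R).
    apply/cvgr0Pnorm_le => e e0.
    have [N _ HN] : \forall n \near \oo, `|geometric (Th * (r `^ g * s `^ l)) q n| <= e.
      have q1 : `|q| < 1 by case/andP: q01 => q0 q1; rewrite ger0_norm.
      by have /cvgr0Pnorm_le := cvg_geometric (Th * (r `^ g * s `^ l)) q1; apply.
    near=> n; have := HN n; rewrite /geometric/=.
    have nN : (N <= n)%N by near: n; exact: nbhs_infty_ge.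
    move=> /(_ nN); apply: le_trans.
    have E : u (r + s) n - u r n - u s n =
       2 ^+ n * (c (r / 2 ^+ n + s / 2 ^+ n) - c (r / 2 ^+ n) - c (s / 2 ^+ n)).
      by rewrite /u -mulrDl; ring.
    rewrite E normrM ger0_norm// mulrC.
    apply: (@le_trans _ _ (Th * ((r / 2 ^+ n) `^ g * (s / 2 ^+ n) `^ l) * 2 ^+ n)).
      by rewrite ler_pM2r//; apply: cadd; rewrite divr_gt0.
    have -> : Th * ((r / 2 ^+ n) `^ g * (s / 2 ^+ n) `^ l) * 2 ^+ n =
       Th * (r `^ g * s `^ l) * ((1 / 2 ^+ n) `^ d * 2 ^+ n).
      rewrite /d powRD; last by apply/implyP => _; rewrite gt_eqF// divr_gt0// exprn_gt0.
      have P (x h : R) : 0 < x -> (x / 2 ^+ n) `^ h = x `^ h * (1 / 2 ^+ n) `^ h.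
        by move=> x0; rewrite -powRM ?(ltW x0)// ?divr_ge0// mul1r.
      by rewrite (P r) // (P s)//; ring.
    by rewrite pow_half// powR1 mul1r ler_norm.
  have := cvg_lim (@Rhausdorff R) H; rewrite (cvg_lim (@Rhausdorff R) H0) => E0.
  by apply/eqP; rewrite -subr_eq0 opprD addrA -(E0 _).
exists (U 1) => r r0.
rewrite [U 1 * r]mulrC -(@additive_bounded_linear U (M + sewing_cst d * Th)) ?Uc//.
move=> s /andP[s0 s1].
rewrite (_ : U s = c s - (c s - U s)); last by ring.
apply: le_trans (ler_normB _ _) _; apply: lerD; first exact: cM.
apply: le_trans (Uc s s0) _; rewrite ler_piMr ?mulr_ge0 ?(ltW (sewing_cst_gt0 _))//.
apply: (@le_trans _ _ (1 `^ d)); last by rewrite powR1.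
apply: ge0_ler_powR; rewrite ?nnegrE ?(ltW s0)//.
by rewrite (le_trans ler01)// ltW.
Unshelve. all: by end_near. Qed.

End approximate_additivity.

Section young.
Context {R : realType}.
Local Notation mu := (@lebesgue_measure R).

Definition hoelder_on (I : set R) (K g : R) (f : R -> R) :=
  forall x y, I x -> I y -> `|f x - f y| <= K * `|x - y| `^ g.

(* Together with gls_value: any generalized Lebesgue-Stieltjes integral of f dg
   over [lo, hi] equals l. *)
Definition fwd_slope (lo hi : R) (f g : R -> R) (l : R) :=
  forall e : R, 0 < e -> exists2 d : R, 0 < d &
     forall r, 0 < r < d -> `|fwd_integral lo hi f g r - l * r| <= e * r.

Lemma powR_small (h C : R) : 0 < h -> 0 <= C -> forall e : R, 0 < e -> exists2 d : R, 0 < d &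
  forall r, 0 < r < d -> C * r `^ h <= e.
Proof.
move=> h0 C0 e e0; pose d := (e / (C + 1)) `^ h^-1.
have C1 : 0 < C + 1 by rewrite ltr_wpDl.
have ec : 0 < e / (C + 1) by rewrite divr_gt0.
exists d; first by rewrite powR_gt0.
move=> r /andP[r0 rd].
have H : r `^ h <= e / (C + 1).
  have -> : e / (C + 1) = d `^ h by rewrite /d -powRrM mulVf ?gt_eqF// powRr1// ltW.
  by apply: ge0_ler_powR; rewrite ?nnegrE ?(ltW h0) ?(ltW r0) ?powR_ge0// ltW.
apply: (@le_trans _ _ (C * (e / (C + 1)))); first exact: ler_wpM2l.
rewrite mulrA ler_pdivrMr// mulrC ler_pM2l// lerDl//.
Qed.

Lemma fwd_slope_pow (lo hi : R) (f g : R -> R) (l C h d0 : R) : 1 < h -> 0 <= C -> 0 < d0 ->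
  (forall r, 0 < r < d0 -> `|fwd_integral lo hi f g r - l * r| <= C * r `^ h) ->
  fwd_slope lo hi f g l.
Proof.
move=> h1 C0 d00 H e e0.
have [d d_gt0 Hd] := @powR_small (h - 1) C (ltac:(by rewrite subr_gt0)) C0 e e0.
exists (Num.min d d0); first by rewrite lt_min d_gt0.
move=> r /andP[r0]; rewrite lt_min => /andP[rd rd0].
apply: le_trans (H _ _) _; first by rewrite r0.
have -> : r `^ h = r `^ (h - 1) * r.
  by rewrite -[X in _ = _ * X](powRr1 (ltW r0)) -powRD ?subrK// (gt_eqF r0) implybT.
by rewrite mulrA ler_pM2r// Hd// r0.
Qed.

Lemma fwd_slope_unique (lo hi : R) (f g : R -> R) (l l' : R) :
  fwd_slope lo hi f g l -> fwd_slope lo hi f g l' -> l = l'.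
Proof.
move=> H H'; apply/eqP; rewrite -subr_eq0 -normr_le0.
apply/ler_addgt0Pl => e e0; rewrite addr0.
have e20 : 0 < e / 2 by rewrite divr_gt0.
have [d d0 Hd] := H _ e20; have [d' d'0 Hd'] := H' _ e20.
pose r := Num.min d d' / 2.
have m0 : 0 < Num.min d d' by rewrite lt_min d0.
have r0 : 0 < r by rewrite divr_gt0.
have rm : r < Num.min d d' by rewrite ltr_pdivrMr// mulr_natr mulr2n ltrDl.
have := rm; rewrite lt_min => /andP[rd rd'].
rewrite -(ler_pM2r r0).
have -> : `|l - l'| * r = `|(fwd_integral lo hi f g r - l' * r) - (fwd_integral lo hi f g r - l * r)|.
  rewrite -[X in _ * X]ger0_norm ?(ltW r0)// -normrM; congr `|_|; ring.
apply: le_trans (ler_normB _ _) _; rewrite (splitr e) mulrDl; apply: lerD.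
  by apply: Hd'; rewrite r0.
by apply: Hd; rewrite r0.
Qed.

(** A 1-Lipschitz retraction onto [s, t]: composing with it extends a Hoelder function to the line
    with the same constant. *)
Definition clamp (s t x : R) := Num.max s (Num.min x t).

Lemma clamp_lip (s t x y : R) : s <= t -> `|clamp s t x - clamp s t y| <= `|x - y|.
Proof.
move=> st; have H1 := ler_norm (x - y); have H2 := ler_norm (y - x).
rewrite (distrC y) in H2; rewrite /clamp /Num.max /Num.min ler_norml.
by case: (ltP x t) => ?; case: (ltP y t) => ?; repeat (case: ltP => ?); apply/andP; split; lra.
Qed.

Lemma clamp_in (s t x : R) : s <= t -> clamp s t x \in `[s, t].
Proof.
move=> st; rewrite /clamp /Num.max /Num.min in_itv/=.
by case: (ltP x t) => ?; repeat (case: ltP => ?); apply/andP; split; lra.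
Qed.

Lemma clamp_id (s t x : R) : s <= x <= t -> clamp s t x = x.
Proof.
move=> /andP[sx xt]; rewrite /clamp /Num.max /Num.min.
by case: (ltP x t) => ?; repeat (case: ltP => ?); lra.
Qed.

Lemma clamp_le (s t x : R) : s <= t -> x <= s -> clamp s t x = s.
Proof.
move=> st xs; rewrite /clamp /Num.max /Num.min.
by case: (ltP x t) => ?; repeat (case: ltP => ?); lra.
Qed.

Lemma clamp_ge (s t x : R) : s <= t -> t <= x -> clamp s t x = t.
Proof.
move=> st xs; rewrite /clamp /Num.max /Num.min.
by case: (ltP x t) => ?; repeat (case: ltP => ?); lra.
Qed.

Lemma hoelder_continuous (K h : R) (f : R -> R) : 0 < h -> hoelder_on setT K h f ->
  continuous f.
Proof.
move=> h0 H x; apply/cvgrPdist_le => e e0.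
have [d d0 Hd] := powR_small h0 (normr_ge0 K) e0.
near=> y; apply: le_trans (H _ _ I I) _.
have [->|xy] := eqVneq x y; first by rewrite subrr normr0 powR0 ?gt_eqF// mulr0 ltW.
apply: le_trans (Hd `|x - y| _).
  by rewrite ler_wpM2r ?powR_ge0// ler_norm.
rewrite normr_gt0 subr_eq0 xy/=.
by near: y; exact: cvgr_dist_lt.
Unshelve. all: by end_near. Qed.

Lemma hoelder_clamp (s t K h : R) (f : R -> R) : s <= t -> 0 <= K -> 0 < h ->
  hoelder_on `[s, t] K h f -> hoelder_on setT K h (f \o clamp s t).
Proof.
move=> st K0 h0 H x y _ _ /=.
apply: le_trans (H _ _ _ _) _; [exact: clamp_in|exact: clamp_in|].
rewrite ler_wpM2l//; apply: ge0_ler_powR; rewrite ?nnegrE ?(ltW h0)//.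
exact: clamp_lip.
Qed.

Lemma fwd_integralE (lo hi : R) (f g : R -> R) r : 0 < r ->
  fwd_integral lo hi f g r =
  \int[mu]_x (if lo < x < hi then f x * (g (Num.min (x + r) hi) - g x) else 0).
Proof.
move=> r0; apply: eq_Rintegral => x _; rewrite /cut.
case: ifPn => [/andP[lox xhi]|]; last by rewrite mul0r.
have xr : lo < x + r by apply: lt_trans lox _; rewrite ltrDl.
congr (_ * _); rewrite xr/=.
rewrite /Num.min; case: ifPn => h; ring.
Qed.

Section local.
Variables (lo hi L K ga la : R) (f g : R -> R).
Hypotheses (lohi : lo < hi) (L0 : 0 <= L) (K0 : 0 <= K) (ga0 : 0 < ga) (la0 : 0 < la)
  (gala : 1 < ga + la).
Hypotheses (fL : hoelder_on `[lo, hi] L ga f) (gK : hoelder_on `[lo, hi] K la g).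

Let Fc := f \o clamp lo hi.
Let Gc := g \o clamp lo hi.

Let hF : hoelder_on setT L ga Fc. Proof. by apply: hoelder_clamp => //; exact: ltW. Qed.
Let hG : hoelder_on setT K la Gc. Proof. by apply: hoelder_clamp => //; exact: ltW. Qed.
Let mFc : measurable_fun setT Fc.
Proof. by apply: continuous_measurable_fun; exact: hoelder_continuous hF. Qed.
Let mGc : measurable_fun setT Gc.
Proof. by apply: continuous_measurable_fun; exact: hoelder_continuous hG. Qed.

Let le_lohi : lo <= hi. Proof. exact: ltW. Qed.

Let H0 : 0 < hi - lo. Proof. by rewrite subr_gt0. Qed.

Let mshift (t : R) : measurable_fun setT (fun x : R => x + t).
Proof. exact: measurable_funD. Qed.

Let osc_clamp (h M : R) (u : R -> R) x y : 0 < h -> 0 <= M -> hoelder_on `[lo, hi] M h u ->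
  `|u (clamp lo hi x) - u (clamp lo hi y)| <= M * (hi - lo) `^ h.
Proof.
move=> h0 M0 uM; apply: le_trans (uM _ _ _ _) _; [exact: clamp_in|exact: clamp_in|].
rewrite ler_wpM2l//; apply: ge0_ler_powR; rewrite ?nnegrE ?(ltW h0) ?(ltW H0)//.
have := clamp_in x le_lohi; have := clamp_in y le_lohi.
by rewrite !in_itv/= ler_norml => /andP[? ?] /andP[? ?]; apply/andP; split; lra.
Qed.

Let incr_le (x r : R) : 0 < r -> `|Gc (x + r) - Gc x| <= K * r `^ la.
Proof.
move=> r0; apply: le_trans (hG I I) _.
by rewrite addrAC subrr add0r ger0_norm ?(ltW r0).
Qed.

Let incr_hi (x r : R) : 0 < r -> hi <= x -> Gc (x + r) - Gc x = 0.
Proof.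
move=> r0 hx; rewrite /Gc/= !clamp_ge ?subrr//.
by apply: le_trans hx _; rewrite lerDl ltW.
Qed.

Let P a b x := Fc (x - a) * (Gc (x + b) - Gc x).

Let mP a b : measurable_fun setT (P a b).
Proof.
apply: measurable_funM; first by apply: (measurableT_comp mFc); exact: mshift.
apply: measurable_funB => //; apply: (measurableT_comp mGc); exact: mshift.
Qed.

(* Then f o clamp lo hi extends f by 0 to the left of lo and is still Hoelder,
   which makes the forward integral approximately additive. *)
Hypothesis flo : f lo = 0.

Let Fc_lo x : x <= lo -> Fc x = 0.
Proof. by move=> xlo; rewrite /Fc/= clamp_le. Qed.

Let Fc_le x : `|Fc x| <= L * (hi - lo) `^ ga.
Proof.
rewrite -[Fc x]subr0 -flo -[X in f X](clamp_le le_lohi (lexx lo)).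
exact: osc_clamp.
Qed.

Let P_support a b x : 0 <= a -> 0 < b -> ~~ (lo <= x <= hi) -> P a b x = 0.
Proof.
move=> a0 b0; rewrite negb_and -!ltNge => /orP[xlo|hix]; rewrite /P.
  by rewrite Fc_lo ?mul0r//; lra.
by rewrite incr_hi ?mulr0// ltW.
Qed.

Let P_bound a b x : 0 < b -> `|P a b x| <= L * (hi - lo) `^ ga * (K * (hi - lo) `^ la).
Proof.
move=> b0; rewrite normrM; apply: ler_pM => //; exact: osc_clamp.
Qed.

Let iP a b : 0 <= a -> 0 < b -> mu.-integrable setT (EFin \o P a b).
Proof.
move=> a0 b0; apply: (@bounded_support_integrable _ _ lo hi
  (L * (hi - lo) `^ ga * (K * (hi - lo) `^ la))) => //.
- by move=> x; exact: P_bound.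
- by move=> x; exact: P_support.
Qed.

Let c := fwd_integral lo hi f g.

Let cE r : 0 < r -> c r = \int[mu]_x P 0 r x.
Proof.
move=> r0; rewrite /c fwd_integralE//; apply: eq_Rintegral => x _.
rewrite /P subr0.
have [lox|xlo] := ltP lo x; last by rewrite Fc_lo// mul0r.
have [xhi|hix] /= := ltP x hi; last by rewrite incr_hi// mulr0.
rewrite /Fc /Gc/= (@clamp_id _ _ x) ?(ltW lox) ?(ltW xhi)//; congr (_ * (g _ - _)).
by rewrite /clamp max_r// le_min le_lohi ltW// (lt_trans lox)// ltrDl.
Qed.

Let c_bound r : 0 < r -> `|c r| <= L * K * (hi - lo) `^ (ga + la) * (hi - lo).
Proof.
move=> r0; rewrite cE//.
rewrite powRD; last by rewrite (gt_eqF H0) implybT.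
have -> : L * K * ((hi - lo) `^ ga * (hi - lo) `^ la) =
   L * (hi - lo) `^ ga * (K * (hi - lo) `^ la) by ring.
apply: le_normr_Rintegral_support => //.
- by move=> x _; exact: P_bound.
- by move=> x; exact: P_support.
Qed.

(** Split the increment of g over r + s at x + r and translate its second half by r. The defect
    becomes the integral of (F(x - r) - F(x)) (G(x + s) - G(x)), where both factors are small. *)
Let c_add r s : 0 < r -> 0 < s ->
  `|c (r + s) - c r - c s| <= L * K * (hi - lo) * (r `^ ga * s `^ la).
Proof.
move=> r0 s0; have rs0 : 0 < r + s by rewrite addr_gt0.
have iT : mu.-integrable setT (EFin \o (fun x => P r s (x + r))).
  apply: (@bounded_support_integrable _ _ (lo - r) (hi - r)
    (L * (hi - lo) `^ ga * (K * (hi - lo) `^ la))) => //.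
  - by apply: (measurableT_comp (mP _ _)); exact: mshift.
  - by move=> x; exact: P_bound.
  - move=> x xD; apply: P_support; rewrite ?(ltW r0)//.
    by apply: contra xD => /andP[? ?]; apply/andP; split; lra.
have -> : c (r + s) - c r - c s = \int[mu]_x (P r s x - P 0 s x).
  rewrite RintegralB//; [|by apply: iP; rewrite // ltW|exact: iP].
  rewrite -(@Rintegral_translate _ _ r)//.
  have -> : c (r + s) = \int[mu]_x (P r s (x + r) + P 0 r x).
    rewrite cE//; apply: eq_Rintegral => x _; rewrite /P !subr0 addrK addrA; ring.
  rewrite RintegralD//; last exact: iP.
  by rewrite !cE//; ring.
rewrite -mulrA [X in _ <= _ * X]mulrC mulrA.
apply: le_normr_Rintegral_support => //.
- exact: measurable_funB.
- move=> x _; rewrite /P subr0 -mulrBl normrM.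
  have -> : L * K * (r `^ ga * s `^ la) = (L * r `^ ga) * (K * s `^ la) by ring.
  apply: ler_pM => //; last exact: incr_le.
  apply: le_trans (hF I I) _.
  by rewrite addrAC subrr add0r normrN ger0_norm ?(ltW r0).
- by move=> x xD; rewrite !P_support ?subrr// ltW.
Qed.

Lemma fwd_slope_vanishing : exists2 J, fwd_slope lo hi f g J &
  `|J| <= (1 + sewing_cst (ga + la)) * (L * K) * (hi - lo) `^ (ga + la).
Proof.
have Th0 : 0 <= L * K * (hi - lo) by rewrite !mulr_ge0// ltW.
have S0 := sewing_cst_gt0 gala.
have [J HJ] := approx_additive Th0 c_bound gala c_add.
exists J.
  apply: (@fwd_slope_pow _ _ _ _ _ (sewing_cst (ga + la) * (L * K * (hi - lo))) (ga + la) 1) => //.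
    by rewrite mulr_ge0// ltW.
  by move=> r /andP[r0 _]; exact: HJ.
rewrite -(ler_pM2r H0).
have -> : `|J| * (hi - lo) = `|J * (hi - lo)| by rewrite normrM (gtr0_norm H0).
(* At r = hi - lo the error estimate for c becomes a bound on J: the 1 in the constant comes from
   [c_bound], the other summand from the sewing error. *)
rewrite (_ : J * (hi - lo) = c (hi - lo) - (c (hi - lo) - J * (hi - lo))); last by ring.
apply: le_trans (ler_normB _ _) _.
apply: le_trans (lerD (c_bound H0) (HJ _ H0)) _.
by rewrite le_eqVlt; apply/orP; left; apply/eqP; ring.
Qed.

End local.
End young.

(** * Slopes for general integrands, and their additivity in the interval *)

Section young_estimate.
Context {R : realType}.
Local Notation mu := (@lebesgue_measure R).

Let fwd_integrand (lo hi : R) (f g : R -> R) (r x : R) :=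
  if lo < x < hi then f x * (g (Num.min (x + r) hi) - g x) else 0.

Lemma hoelder_onS (A B : set R) (K h : R) (f : R -> R) : A `<=` B ->
  hoelder_on B K h f -> hoelder_on A K h f.
Proof. by move=> AB H x y /AB Bx /AB By; exact: H. Qed.

Lemma hoelder_bound (lo hi K h : R) (f : R -> R) x y : lo <= hi -> 0 <= K -> 0 < h ->
  hoelder_on `[lo, hi] K h f -> lo <= x <= hi -> lo <= y <= hi ->
  `|f x - f y| <= K * (hi - lo) `^ h.
Proof.
move=> lohi K0 h0 H xI yI; apply: le_trans (H _ _ _ _) _; rewrite ?/= ?in_itv//=.
rewrite ler_wpM2l//; apply: ge0_ler_powR; rewrite ?nnegrE ?(ltW h0) ?subr_ge0//.
by case/andP: xI => ? ?; case/andP: yI => ? ?; rewrite ler_norml; apply/andP; split; lra.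
Qed.

Lemma measurable_fwd_integrand (lo hi L K ga la : R) (f g : R -> R) r : lo <= hi ->
  0 <= L -> 0 <= K -> 0 < ga -> 0 < la ->
  hoelder_on `[lo, hi] L ga f -> hoelder_on `[lo, hi] K la g -> 0 < r ->
  measurable_fun setT (fwd_integrand lo hi f g r).
Proof.
move=> lohi L0 K0 ga0 la0 fL gK r0.
have mF : measurable_fun setT (f \o clamp lo hi).
  by apply: continuous_measurable_fun; apply: (@hoelder_continuous _ L ga) => //; exact: hoelder_clamp.
have mG : measurable_fun setT (g \o clamp lo hi).
  by apply: continuous_measurable_fun; apply: (@hoelder_continuous _ K la) => //; exact: hoelder_clamp.
have -> : fwd_integrand lo hi f g r = (fun x => if lo < x < hi then
    (f \o clamp lo hi) x * ((g \o clamp lo hi) (x + r) - (g \o clamp lo hi) x) else 0).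
  apply/funext => x; rewrite /fwd_integrand; case: ifPn => // /andP[lox xhi] /=.
  rewrite (@clamp_id _ lo hi x) ?(ltW lox) ?(ltW xhi)//; congr (_ * (g _ - _)).
  by rewrite /clamp max_r// le_min lohi ltW// (lt_trans lox)// ltrDl.
apply: measurable_fun_ifT => //.
  by apply: measurable_and; exact: measurable_fun_ltr.
apply: measurable_funM => //; apply: measurable_funB => //.
by apply: (measurableT_comp mG); exact: measurable_funD.
Qed.

Lemma fwd_incr_le (lo hi K la : R) (g : R -> R) x r : lo <= hi -> 0 <= K -> 0 < la ->
  hoelder_on `[lo, hi] K la g -> 0 < r -> lo < x < hi ->
  `|g (Num.min (x + r) hi) - g x| <= K * r `^ la.
Proof.
move=> lohi K0 la0 gK r0 /andP[lox xhi].
have xr : x < x + r by rewrite ltrDl.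
apply: le_trans (gK _ _ _ _) _; rewrite /= ?in_itv/=.
- by rewrite ge_min lexx orbT andbT le_min lohi ltW// (lt_trans lox).
- by rewrite !ltW.
rewrite ler_wpM2l//; apply: ge0_ler_powR; rewrite ?nnegrE ?(ltW la0) ?(ltW r0)//.
by rewrite /Num.min ler_norml; case: ifPn => h; apply/andP; split; lra.
Qed.

Lemma integrable_fwd_integrand (lo hi L K ga la : R) (f g : R -> R) r : lo <= hi ->
  0 <= L -> 0 <= K -> 0 < ga -> 0 < la ->
  hoelder_on `[lo, hi] L ga f -> hoelder_on `[lo, hi] K la g -> 0 < r ->
  mu.-integrable setT (EFin \o fwd_integrand lo hi f g r).
Proof.
move=> lohi L0 K0 ga0 la0 fL gK r0.
apply: (@bounded_support_integrable _ _ lo hi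
    ((`|f lo| + L * (hi - lo) `^ ga) * (K * r `^ la))).
- exact: (@measurable_fwd_integrand _ _ L K ga la).
- move=> x; rewrite /fwd_integrand; case: ifPn => [xI|_]; last first.
    by rewrite normr0 !mulr_ge0 ?addr_ge0 ?mulr_ge0 ?powR_ge0.
  rewrite normrM; apply: ler_pM => //; last exact: (@fwd_incr_le lo hi).
  rewrite (_ : f x = f lo + (f x - f lo)); last by ring.
  apply: le_trans (ler_normD _ _) _; rewrite lerD2l.
  case/andP: xI => lox xhi.
  by apply: (@hoelder_bound lo hi) => //; rewrite ?lexx// !ltW.
- move=> x; rewrite /fwd_integrand; case: ifPn => // /andP[? ?].
  by rewrite !ltW.
Qed.

Lemma hoelder_cst (I : set R) (k h : R) : hoelder_on I 0 h (cst k).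
Proof. by move=> x y _ _; rewrite /cst subrr normr0 mul0r. Qed.

Lemma Rintegral_box (lo r v : R) : 0 <= r ->
  \int[mu]_x (if lo < x <= lo + r then v else 0) = v * r.
Proof.
move=> r0; transitivity (\int[mu]_(x in `]lo, lo + r]) v).
  by rewrite [RHS]Rintegral_mkcond; apply: eq_Rintegral => x _; rewrite patchE mem_setE in_itv.
rewrite Rintegral_cst//= lebesgue_measure_itv/= lte_fin ltrDl.
move: r0; rewrite le_eqVlt => /predU1P[<-|r0]; first by rewrite ltxx mulr0.
by rewrite r0/= addrAC subrr add0r.
Qed.

(** After a translation by r the integral telescopes: only r g(hi) minus the integral of g over
    [lo, lo + r] survives, and replacing g by g lo there costs at most K r^(1 + la). *)
Lemma fwd_slope_one (lo hi K la : R) (g : R -> R) : lo < hi -> 0 <= K -> 0 < la ->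
  hoelder_on `[lo, hi] K la g -> fwd_slope lo hi (cst 1) g (g hi - g lo).
Proof.
move=> lohi K0 la0 gK; have h0 : 0 < hi - lo by rewrite subr_gt0.
apply: (@fwd_slope_pow _ _ _ _ _ _ K (1 + la) (hi - lo)) => //; first by rewrite ltrDl.
move=> r /andP[r0 rh]; pose Gc := g \o clamp lo hi.
have mG : measurable_fun setT Gc.
  apply: continuous_measurable_fun; apply: (@hoelder_continuous _ K la) => //.
  by apply: hoelder_clamp => //; exact: ltW.
have Gosc x y : `|Gc x - Gc y| <= K * (hi - lo) `^ la.
  have Hx := clamp_in x (ltW lohi); have Hy := clamp_in y (ltW lohi).
  rewrite !in_itv/= in Hx Hy.
  exact: (@hoelder_bound lo hi K la g _ _ (ltW lohi) K0 la0 gK Hx Hy).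
have Ghi x : hi <= x -> Gc x = g hi by move=> h; rewrite /Gc/= clamp_ge// ltW.
pose A (x : R) := if lo < x < hi then Gc (x + r) - Gc hi else 0.
pose B (x : R) := if lo < x < hi then Gc x - Gc hi else 0.
have mb (a b : R) : measurable_fun setT (fun x : R => a < x < b).
  by apply: measurable_and; exact: measurable_fun_ltr.
have mA : measurable_fun setT A.
  apply: measurable_fun_ifT => //; apply: measurable_funB => //.
  by apply: (measurableT_comp mG); exact: measurable_funD.
have mB : measurable_fun setT B.
  by apply: measurable_fun_ifT => //; exact: measurable_funB.
have iA : mu.-integrable setT (EFin \o A).
  apply: (@bounded_support_integrable _ _ lo hi (K * (hi - lo) `^ la)) => //.
  - by move=> x; rewrite /A; case: ifP => // _; rewrite normr0 mulr_ge0 ?powR_ge0.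
  - by move=> x; rewrite /A; case: ifP => // /andP[? ?]; rewrite !ltW.
have iB : mu.-integrable setT (EFin \o B).
  apply: (@bounded_support_integrable _ _ lo hi (K * (hi - lo) `^ la)) => //.
  - by move=> x; rewrite /B; case: ifP => // _; rewrite normr0 mulr_ge0 ?powR_ge0.
  - by move=> x; rewrite /B; case: ifP => // /andP[? ?]; rewrite !ltW.
have mAr : measurable_fun setT (fun x : R => A (x + (- r))).
  by apply: (measurableT_comp mA); exact: measurable_funD.
have iAr : mu.-integrable setT (EFin \o (fun x : R => A (x + (- r)))).
  apply: (@bounded_support_integrable _ _ (lo + r) (hi + r) (K * (hi - lo) `^ la)) => //.
  - by move=> x; rewrite /A; case: ifP => // _; rewrite normr0 mulr_ge0 ?powR_ge0.
  - move=> x; rewrite /A; case: ifP => // /andP[? ?] /negP[].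
    by apply/andP; split; lra.
have -> : fwd_integral lo hi (cst 1) g r = Rintegral mu setT (fun x : R => A (x + (- r))) - \int[mu]_x B x.
  rewrite (@Rintegral_translate _ A) // -RintegralB// fwd_integralE//.
  apply: eq_Rintegral => x _; rewrite /A /B; case: ifPn => [/andP[lox xhi]|_]; last by rewrite subr0.
  rewrite /cst mul1r /Gc/= (@clamp_id _ lo hi x) ?(ltW lox) ?(ltW xhi)//.
  have -> : Num.min (x + r) hi = clamp lo hi (x + r).
    by rewrite /clamp max_r// le_min (ltW lohi) ltW// (lt_trans lox)// ltrDl.
  by ring.
rewrite -(Rintegral_box lo (g hi - g lo) (ltW r0)) -RintegralB// -RintegralB//; last 2 first.
- by apply: (integrableB _ iAr iB).
- apply: (@bounded_support_integrable _ _ lo (lo + r) `|g hi - g lo|) => //.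
  + apply: measurable_fun_ifT => //; apply: measurable_and; [exact: measurable_fun_ltr|exact: measurable_fun_ler].
  + by move=> x; case: ifP => // _; rewrite normr0.
  + by move=> x; case: ifP => // /andP[? ->]; rewrite ltW.
have E x : A (x + (- r)) - B x - (if lo < x <= lo + r then g hi - g lo else 0) =
    if lo < x <= lo + r then Gc lo - Gc x else 0.
  have Glo : Gc lo = g lo by rewrite /Gc/= clamp_le// ltW.
  have Ghh : Gc hi = g hi by exact: Ghi.
  rewrite /A /B subrK Glo Ghh.
  have -> : (lo < x - r) = (lo + r < x) by rewrite ltrBrDr.
  have -> : (x - r < hi) = (x < hi + r) by rewrite ltrBlDr.
  case: (ltP lo x) => lox /=; last first.
    by rewrite ltNge (_ : x <= lo + r)/= ?subr0//; lra.
  case: (ltP (lo + r) x) => xr /=.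
    rewrite subr0.
    case: (ltP x hi) => xhi.
      by rewrite (_ : x < hi + r) ?subrr//; lra.
    by case: ifP => _; rewrite ?Ghi// ?subrr// subr0.
  have -> : x < hi by lra.
  by ring.
rewrite powRD; last by rewrite (gt_eqF r0) implybT.
rewrite powRr1 ?(ltW r0)// (mulrC r) mulrA.
under eq_Rintegral do rewrite E.
have -> : K * r `^ la * r = K * r `^ la * ((lo + r) - lo) by congr (_ * _); ring.
apply: le_normr_Rintegral_support.
- by rewrite lerDl ltW.
- apply: measurable_fun_ifT => //; last exact: measurable_funB.
  by apply: measurable_and; [exact: measurable_fun_ltr|exact: measurable_fun_ler].
- move=> x /andP[lox xr]; case: ifP => _; last by rewrite normr0 mulr_ge0 ?powR_ge0.
  have := @hoelder_clamp _ lo hi K la g (ltW lohi) K0 la0 gK lo x I I.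
  move=> /le_trans; apply; rewrite ler_wpM2l//.
  apply: ge0_ler_powR; rewrite ?nnegrE ?(ltW la0) ?(ltW r0)//.
  by rewrite ler_norml; apply/andP; split; lra.
- by move=> x; case: ifP => // /andP[? ->]; rewrite ltW.
Qed.

(** Write f as (f - f lo) + f lo: the first part vanishes at lo and gives the remainder, the
    constant part gives exactly the first order term. *)
Lemma young_local (lo hi L K ga la : R) (f g : R -> R) : lo < hi ->
  0 <= L -> 0 <= K -> 0 < ga -> 0 < la -> 1 < ga + la ->
  hoelder_on `[lo, hi] L ga f -> hoelder_on `[lo, hi] K la g ->
  exists2 l, fwd_slope lo hi f g l &
  `|l - f lo * (g hi - g lo)| <=
     (1 + sewing_cst (ga + la)) * (L * K) * (hi - lo) `^ (ga + la).
Proof.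
move=> lohi L0 K0 ga0 la0 gala fL gK.
pose f0 x := f x - f lo.
have f0L : hoelder_on `[lo, hi] L ga f0.
  by move=> x y xI yI; rewrite /f0 opprB addrA subrK; exact: fL.
have f00 : f0 lo = 0 by rewrite /f0 subrr.
have [J HJ JB] := fwd_slope_vanishing lohi L0 K0 ga0 la0 gala f0L gK f00.
have H1 := fwd_slope_one lohi K0 la0 gK.
exists (J + f lo * (g hi - g lo)); last by rewrite addrK.
have E r : 0 < r -> fwd_integral lo hi f g r =
    fwd_integral lo hi f0 g r + f lo * fwd_integral lo hi (cst 1) g r.
  move=> r0; rewrite !fwd_integralE//.
  have i1 := @integrable_fwd_integrand lo hi 0 K ga la (cst 1) g r (ltW lohi) (lexx _) K0 ga0 la0 (@hoelder_cst `[lo, hi]%classic 1 ga) gK r0.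
  have i0 := @integrable_fwd_integrand lo hi L K ga la f0 g r (ltW lohi) L0 K0 ga0 la0 f0L gK r0.
  rewrite -RintegralZl// -RintegralD//; last first.
    by have := integrableZl measurableT (f lo) i1; apply: eq_integrable.
  apply: eq_Rintegral => x _; rewrite /fwd_integrand; case: ifP => _; last by rewrite mulr0 addr0.
  by rewrite /cst /f0; ring.
move=> e e0; have e20 : 0 < e / 2 by rewrite divr_gt0.
have q0 : 0 < e / (2 * (`|f lo| + 1)) by rewrite divr_gt0// mulr_gt0// ltr_wpDl.
have [d d0 Hd] := HJ _ e20; have [d' d'0 Hd'] := H1 _ q0.
exists (Num.min d d'); first by rewrite lt_min d0.
move=> r /andP[r0]; rewrite lt_min => /andP[rd rd'].
rewrite E//.
rewrite (_ : _ - _ = (fwd_integral lo hi f0 g r - J * r) +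
   f lo * (fwd_integral lo hi (cst 1) g r - (g hi - g lo) * r)); last by ring.
apply: le_trans (ler_normD _ _) _; rewrite [in leRHS](splitr e) [in leRHS]mulrDl; apply: lerD.
  by apply: Hd; rewrite r0.
rewrite normrM; apply: (@le_trans _ _ (`|f lo| * (e / (2 * (`|f lo| + 1)) * r))).
  by rewrite ler_wpM2l// Hd'// r0.
rewrite mulrA ler_pM2r//.
have -> : `|f lo| * (e / (2 * (`|f lo| + 1))) = (e / 2) * (`|f lo| / (`|f lo| + 1)).
  by field; rewrite gt_eqF// ltr_wpDl.
rewrite -[leRHS]mulr1 ler_pM2l// ler_pdivrMr ?mul1r ?lerDl// ltr_wpDl//.
Qed.

(** The integrands over [lo, hi] and over the two pieces differ only for x within r to the left of
    mid, where the left piece freezes g at mid. The discrepancy is O(r^(1 + la)), invisible to the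
    slope. *)
Lemma fwd_slope_chasles (lo mid hi L K ga la : R) (f g : R -> R) l1 l2 :
  lo < mid -> mid < hi -> 0 <= L -> 0 <= K -> 0 < ga -> 0 < la ->
  hoelder_on `[lo, hi] L ga f -> hoelder_on `[lo, hi] K la g ->
  fwd_slope lo mid f g l1 -> fwd_slope mid hi f g l2 -> fwd_slope lo hi f g (l1 + l2).
Proof.
move=> lomid midhi L0 K0 ga0 la0 fL gK H1 H2.
have lohi : lo < hi by exact: lt_trans midhi.
have S1 : `[lo, mid] `<=` `[lo, hi]%classic by apply: subset_itvl; rewrite bnd_simp ltW.
have S2 : `[mid, hi] `<=` `[lo, hi]%classic by apply: subset_itvr; rewrite bnd_simp ltW.
have fL1 := hoelder_onS S1 fL; have fL2 := hoelder_onS S2 fL.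
have gK1 := hoelder_onS S1 gK; have gK2 := hoelder_onS S2 gK.
pose M := `|f lo| + L * (hi - lo) `^ ga.
have M0 : 0 <= M by rewrite addr_ge0// mulr_ge0// powR_ge0.
have fM x : lo < x < hi -> `|f x| <= M.
  move=> /andP[lox xhi]; rewrite (_ : f x = f lo + (f x - f lo)); last by ring.
  apply: le_trans (ler_normD _ _) _; rewrite lerD2l.
  by apply: (@hoelder_bound lo hi) => //; rewrite ?lexx// !ltW.
have D r : 0 < r -> `|fwd_integral lo hi f g r - fwd_integral lo mid f g r - fwd_integral mid hi f g r|
    <= M * (K * r `^ la) * r.
  move=> r0; rewrite !fwd_integralE//.
  have i0 := @integrable_fwd_integrand lo hi L K ga la f g r (ltW lohi) L0 K0 ga0 la0 fL gK r0.
  have i1 := @integrable_fwd_integrand lo mid L K ga la f g r (ltW lomid) L0 K0 ga0 la0 fL1 gK1 r0.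
  have i2 := @integrable_fwd_integrand mid hi L K ga la f g r (ltW midhi) L0 K0 ga0 la0 fL2 gK2 r0.
  have i01 := integrableB measurableT i0 i1.
  rewrite -RintegralB// -RintegralB//.
  have -> : M * (K * r `^ la) * r = M * (K * r `^ la) * (mid - (mid - r)) by congr (_ * _); ring.
  apply: le_normr_Rintegral_support.
  - by rewrite gerBl ltW.
  - apply: measurable_funB; first apply: measurable_funB.
    + exact: (@measurable_fwd_integrand lo hi L K ga la _ _ _ (ltW lohi)).
    + exact: (@measurable_fwd_integrand lo mid L K ga la _ _ _ (ltW lomid)).
    + exact: (@measurable_fwd_integrand mid hi L K ga la _ _ _ (ltW midhi)).
  - move=> x /andP[xr xmid].
    rewrite [mid < x]ltNge xmid/= subr0 (le_lt_trans xmid midhi) andbT.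
    have MK0 : 0 <= M * (K * r `^ la) by rewrite !mulr_ge0// powR_ge0.
    case: (ltP lo x) => lox /=; last by rewrite subrr normr0.
    have xI : lo < x < hi by rewrite lox (le_lt_trans xmid).
    case: ltP => xm.
      rewrite -mulrBr opprB addrA subrK normrM; apply: ler_pM => //; first exact: fM.
      have xr0 : x < x + r by rewrite ltrDl.
      apply: le_trans (gK _ _ _ _) _; rewrite /= ?in_itv/=.
      + by rewrite ge_min lexx orbT andbT le_min (ltW lohi) ltW// (lt_trans lox).
      + rewrite le_min (ltW lomid) (ltW (lt_trans lox xr0))/=.
        by rewrite ge_min (ltW midhi) orbT.
      rewrite ler_wpM2l//; apply: ge0_ler_powR; rewrite ?nnegrE ?(ltW la0) ?(ltW r0)//.
      rewrite /Num.min ler_norml; case: ifPn => h; case: ifPn => h'; apply/andP; split; lra.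
    rewrite subr0 normrM; apply: ler_pM => //; first exact: fM.
    exact: (@fwd_incr_le lo hi _ _ _ _ _ (ltW lohi)).
  - move=> x; rewrite negb_and -!ltNge => /orP[xr|mx].
      have xmid : x < mid by lra.
      rewrite [mid < x]ltNge (ltW xmid)/= subr0 xmid (lt_trans xmid midhi).
      case: (ltP lo x) => lox /=; last by rewrite subrr.
      have h1 : x + r < mid by lra.
      have h2 : x + r < hi by exact: lt_trans midhi.
      by rewrite /Num.min h1 h2 subrr.
    rewrite mx (lt_trans lomid mx) [x < mid]ltNge (ltW mx)/= subr0.
    by case: ifP => _; rewrite subrr.
move=> e e0; have e3 : 0 < e / 3 by rewrite divr_gt0.
have [d1 d10 Hd1] := H1 _ e3; have [d2 d20 Hd2] := H2 _ e3.
have MK0 : 0 <= M * K by rewrite mulr_ge0.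
have [d3 d30 Hd3] := powR_small la0 MK0 e3.
exists (Num.min d1 (Num.min d2 d3)); first by rewrite !lt_min d10 d20.
move=> r /andP[r0]; rewrite !lt_min => /andP[rd1 /andP[rd2 rd3]].
have {}Hd1 := Hd1 r (introT andP (conj r0 rd1)).
have {}Hd2 := Hd2 r (introT andP (conj r0 rd2)).
have {}Hd3 := Hd3 r (introT andP (conj r0 rd3)).
have {D}D := D r r0.
have D3 : M * (K * r `^ la) * r <= e / 3 * r by rewrite mulrA ler_pM2r.
move: Hd1 Hd2 D D3.
move: (fwd_integral lo hi f g r) (fwd_integral lo mid f g r) (fwd_integral mid hi f g r) => c0 c1 c2.
move=> Hd1 Hd2 D D3.
rewrite (_ : c0 - (l1 + l2) * r = (c0 - c1 - c2) + ((c1 - l1 * r) + (c2 - l2 * r))); last by ring.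
apply: le_trans (ler_normD _ _) _.
have := ler_normD (c1 - l1 * r) (c2 - l2 * r).
have E3 : e * r = e / 3 * r + (e / 3 * r + e / 3 * r) by field.
by rewrite E3 => h; apply: lerD; [exact: le_trans D D3|exact: le_trans h (lerD Hd1 Hd2)].
Qed.

(** A slope exists by [young_local], and [gls_value] identifies v with it, whatever order was chosen
    in the definition. *)
Lemma is_gls_integral_fwd_slope (lo hi L K ga la : R) (f g : R -> R) (v : R) : lo < hi ->
  0 <= L -> 0 <= K -> 0 < ga -> 0 < la -> 1 < ga + la ->
  hoelder_on `[lo, hi] L ga f -> hoelder_on `[lo, hi] K la g ->
  is_gls_integral lo hi f g v -> fwd_slope lo hi f g v.
Proof.
move=> lohi L0 K0 ga0 la0 gala fL gK [al [al01 H1 H2 ->]].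
have [l Hl _] := young_local lohi L0 K0 ga0 la0 gala fL gK.
have mf := H1.1; have mg := H2.1.
pose M := `|f lo| + L * (hi - lo) `^ ga + K * (hi - lo) `^ la.
have L1 : 0 <= L * (hi - lo) `^ ga by rewrite mulr_ge0// powR_ge0.
have K1 : 0 <= K * (hi - lo) `^ la by rewrite mulr_ge0// powR_ge0.
have M0 : 0 <= M by rewrite !addr_ge0.
have fM x : lo < x < hi -> `|f x| <= M.
  move=> /andP[lox xhi]; rewrite (_ : f x = f lo + (f x - f lo)); last by ring.
  apply: le_trans (ler_normD _ _) _; rewrite /M -addrA lerD2l -[leLHS]addr0 lerD//.
  by apply: (@hoelder_bound lo hi) => //; rewrite ?lexx// !ltW.
have gM x : lo < x < hi -> `|g x - g hi| <= M.
  move=> /andP[lox xhi]; rewrite /M -[leLHS]add0r lerD//; first by rewrite addr_ge0.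
  by apply: (@hoelder_bound lo hi) => //; rewrite ?lexx// !ltW.
by rewrite (gls_value lohi mf mg M0 fM gM al01 H1 H2 Hl).
Qed.

(** Two Hoelder constants of f occur: L on [0, T] only makes the slopes exist and add up, while M on
    [s, t] enters the bound. This separation is what lets the estimate improve itself later. The
    integral over [s, t] appears only through its slope. *)
Theorem gls_young_estimate (T L K ga la : R) (f g v : R -> R) :
  0 <= L -> 0 <= K -> 0 < ga -> 0 < la -> 1 < ga + la ->
  hoelder_on `[0, T] L ga f -> hoelder_on `[0, T] K la g ->
  (forall t, 0 <= t <= T -> is_gls_integral 0 t f g (v t)) ->
  forall s t M, 0 <= s -> s < t -> t <= T -> 0 <= M -> hoelder_on `[s, t] M ga f ->
  `|v t - v s - f s * (g t - g s)| <=
    (1 + sewing_cst (ga + la)) * (M * K) * (t - s) `^ (ga + la).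
Proof.
move=> L0 K0 ga0 la0 gala fL gK Hv s t M s0 st tT M0 fM.
have t0 : 0 < t by exact: le_lt_trans st.
have St : `[0, t] `<=` `[0, T]%classic by apply: subset_itvl; rewrite bnd_simp.
have Sst : `[s, t] `<=` `[0, t]%classic by apply: subset_itvr; rewrite bnd_simp.
have fLt := hoelder_onS St fL; have gKt := hoelder_onS St gK.
have fLst := hoelder_onS Sst fLt; have gKst := hoelder_onS Sst gKt.
have Ht : fwd_slope 0 t f g (v t).
  apply: (is_gls_integral_fwd_slope t0 L0 K0 ga0 la0 gala fLt gKt).
  by apply: Hv; rewrite (ltW t0).
have [l Hl lB] := young_local st M0 K0 ga0 la0 gala fM gKst.
suff -> : v t - v s = l by [].
(* For s = 0 the slope lemmas do not apply to the degenerate interval, but v 0 is an integral over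
   the empty set. *)
move: s0; rewrite le_eqVlt => /predU1P[s0|s0].
  have -> : v s = 0.
    rewrite -s0; have := Hv 0; rewrite lexx (le_trans (ltW t0) tT) => /(_ isT).
    by move=> [al [_ _ _ ->]]; rewrite set_itvoo0 Rintegral_set0 oppr0.
  by rewrite subr0; apply: (fwd_slope_unique Ht); rewrite s0.
have Ss : `[0, s] `<=` `[0, t]%classic by apply: subset_itvl; rewrite bnd_simp ltW.
have Hs : fwd_slope 0 s f g (v s).
  apply: (is_gls_integral_fwd_slope s0 L0 K0 ga0 la0 gala (hoelder_onS Ss fLt) (hoelder_onS Ss gKt)).
  by apply: Hv; rewrite (ltW s0) (le_trans (ltW st)).
have H := fwd_slope_chasles s0 st L0 K0 ga0 la0 fLt gKt Hs Hl.
by rewrite (fwd_slope_unique Ht H) addrAC subrr add0r.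
Qed.

End young_estimate.

(** * Growth of the solution along a path *)

Section path_growth.
Context {R : realType}.

(** Absorption without an optimal constant: if every bound A + M improves to A + M / 2, then one
    finite bound, however bad, yields bounds arbitrarily close to A. *)
Lemma half_iteration (Q : R -> Prop) (A : R) :
  (forall M, 0 <= M -> Q (A + M) -> Q (A + M / 2)) ->
  (exists2 M, 0 <= M & Q (A + M)) ->
  forall e, 0 < e -> exists2 M, 0 <= M <= e & Q (A + M).
Proof.
move=> Qhalf [M0 M00 QM0] e e0.
have Qn n : Q (A + M0 / 2 ^+ n).
  elim: n => [|n IH]; first by rewrite expr0 divr1.
  by rewrite exprSr invfM mulrA; apply: Qhalf => //; rewrite divr_ge0// exprn_ge0.
pose n := Num.truncn (M0 / e).
exists (M0 / 2 ^+ n) => //; rewrite divr_ge0 ?exprn_ge0//=.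
rewrite ler_pdivrMr ?exprn_gt0// mulrC -ler_pdivrMr//.
apply: (@le_trans _ _ n.+1%:R); first exact/ltW/truncnS_gt.
by rewrite -natrX ler_nat ltn_expl.
Qed.

Lemma hoelder_on_ordered (lo hi K g : R) (x : R -> R) : 0 < g ->
  (forall s t, lo <= s -> s < t -> t <= hi -> `|x t - x s| <= K * (t - s) `^ g) ->
  hoelder_on `[lo, hi] K g x.
Proof.
move=> g0 H s t; rewrite /= !in_itv/= => /andP[s1 s2] /andP[t1 t2].
case: (ltgtP s t) => [st|ts|->].
- by rewrite distrC [`|s - t|]distrC [`|t - s|]gtr0_norm ?subr_gt0//; exact: H.
- by rewrite [`|s - t|]gtr0_norm ?subr_gt0//; exact: H.
- by rewrite !subrr normr0 powR0 ?gt_eqF// mulr0.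
Qed.

(* The increments of a solution with Hoelder constant L and with 1 + |x| <= m on
   [s, t]: drift, first order term and Young remainder. *)
Definition young_increments (T C S ga la K : R) (x : R -> R) :=
  forall s t m L, 0 <= s -> s < t -> t <= T ->
  (forall u, s <= u <= t -> 1 + `|x u| <= m) ->
  0 <= L -> hoelder_on `[s, t] L ga x ->
  `|x t - x s| <= C * m * (t - s) + C * m * K * (t - s) `^ la
                  + S * (1 + L) * K * (t - s) `^ (ga + la).

Lemma powR_le_id (h la : R) : 0 < h -> h <= 1 -> la <= 1 -> h <= h `^ la.
Proof.
move=> h0 h1 la1; rewrite -[leLHS]powRr1 ?(ltW h0)//.
by rewrite /powR gt_eqF// ler_expR ler_wnM2r// ln_le0.
Qed.

Lemma powR_le1 (h g : R) : 0 <= h -> h <= 1 -> 0 <= g -> h `^ g <= 1.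
Proof.
move=> h0 h1 g0; apply: (@le_trans _ _ (1 `^ g)); last by rewrite powR1.
by apply: ge0_ler_powR => //; rewrite nnegrE.
Qed.

Variables (T C S ga la K : R) (x : R -> R).
Hypotheses (C0 : 0 < C) (S0 : 0 < S) (ga0 : 0 < ga) (gala : ga <= la) (la1 : la <= 1).
Hypothesis K1 : 1 <= K.
Hypothesis xY : young_increments T C S ga la K x.
Variable K0 : R.
Hypotheses (K00 : 0 <= K0) (xK : hoelder_on `[0, T] K0 ga x).

(** With P = C m K (hi - lo)^(la - ga), a Hoelder constant L improves to 2 P + (1 + L) / 2. The
    constant 4 P + 1 is the fixed point, and the excess over it is halved each time. *)
Lemma young_increments_hoelder lo hi m : 0 <= lo -> lo < hi -> hi <= T ->
  hi - lo <= 1 -> S * K * (hi - lo) `^ la <= 2^-1 ->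
  (forall u, lo <= u <= hi -> 1 + `|x u| <= m) ->
  hoelder_on `[lo, hi] (4 * (C * m * K * (hi - lo) `^ (la - ga)) + 1) ga x.
Proof.
move=> lo0 lohi hiT h1 SK xm.
set D := hi - lo in h1 SK *; have D0 : 0 < D by rewrite subr_gt0.
have la0 : 0 < la by exact: lt_le_trans gala.
have K0' : 0 < K by exact: lt_le_trans K1.
have m0 : 0 <= m.
  by apply: le_trans (xm lo _); rewrite ?addr_ge0// lexx ltW.
set P := C * m * K * D `^ (la - ga).
have P0 : 0 <= P by rewrite !mulr_ge0 ?powR_ge0 ?(ltW C0) ?(ltW K0').
(* An arbitrarily small excess suffices, since the Hoelder bound at fixed s and t is continuous in
   the constant. *)
suff H e : 0 < e -> exists2 M, 0 <= M <= e & hoelder_on `[lo, hi] (4 * P + 1 + M) ga x.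
  move=> s t sI tI; apply/ler_addgt0Pl => e e0.
  pose q := e / (`|s - t| `^ ga + 1).
  have q10 : 0 < `|s - t| `^ ga + 1 by rewrite ltr_wpDl// powR_ge0.
  have q0 : 0 < q by rewrite divr_gt0.
  have [M /andP[M0 Mq] HM] := H _ q0.
  apply: le_trans (HM s t sI tI) _; rewrite mulrDl addrC lerD2r.
  apply: (@le_trans _ _ (q * `|s - t| `^ ga)); first by rewrite ler_wpM2r// powR_ge0.
  rewrite /q mulrAC ler_pdivrMr// ler_pM2l// lerDl ler01//.
move=> e0; apply: (@half_iteration (fun M => hoelder_on `[lo, hi] M ga x)) e0; last first.
  exists K0 => // s t /= sI tI; apply: (@le_trans _ _ (K0 * `|s - t| `^ ga)).
    apply: xK; rewrite /= in_itv/=; rewrite !in_itv/= in sI tI.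
      by case/andP: sI => ? ?; apply/andP; split; [exact: le_trans lo0 _|exact: le_trans hiT].
    by case/andP: tI => ? ?; apply/andP; split; [exact: le_trans lo0 _|exact: le_trans hiT].
  by rewrite ler_wpM2r ?powR_ge0// lerDr addr_ge0// mulr_ge0.
move=> M M0 HM.
apply: hoelder_on_ordered => // s t los st thi; set h := t - s.
have h0 : 0 < h by rewrite subr_gt0.
have hD : h <= D by rewrite /h /D lerB.
have Sst : `[s, t] `<=` `[lo, hi]%classic.
  by move=> u; rewrite /= !in_itv/= => /andP[? ?]; apply/andP; split; [exact: le_trans los _|exact: le_trans thi].
have L0 : 0 <= 4 * P + 1 + M by rewrite !addr_ge0// mulr_ge0.
have := @xY s t m (4 * P + 1 + M) (le_trans lo0 los) st (le_trans thi hiT) _ L0 _.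
move=> /(_ _ _)/le_trans; apply.
- by move=> u /andP[su ut]; apply: xm; rewrite (le_trans los)//= (le_trans ut).
- by move=> u w /Sst uI /Sst wI; exact: HM.
rewrite -/h.
have hla : h `^ la = h `^ (la - ga) * h `^ ga.
  by rewrite -powRD ?subrK// (gt_eqF h0) implybT.
have hlaD : h `^ la <= D `^ la.
  by apply: ge0_ler_powR; rewrite ?nnegrE ?(ltW la0) ?(ltW h0) ?(ltW D0).
have hlgD : h `^ (la - ga) <= D `^ (la - ga).
  apply: ge0_ler_powR; rewrite ?nnegrE ?(ltW h0) ?(ltW D0)//.
  by rewrite subr_ge0.
have E1 : C * m * h <= C * m * K * h `^ la.
  rewrite -[leRHS]mulrA ler_wpM2l ?mulr_ge0 ?(ltW C0)//.
  apply: le_trans (powR_le_id h0 (le_trans hD h1) la1) _.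
  by rewrite ler_peMl// powR_ge0.
have E2 : C * m * K * h `^ la <= P * h `^ ga.
  rewrite hla mulrA ler_wpM2r ?powR_ge0// ler_wpM2l//.
  by rewrite !mulr_ge0 ?(ltW C0) ?(ltW K0').
have E3 : S * (1 + (4 * P + 1 + M)) * K * h `^ (ga + la) <= 2^-1 * (1 + (4 * P + 1 + M)) * h `^ ga.
  rewrite [h `^ (ga + la)]powRD; last by rewrite (gt_eqF h0) implybT.
  rewrite (_ : _ * (_ * _) = S * K * h `^ la * (1 + (4 * P + 1 + M)) * h `^ ga); last by ring.
  have L1 : 0 <= 1 + (4 * P + 1 + M) by rewrite addr_ge0.
  rewrite ler_wpM2r ?powR_ge0// ler_wpM2r//.
  by apply: le_trans SK; rewrite ler_wpM2l// mulr_ge0 ?ltW.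
apply: le_trans (lerD (lerD (le_trans E1 E2) E2) E3) _.
by rewrite le_eqVlt; apply/orP; left; apply/eqP; field.
Qed.

(** If 1 + |x| <= m on the interval, the Hoelder bound improves this to 2 + |x lo| + m / 2, as 4
    times 1/8 is 1/2. For m = 4 (1 + |x lo|) + M this is at most 4 (1 + |x lo|) + M / 2, so
    [half_iteration] applies. *)
Lemma young_increments_step lo hi : 0 <= lo -> lo <= hi -> hi <= T ->
  hi - lo <= 1 -> S * K * (hi - lo) `^ la <= 2^-1 ->
  C * K * (hi - lo) `^ la <= 8^-1 ->
  1 + `|x hi| <= 4 * (1 + `|x lo|).
Proof.
move=> lo0; rewrite le_eqVlt => /predU1P[<- _ _ _ _|lohi hiT h1 SK CK].
  by rewrite ler_peMl ?addr_ge0// ler1n.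
have D0 : 0 < hi - lo by rewrite subr_gt0.
pose Q m := forall u, lo <= u <= hi -> 1 + `|x u| <= m.
have K0' : 0 < K by exact: lt_le_trans K1.
have la0 : 0 < la by exact: lt_le_trans gala.
set A := 4 * (1 + `|x lo|).
have A4 : 4 <= A by rewrite ler_peMr// lerDl.
suff H e : 0 < e -> exists2 M, 0 <= M <= e & Q (A + M).
  apply/ler_addgt0Pl => e /H[M /andP[_ Me] QM].
  by apply: le_trans (QM hi _) _; [rewrite lexx (ltW lohi)|rewrite addrC lerD2r].
move=> e0; apply: half_iteration e0; last first.
  have T0 : 0 <= T by rewrite (le_trans lo0)// (le_trans (ltW lohi)).
  exists (1 + `|x lo| + K0 * T `^ ga); first by rewrite !addr_ge0// mulr_ge0// powR_ge0.
  move=> u /andP[lou uhi].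
  have /(_ _ _)/= := xK (x := u) (y := lo).
  rewrite !in_itv/= (le_trans lo0 lou) (le_trans uhi hiT) lo0 (le_trans (ltW lohi) hiT).
  move=> /(_ isT isT) ux.
  have : `|u - lo| `^ ga <= T `^ ga.
    apply: ge0_ler_powR; rewrite ?nnegrE ?(ltW ga0)//.
    by rewrite ger0_norm ?subr_ge0// lerBlDr (le_trans (le_trans uhi hiT))// lerDl.
  move=> /(ler_wpM2l K00) h2.
  have h3 : `|x u| <= `|x u - x lo| + `|x lo|.
    by apply: le_trans (ler_normD _ _); rewrite subrK.
  by have := le_trans ux h2; lra.
move=> M M0 QM u /andP[lou uhi].
have AM0 : 0 <= A + M by rewrite addr_ge0// (le_trans _ A4).
have /(_ u lo)/= := young_increments_hoelder lo0 lohi hiT h1 SK QM.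
rewrite !in_itv/= lexx lou uhi (ltW lohi) => /(_ isT isT) H.
have ul : `|u - lo| <= hi - lo by rewrite ger0_norm ?subr_ge0// lerB.
have h2 : `|u - lo| `^ ga <= (hi - lo) `^ ga.
  by apply: ge0_ler_powR; rewrite ?nnegrE ?(ltW ga0) ?(ltW D0).
have h4 : (hi - lo) `^ ga <= 1 by rewrite powR_le1// ltW.
have P0 : 0 <= C * (A + M) * K * (hi - lo) `^ (la - ga).
  by rewrite !mulr_ge0 ?powR_ge0 ?(ltW C0) ?(ltW K0').
have h5 : `|x u - x lo| <= 4 * (C * K * (hi - lo) `^ la) * (A + M) + 1.
  apply: le_trans H _; apply: (@le_trans _ _ ((4 * (C * (A + M) * K * (hi - lo) `^ (la - ga)) + 1) * (hi - lo) `^ ga)).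
    by rewrite ler_wpM2l// addr_ge0// mulr_ge0.
  rewrite mulrDl mul1r lerD// le_eqVlt; apply/orP; left; apply/eqP.
  have -> : (hi - lo) `^ la = (hi - lo) `^ (la - ga) * (hi - lo) `^ ga.
    by rewrite -powRD ?subrK// (gt_eqF D0) implybT.
  by ring.
have h6 : (C * K * (hi - lo) `^ la) * (A + M) <= 8^-1 * (A + M) by rewrite ler_wpM2r.
have h3 : `|x u| <= `|x u - x lo| + `|x lo|.
  by apply: le_trans (ler_normD _ _); rewrite subrK.
have h7 : A = 4 * (1 + `|x lo|) by [].
move: h5 h6 h3 h7 A4; rewrite -mulrA.
move: (_ * (A + M)) `|x u| `|x u - x lo| `|x lo| => p q r w *; lra.
Qed.

Variable D : R.
Hypotheses (D0 : 0 < D) (D1 : D <= 1).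
Hypotheses (SKD : S * K * D `^ la <= 2^-1) (CKD : C * K * D `^ la <= 8^-1).

Lemma young_increments_sup n t : 0 <= t -> t <= T -> t <= n%:R * D ->
  1 + `|x t| <= 4 ^+ n * (1 + `|x 0|).
Proof.
have K0' : 0 < K by exact: lt_le_trans K1.
have la0 : 0 < la by exact: lt_le_trans gala.
elim: n t => [|n IH] t t0 tT.
  by rewrite mul0r => t0'; rewrite expr0 mul1r (_ : t = 0)//; apply/le_anti; rewrite t0 t0'.
move=> tn; have nD0 : 0 <= n%:R * D by rewrite mulr_ge0// ltW.
have [tn'|tn'] := leP t (n%:R * D).
  apply: le_trans (IH t t0 tT tn') _.
  by rewrite ler_wpM2r ?addr_ge0// exprS ler_peMl ?exprn_ge0// ler1n.
have tD : t - n%:R * D <= D by rewrite lerBlDr; move: tn; rewrite -natr1 mulrDl mul1r addrC.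
have tDl : (t - n%:R * D) `^ la <= D `^ la.
  by apply: ge0_ler_powR; rewrite ?nnegrE ?subr_ge0 ?(ltW tn') ?(ltW la0) ?(ltW D0).
apply: le_trans (young_increments_step nD0 (ltW tn') tT _ _ _) _.
- exact: le_trans tD D1.
- by apply: le_trans SKD; rewrite ler_wpM2l// mulr_ge0// ltW.
- by apply: le_trans CKD; rewrite ler_wpM2l// mulr_ge0// ltW.
by rewrite exprS -mulrA ler_pM2l//; apply: IH => //; exact: le_trans (ltW tn') tT.
Qed.

(** The exponent is raised from ga to la, since ga may be below alpha. For lags up to D, the local
    constant of order ga is put back into [xY], where every term is then of order (t - s)^la; for
    longer lags 2 m <= 2 m ((t - s) / D)^la. *)
Lemma young_increments_global m : (forall u, 0 <= u <= T -> 1 + `|x u| <= m) ->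
  hoelder_on `[0, T] ((2 * C + 4 * S * C + 2 * S) * m * K ^+ 2 + 2 * m / D `^ la) la x.
Proof.
move=> xm.
have K0' : 0 < K by exact: lt_le_trans K1.
have la0 : 0 < la by exact: lt_le_trans gala.
apply: hoelder_on_ordered => // s t s0 st tT; set h := t - s.
have h0 : 0 < h by rewrite subr_gt0.
have xmst u : s <= u <= t -> 1 + `|x u| <= m.
  by move=> /andP[su ut]; apply: xm; rewrite (le_trans s0)//= (le_trans ut).
have m1 : 1 <= m by apply: le_trans (xmst t _); rewrite ?lerDl// lexx ltW.
have m0 : 0 < m by exact: lt_le_trans m1.
have Q1 : 0 <= (2 * C + 4 * S * C + 2 * S) * m * K ^+ 2.
  by rewrite !mulr_ge0 ?addr_ge0 ?mulr_ge0 ?exprn_ge0 ?(ltW C0) ?(ltW S0) ?(ltW m0) ?(ltW K0').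
have Q2 : 0 <= 2 * m / D `^ la by rewrite divr_ge0 ?powR_ge0// mulr_ge0// ltW.
rewrite mulrDl; case: (leP h D) => [hD|Dh]; last first.
  rewrite -[leLHS]add0r; apply: lerD; first by rewrite mulr_ge0 ?powR_ge0.
  apply: (@le_trans _ _ (2 * m)).
    apply: le_trans (ler_normB _ _) _; rewrite mulrDl !mul1r.
    have := xmst t; have := xmst s; rewrite !lexx (ltW st) => /(_ isT) a1 /(_ isT) a2.
    by apply: lerD; [apply: le_trans a2|apply: le_trans a1]; rewrite lerDr.
  rewrite -[leRHS]mulrA; apply: ler_peMr; first by rewrite mulr_ge0 ?(ltW m0).
  rewrite mulrC ler_pdivlMr ?powR_gt0// mul1r.
  by apply: ge0_ler_powR; rewrite ?nnegrE ?(ltW la0) ?(ltW D0) ?(ltW h0) ?(ltW Dh).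
rewrite -[leLHS]addr0; apply: lerD; last by rewrite mulr_ge0 ?powR_ge0.
have h1 : h <= 1 by exact: le_trans D1.
have hl : h `^ la <= D `^ la by apply: ge0_ler_powR; rewrite ?nnegrE ?(ltW la0) ?(ltW D0) ?(ltW h0).
have SKh : S * K * h `^ la <= 2^-1.
  by apply: le_trans SKD; rewrite ler_wpM2l// mulr_ge0// ltW.
have P0 : 0 <= C * m * K * h `^ (la - ga).
  by rewrite !mulr_ge0 ?powR_ge0 ?(ltW C0) ?(ltW K0') ?(ltW m0).
have HH := young_increments_hoelder s0 st tT h1 SKh xmst.
have L0 : 0 <= 4 * (C * m * K * h `^ (la - ga)) + 1 by rewrite addr_ge0// mulr_ge0.
apply: le_trans (xY s0 st tT xmst L0 HH) _; rewrite -/h.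
have hg1 : h `^ (la - ga) <= 1 by rewrite powR_le1 ?subr_ge0// ltW.
have hg2 : h `^ ga <= 1 by rewrite powR_le1 ?(ltW h0) ?(ltW ga0).
have E1 : C * m * h <= C * m * K ^+ 2 * h `^ la.
  rewrite -[leRHS]mulrA ler_wpM2l ?mulr_ge0 ?(ltW C0) ?(ltW m0)//.
  apply: le_trans (powR_le_id h0 h1 la1) _.
  by rewrite ler_peMl ?powR_ge0// exprn_ege1.
have E2 : C * m * K * h `^ la <= C * m * K ^+ 2 * h `^ la.
  rewrite ler_wpM2r ?powR_ge0// ler_wpM2l ?mulr_ge0 ?(ltW C0) ?(ltW m0)//.
  by rewrite expr2 ler_peMl// ltW.
have E3 : S * (1 + (4 * (C * m * K * h `^ (la - ga)) + 1)) * K * h `^ (ga + la) <=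
    (4 * S * C + 2 * S) * m * K ^+ 2 * h `^ la.
  rewrite [h `^ (ga + la)]powRD; last by rewrite (gt_eqF h0) implybT.
  rewrite (_ : _ * (_ * _) = S * K * (2 + 4 * (C * m * K * h `^ (la - ga))) * h `^ ga * h `^ la); last by ring.
  rewrite ler_wpM2r ?powR_ge0//.
  have SK0 : 0 <= S * K by rewrite mulr_ge0 ?(ltW S0) ?(ltW K0').
  apply: (@le_trans _ _ (S * K * (2 + 4 * (C * m * K * h `^ (la - ga))))).
    by rewrite ler_piMr// mulr_ge0// addr_ge0// mulr_ge0.
  rewrite (_ : (_ + _) * _ * _ = S * K * (2 * (m * K) + 4 * (C * m * K))); last by ring.
  rewrite ler_wpM2l//; apply: lerD.
    by rewrite ler_peMr// -[leLHS]mulr1 ler_pM.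
  by rewrite ler_wpM2l// ler_piMr// !mulr_ge0 ?(ltW C0) ?(ltW K0') ?(ltW m0).
apply: le_trans (lerD (lerD E1 E2) E3) _.
by rewrite -!mulrDl le_eqVlt; apply/orP; left; apply/eqP; ring.
Qed.

End path_growth.

(** * Exponential growth in the Hoelder constant of the driver *)

Section exponential_bound.
Context {R : realType}.

Lemma expR_ge_id (x : R) : x <= expR x.
Proof. by apply: le_trans (expR_ge1Dx x); rewrite lerDr. Qed.

Lemma young_increments_exp (T C S ga la x0 : R) : 0 <= T -> 0 < C -> 0 < S ->
  0 < ga -> ga <= la -> la <= 1 ->
  exists2 c3 : R, 0 <= c3 & forall K K0 (x : R -> R), 1 <= K ->
  young_increments T C S ga la K x -> 0 <= K0 -> hoelder_on `[0, T] K0 ga x -> x 0 = x0 ->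
  (forall t, 0 <= t <= T -> 1 + `|x t| <= expR (c3 * K `^ la^-1)) /\
  hoelder_on `[0, T] (expR (c3 * K `^ la^-1)) la x.
Proof.
move=> T0 C0 S0 ga0 gala la1.
have la0 : 0 < la by exact: lt_le_trans gala.
(* With D^la = 1 / (q K), the summands 2 S and 8 C give the two smallness conditions on D, and the
   summand 1 gives D <= 1. *)
pose q := 1 + 2 * S + 8 * C.
have q1 : 1 <= q by rewrite /q -addrA lerDl addr_ge0// mulr_ge0// ltW.
have q0 : 0 < q by exact: lt_le_trans q1.
pose q2 := 2 * C + 4 * S * C + 2 * S.
have q20 : 0 <= q2 by rewrite /q2 !addr_ge0 ?mulr_ge0 ?(ltW C0) ?(ltW S0).
(* At most 1 + T / D = 1 + T (q K)^(1/la) steps are taken, and 4^n <= exp(4 n). *)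
pose c1 := 4 * (1 + T * q `^ la^-1).
have c10 : 0 <= c1 by rewrite mulr_ge0// addr_ge0// mulr_ge0// powR_ge0.
(* One summand for each factor put in exponential form: c1 for 4^n, |x0| for 1 + |x0|, q2 + 2 q for
   the coefficient in [young_increments_global], and 2 for K^2. *)
pose c3 := c1 + `|x0| + (q2 + 2 * q) + 2.
have q20' : 0 <= 2 * q by rewrite mulr_ge0// ltW.
exists c3.
  by apply: addr_ge0 => //; apply: addr_ge0; apply: addr_ge0.
move=> K K0 x K1 xY K00 xK xx0; set U := K `^ la^-1.
have K0' : 0 < K by exact: lt_le_trans K1.
have qK1 : 1 <= q * K by rewrite -[leLHS]mulr1 ler_pM.
have qK0 : 0 < q * K by exact: lt_le_trans qK1.
have KU : K <= U.
  rewrite /U -[leLHS](powRr1 (ltW K0')) /powR gt_eqF// ler_expR ler_wpM2r// ?ln_ge0//.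
  by rewrite -invr1 lef_pV2 ?posrE.
have U1 : 1 <= U by exact: le_trans KU.
pose D := (q * K) `^ (- la^-1).
have Dla : D `^ la = (q * K)^-1 by rewrite /D -powRrM mulNr mulVf ?gt_eqF// powR_inv1// ltW.
have D0 : 0 < D by rewrite powR_gt0.
have D1 : D <= 1.
  rewrite /D powRN invf_le1 ?powR_gt0//.
  apply: (@le_trans _ _ (1 `^ la^-1)); first by rewrite powR1.
  by apply: ge0_ler_powR; rewrite ?nnegrE ?invr_ge0 ?(ltW la0) ?(ltW qK0).
have SKD : S * K * D `^ la <= 2^-1.
  rewrite Dla ler_pdivrMr//; suff : 0 <= K * (1 + 8 * C) by rewrite /q; lra.
  by rewrite mulr_ge0 ?(ltW K0')// addr_ge0// mulr_ge0// ltW.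
have CKD : C * K * D `^ la <= 8^-1.
  rewrite Dla ler_pdivrMr//; suff : 0 <= K * (1 + 2 * S) by rewrite /q; lra.
  by rewrite mulr_ge0 ?(ltW K0')// addr_ge0// mulr_ge0// ltW.
pose n := (Num.truncn (T / D)).+1.
have TD0 : 0 <= T / D by rewrite divr_ge0// ltW.
have nT : T <= n%:R * D by rewrite -ler_pdivrMr// ltW// truncnS_gt.
have nU : 4 * n%:R <= c1 * U.
  rewrite /c1 -mulrA ler_pM2l// mulrDl mul1r /n -natr1 addrC lerD//.
  have /andP[h _] := truncn_itv TD0; apply: le_trans h _.
  by rewrite /D powRN invrK powRM ?(ltW q0) ?(ltW K0')// mulrA.
pose m := 4 ^+ n * (1 + `|x 0|).
have sup t : 0 <= t <= T -> 1 + `|x t| <= m.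
  move=> /andP[t0 tT]; apply: (young_increments_sup C0 S0 ga0 gala la1 K1 xY K00 xK D0 D1 SKD CKD t0 tT).
  exact: le_trans nT.
have mE : m <= expR ((c1 + `|x0|) * U).
  rewrite mulrDl expRD; apply: ler_pM; rewrite ?exprn_ge0 ?addr_ge0//.
    apply: (@le_trans _ _ (expR 4 ^+ n)).
      by rewrite ler_pXn2r ?nnegrE ?expR_ge0//; exact: expR_ge_id.
    by rewrite -expRM_natr ler_expR.
  rewrite xx0; apply: le_trans (expR_ge1Dx _) _.
  by rewrite ler_expR ler_peMr.
have m0 : 0 <= m by rewrite mulr_ge0 ?exprn_ge0// addr_ge0.
have qq0 : 0 <= q2 + 2 * q by exact: addr_ge0.
have R0 : 0 <= (q2 + 2 * q + 2) * U by rewrite mulr_ge0 ?(le_trans _ U1)// addr_ge0.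
split=> [t /sup /le_trans|].
  apply; apply: le_trans mE _; rewrite ler_expR.
  by move: R0; rewrite /c3 !mulrDl; lra.
have H := young_increments_global C0 S0 ga0 gala la1 K1 xY K00 xK D0 D1 SKD sup.
move=> s t sI tI; apply: le_trans (H s t sI tI) _.
rewrite ler_wpM2r ?powR_ge0// Dla invrK -/q2.
have -> : c3 * U = (c1 + `|x0|) * U + ((q2 + 2 * q) * U + 2 * U) by rewrite /c3; ring.
rewrite expRD; apply: (@le_trans _ _ (m * ((q2 + 2 * q) * K ^+ 2))).
  have : K <= K ^+ 2 by rewrite expr2 ler_peMl// ltW.
  have qm0 : 0 <= 2 * m * q by rewrite !mulr_ge0// ltW.
  by move=> /(ler_wpM2l qm0); lra.
apply: ler_pM => //; first by rewrite mulr_ge0 ?exprn_ge0 ?(ltW K0').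
rewrite expRD; apply: ler_pM; rewrite ?exprn_ge0 ?(ltW K0')//.
- apply: le_trans (expR_ge_id _) _; rewrite ler_expR ler_peMr//.
- rewrite expRM_natl ler_pXn2r ?nnegrE ?expR_ge0 ?(ltW K0')//.
  exact: le_trans (expR_ge_id _).
Qed.

End exponential_bound.

(** * The equation and the fractional norm along one path *)

Section sde_path.
Context {R : realType}.
Local Notation mu := (@lebesgue_measure R).

Lemma lipschitz_of_derive1 (f : R -> R) (C : R) : (forall x, derivable f x 1) ->
  (forall x, `|derive1 f x| <= C) -> forall x y, `|f x - f y| <= C * `|x - y|.
Proof.
move=> df fC.
suff H x y : x < y -> `|f y - f x| <= C * (y - x).
  move=> x y; case: (ltgtP x y) => [xy|yx|->]; last by rewrite !subrr normr0 mulr0.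
    by rewrite distrC (distrC x) [`|y - x|]gtr0_norm ?subr_gt0//; exact: H.
  by rewrite [`|x - y|]gtr0_norm ?subr_gt0//; exact: H.
move=> xy.
have [z _ ->] := @MVT R f (derive1 f) x y xy
   (fun z _ => eq_rect_r (fun u => is_derive z 1 f u) (derivableP (df z)) (derive1E f z))
   (derivable_within_continuous (fun z _ => df z)).
by rewrite normrM [`|y - x|]gtr0_norm ?subr_gt0// ler_wpM2r// subr_ge0 ltW.
Qed.

(** If x has Hoelder constant L of order ga on an interval, then s |-> c(s, x s) has constant at
    most C (1 + T^(beta - ga)) (1 + L): the time regularity beta >= ga costs the power of T. The
    Young estimate for this integrand gives the remainder, whatever the global constant K0. *)
Lemma sde_young_increments (T C beta ga la K K0 x0 : R) (a c : R -> R -> R) (x g : R -> R) :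
  0 < T -> 0 < C -> 0 < ga -> ga <= beta -> 0 < la -> 1 < ga + la ->
  0 <= K0 -> 0 <= K ->
  (forall t y, 0 <= t <= T -> `|a t y| <= C * (1 + `|y|)) ->
  (forall t y, 0 <= t <= T -> `|c t y| <= C * (1 + `|y|)) ->
  (forall s t y z, 0 <= s <= T -> 0 <= t <= T ->
     `|c s y - c t z| <= C * `|s - t| `^ beta + C * `|y - z|) ->
  hoelder_on `[0, T] K0 ga x -> hoelder_on `[0, T] K la g ->
  (forall t, 0 <= t <= T -> mu.-integrable `[0, t] (fun s => (a s (x s))%:E) /\
     exists2 v : R, is_gls_integral 0 t (fun s => c s (x s)) g v &
     x t = x0 + \int[mu]_(s in `[0, t]) a s (x s) + v) ->
  young_increments T C ((1 + sewing_cst (ga + la)) * (C * (1 + T `^ (beta - ga)))) ga la K x.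
Proof.
move=> T0 C0 ga0 gab la0 gala K00 K0' aC cC cH xK gK xE.
pose f s := c s (x s).
pose A t := \int[mu]_(s in `[0, t]) a s (x s).
pose v t := x t - x0 - A t.
set S2 := C * (1 + T `^ (beta - ga)).
have S20 : 0 <= S2 by rewrite mulr_ge0 ?(ltW C0)// addr_ge0// powR_ge0.
have Hv t : 0 <= t <= T -> is_gls_integral 0 t f g (v t).
  move=> /xE[_ [w Hw E]]; suff -> : v t = w by [].
  by rewrite /v E /A; ring.
have fH lo hi L : 0 <= lo -> hi <= T -> 0 <= L -> hoelder_on `[lo, hi] L ga x ->
    hoelder_on `[lo, hi] (S2 * (1 + L)) ga f.
  move=> lo0 hiT L0 HL s t sI tI.
  have := sI; have := tI; rewrite /= !in_itv/= => /andP[t1 t2] /andP[s1 s2].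
  have s01 : 0 <= s <= T by rewrite (le_trans lo0 s1) (le_trans s2 hiT).
  have t01 : 0 <= t <= T by rewrite (le_trans lo0 t1) (le_trans t2 hiT).
  apply: le_trans (cH s t (x s) (x t) s01 t01) _.
  have E1 : `|s - t| `^ beta <= T `^ (beta - ga) * `|s - t| `^ ga.
    have stT : `|s - t| <= T.
      by case/andP: s01 => ? ?; case/andP: t01 => ? ?; rewrite ler_norml; apply/andP; split; lra.
    have [->|st0] := eqVneq s t.
      by rewrite subrr normr0 !powR0 ?mulr0 ?gt_eqF// (lt_le_trans ga0).
    have -> : `|s - t| `^ beta = `|s - t| `^ (beta - ga) * `|s - t| `^ ga.
      by rewrite -powRD ?subrK// normr_eq0 subr_eq0 (negbTE st0) implybT.
    rewrite ler_wpM2r ?powR_ge0//; apply: ge0_ler_powR; rewrite ?nnegrE ?(ltW T0)//.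
    by rewrite subr_ge0.
  have E2 := HL s t sI tI.
  have p0 : 0 <= `|s - t| `^ ga by exact: powR_ge0.
  have b0 : 0 <= T `^ (beta - ga) by exact: powR_ge0.
  apply: (@le_trans _ _ (C * (T `^ (beta - ga) * `|s - t| `^ ga) + C * (L * `|s - t| `^ ga))).
    by apply: lerD; rewrite ler_wpM2l// ltW.
  rewrite /S2 -mulrDr -!mulrA ler_pM2l// -mulrDl mulrA ler_wpM2r//.
  rewrite [leRHS](_ : _ = (T `^ (beta - ga) + L) + (1 + T `^ (beta - ga) * L)); last by ring.
  by rewrite lerDl addr_ge0// mulr_ge0.
have SL0 : 0 <= S2 * (1 + K0) by rewrite mulr_ge0// addr_ge0.
have fK := fH 0 T K0 (lexx _) (lexx _) K00 xK.
have Y := gls_young_estimate SL0 K0' ga0 la0 gala fK gK Hv.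
move=> s t m L s0 st tT xm L0 HL.
have {Y}Y := Y s t (S2 * (1 + L)) s0 st tT (mulr_ge0 S20 (addr_ge0 ler01 L0)) (fH s t L s0 tT L0 HL).
have t0T : 0 <= t <= T by rewrite (le_trans s0 (ltW st)) tT.
have s0T : 0 <= s <= T by rewrite s0 (le_trans (ltW st)).
have m0 : 0 <= m by apply: le_trans (xm s _); rewrite ?addr_ge0// lexx ltW.
have [It _] := xE t t0T.
have AE : A t - A s = \int[mu]_(u in `]s, t]) a u (x u).
  by rewrite /A Rintegral_itvB// bnd_simp// ltW.
have AB : `|A t - A s| <= C * m * (t - s).
  rewrite AE; apply: le_normr_Rintegral_itv; first exact: ltW.
    apply: (@measurable_funS _ _ _ _ `[0, t]%classic) => //.
      by apply: subset_itvr; rewrite bnd_simp.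
    by apply/measurable_EFinP; exact: measurable_int It.
  move=> u /andP[su ut]; have u0T : 0 <= u <= T by rewrite (le_trans s0 su) (le_trans ut tT).
  apply: le_trans (aC u (x u) u0T) _; rewrite ler_pM2l//; apply: xm; rewrite su//.
have fB : `|f s * (g t - g s)| <= C * m * K * (t - s) `^ la.
  rewrite normrM -[leRHS]mulrA; apply: ler_pM => //.
    apply: le_trans (cC s (x s) s0T) _; rewrite ler_pM2l//; apply: xm; rewrite lexx ltW//.
  have := gK t s; rewrite /= !in_itv/= t0T s0T => /(_ isT isT).
  by rewrite [`|t - s|]gtr0_norm// subr_gt0.
have -> : x t - x s = (A t - A s) + (f s * (g t - g s)) + (v t - v s - f s * (g t - g s)).
  by rewrite /v; ring.
apply: le_trans (ler_normD _ _) _; apply: lerD.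
  by apply: le_trans (ler_normD _ _) _; exact: lerD.
apply: le_trans Y _; rewrite le_eqVlt; apply/orP; left; apply/eqP; ring.
Qed.

Lemma sde_path_start (x0 : R) (a c : R -> R -> R) (x g : R -> R) :
  (exists2 v : R, is_gls_integral 0 0 (fun s => c s (x s)) g v &
     x 0 = x0 + \int[mu]_(s in `[0, 0]) a s (x s) + v) -> x 0 = x0.
Proof.
move=> [v [al [_ _ _ ->]] ->].
by rewrite set_itv1 Rintegral_set1 set_itvoo0 Rintegral_set0 oppr0 !addr0.
Qed.

(** The integrand of the fractional part of [frac_sup_norm], extended by 0, so that s no longer
    appears in the domain of integration; Fatou and joint measurability then apply. *)
Definition frac_integrand (al : R) (f : R -> R) (s u : R) : \bar R :=
  if 0 < u < s then (`|f s - f u| * (s - u) `^ (- (1 + al)))%:E else 0%E.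

Lemma frac_integrand_ge0 al f s u : (0 <= frac_integrand al f s u)%E.
Proof. by rewrite /frac_integrand; case: ifP => // _; rewrite lee_fin mulr_ge0 ?powR_ge0. Qed.

Lemma integral_frac_integrand al (f : R -> R) s :
  (\int[mu]_(u in `]0%R, s[) (`|f s - f u| / (s - u) `^ (1 + al))%:E =
   \int[mu]_u frac_integrand al f s u)%E.
Proof.
rewrite integral_mkcond; apply: eq_integral => u _.
by rewrite patchE mem_setE in_itv/= /frac_integrand powRN.
Qed.

Lemma measurable_powR_sub (al s : R) : measurable_fun setT (fun u : R => (s - u) `^ (- (1 + al))).
Proof.
have mpw : measurable_fun setT (fun p : R => p `^ (- (1 + al))) by exact: measurable_powR.
by apply: (measurableT_comp mpw); exact: measurable_funB.
Qed.

Lemma measurable_frac_integrand al (f : R -> R) s : measurable_fun setT f ->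
  measurable_fun setT (frac_integrand al f s).
Proof.
move=> mf; apply: measurable_fun_ifT => //.
  by apply: measurable_and; exact: measurable_fun_ltr.
apply/measurable_EFinP; apply: measurable_funM; last exact: measurable_powR_sub.
by apply: measurableT_comp => //; exact: measurable_funB.
Qed.

(** The Hoelder bound leaves the singularity (s - u)^(la - al - 1), integrable because al < la. *)
Lemma frac_sup_norm_le (T al la E E' : R) (x : R -> R) : 0 < T -> 0 <= E' -> al < la -> 0 < la ->
  (forall t, 0 <= t <= T -> `|x t| <= E) -> hoelder_on `[0, T] E' la x ->
  (frac_sup_norm al T x <= (E + E' * (T `^ (la - al) / (la - al)))%:E)%E.
Proof.
move=> T0 E'0 alla la0 xE xH; rewrite EFinD; apply: leeD.
  by apply: ge_ereal_sup => _ /= [t tI <-]; rewrite lee_fin; apply: xE; rewrite in_itv in tI.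
have d0 : 0 < la - al by rewrite subr_gt0.
apply: ge_ereal_sup => _ /= [s sI <-]; rewrite in_itv/= in sI; case/andP: sI.
rewrite le_eqVlt => /predU1P[<- _|s0 sT].
  by rewrite set_itvoo0 integral_set0 lee_fin mulr_ge0// divr_ge0 ?powR_ge0// ltW.
(* Nothing is known of x outside [0, T]; the clamped path is measurable on the line and has the same
   integrals. *)
pose xc : R -> R := x \o clamp 0 T.
have mx : measurable_fun setT xc.
  apply: continuous_measurable_fun; apply: (@hoelder_continuous _ E' la) => //.
  exact: (hoelder_clamp (ltW T0)).
pose h (p : R) : \bar R := if 0 < p < s then (E' * p `^ (la - al - 1))%:E else 0%E.
have mh : measurable_fun setT h.
  apply: measurable_fun_ifT => //.
    by apply: measurable_and; exact: measurable_fun_ltr.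
  by apply/measurable_EFinP; apply: measurable_funM => //; exact: measurable_powR.
have h0 p : (0 <= h p)%E by rewrite /h; case: ifP => // _; rewrite lee_fin mulr_ge0// powR_ge0.
pose k := frac_integrand al xc s.
have kh u : (k u <= h (s - u)%R)%E.
  rewrite /k /frac_integrand /h subr_gt0 (_ : (s - u < s) = (0 < u)); last by rewrite ltrBlDr ltrDl.
  rewrite andbC; case: ifP => // /andP[us u0]; rewrite lee_fin.
  have su0 : 0 < s - u by rewrite subr_gt0.
  rewrite powRN ler_pdivrMr ?powR_gt0// -mulrA -powRD; last by rewrite (gt_eqF su0) implybT.
  rewrite (_ : la - al - 1 + (1 + al) = la); last by ring.
  have sI : 0 <= s <= T by rewrite (ltW s0).
  have uI : 0 <= u <= T by rewrite (ltW u0) (le_trans (ltW us)).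
  rewrite /xc /= !clamp_id//; apply: le_trans (xH _ _ _ _) _; rewrite /= ?in_itv//=.
  by rewrite gtr0_norm.
have -> : (\int[mu]_(u in `]0%R, s[) (`|x s - x u| / (s - u) `^ (1 + al))%:E = \int[mu]_u k u)%E.
  rewrite -integral_frac_integrand; apply: eq_integral => u; rewrite inE/= in_itv/= => /andP[u0 us].
  by rewrite /xc /= !clamp_id// ?(ltW s0) ?(ltW u0)//= (le_trans (ltW us)).
apply: (@le_trans _ _ (\int[mu]_u h (s - u)%R)%E).
  apply: ge0_le_integral => //.
  - by move=> u _; exact: frac_integrand_ge0.
  - exact: measurable_frac_integrand.
  - by apply: (measurableT_comp mh); exact: measurable_funB.
rewrite (ge0_integral_reflect s mh h0).
have -> : (\int[mu]_p h p = \int[mu]_(p in `]0%R, s[) (E'%:E * (p `^ (la - al - 1))%:E))%E.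
  rewrite [RHS]integral_mkcond; apply: eq_integral => u _.
  by rewrite patchE mem_setE in_itv/= /h; case: ifP.
have mp : measurable_fun setT (fun p : R => (p `^ (la - al - 1))%:E).
  by apply/measurable_EFinP; exact: measurable_powR.
rewrite ge0_integralZl//; last 2 first.
- exact: measurable_funTS.
- by move=> p _; rewrite lee_fin powR_ge0.
rewrite EFinM; apply: lee_wpmul2l; first by rewrite lee_fin.
apply: (@le_trans _ _ (s `^ (la - al) / (la - al))%:E); last first.
  rewrite lee_fin ler_pM2r ?invr_gt0//.
  by apply: ge0_ler_powR; rewrite ?nnegrE ?(ltW d0) ?(ltW s0) ?(ltW T0).
apply: le_trans (integral_powR_head d0 s0); apply: ge0_subset_integral => //.
- exact: measurable_funTS.
- by move=> p _; rewrite lee_fin powR_ge0.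
- by apply: subset_itvl; rewrite bnd_simp.
Qed.

End sde_path.

(** * The Hoelder constant of fractional Brownian motion *)

Section dyadic.
Context {R : realType}.
Variables (T : R).
Hypothesis T0 : 0 < T.

Definition dyadic_point (n k : nat) : R := k%:R * (T / 2 ^+ n).
Definition dyadic_index (n : nat) (t : R) : nat := Num.truncn (2 ^+ n * (t / T)).
Definition dyadic_floor n t := dyadic_point n (dyadic_index n t).

Lemma dyadic_point_ge0 n k : 0 <= dyadic_point n k.
Proof. by rewrite mulr_ge0// divr_ge0 ?exprn_ge0// ltW. Qed.

Lemma dyadic_point_leT n k : (k <= 2 ^ n)%N -> dyadic_point n k <= T.
Proof.
move=> kn; rewrite /dyadic_point mulrCA ler_piMr ?(ltW T0)//.
by rewrite ler_pdivrMr ?exprn_gt0// mul1r -natrX ler_nat.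
Qed.

Lemma dyadic_point_half n k : dyadic_point n.+1 k.*2 = dyadic_point n k.
Proof.
rewrite /dyadic_point -muln2 natrM exprS.
by field; rewrite expf_neq0.
Qed.

Lemma dyadic_pointS n k : dyadic_point n k.+1 = dyadic_point n k + T / 2 ^+ n.
Proof. by rewrite /dyadic_point -natr1 mulrDl mul1r. Qed.

Lemma dyadic_index_itv n t : 0 <= t ->
  (dyadic_index n t)%:R <= 2 ^+ n * (t / T) < (dyadic_index n t).+1%:R.
Proof. by move=> t0; apply: truncn_itv; rewrite mulr_ge0 ?exprn_ge0// divr_ge0// ltW. Qed.

Lemma dyadic_index_le n t : t <= T -> (dyadic_index n t <= 2 ^ n)%N.
Proof.
move=> tT; rewrite truncn_le_nat; apply: (@le_lt_trans _ _ (2 ^ n)%:R).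
  by rewrite natrX ler_piMr ?exprn_ge0// ler_pdivrMr// mul1r.
by rewrite ltr_nat.
Qed.

Lemma dyadic_floor_itv n t : 0 <= t -> dyadic_floor n t <= t < dyadic_floor n t + T / 2 ^+ n.
Proof.
move=> /(dyadic_index_itv n)/andP[h1 h2]; rewrite /dyadic_floor -dyadic_pointS /dyadic_point.
rewrite !mulrA ler_pdivrMr ?exprn_gt0// ltr_pdivlMr ?exprn_gt0//.
rewrite -ler_pdivlMr// -ltr_pdivrMr// (_ : t * _ / T = 2 ^+ n * (t / T)) ?h1//; ring.
Qed.

Lemma dyadic_floor_ge0 n t : 0 <= dyadic_floor n t.
Proof. exact: dyadic_point_ge0. Qed.

Lemma dyadic_floor_cvg t : 0 <= t -> dyadic_floor n t @[n --> \oo] --> t.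
Proof.
move=> t0; apply/cvgrPdist_le => e e0.
near=> n; have /andP[h1 h2] := dyadic_floor_itv n t0.
rewrite ger0_norm ?subr_ge0// lerBlDl (le_trans (ltW h2))// lerD2l.
rewrite ler_pdivrMr ?exprn_gt0// mulrC -ler_pdivrMr//.
apply: (@le_trans _ _ (Num.truncn (T / e)).+1%:R); first exact/ltW/truncnS_gt.
apply: (@le_trans _ _ n%:R); first by rewrite ler_nat; near: n; exact: nbhs_infty_ge.
by rewrite -natrX ler_nat ltnW// ltn_expl.
Unshelve. all: by end_near. Qed.

Lemma dyadic_indexS n t : 0 <= t ->
  dyadic_index n.+1 t = (dyadic_index n t).*2 \/ dyadic_index n.+1 t = (dyadic_index n t).*2.+1.
Proof.
move=> t0; have /andP[h1 h2] := dyadic_index_itv n t0.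
set k := dyadic_index n t in h1 h2 *; set y := _ * _ in h1 h2.
have y0 : 0 <= y by exact: le_trans h1.
have E : 2 ^+ n.+1 * (t / T) = 2 * y by rewrite /y exprS -mulrA.
have y20 : 0 <= 2 * y by rewrite mulr_ge0.
have H1 : (k.*2 <= dyadic_index n.+1 t)%N.
  by rewrite /dyadic_index truncn_ge_nat E// -muln2 natrM mulrC ler_pM2l.
have H2 : (dyadic_index n.+1 t < k.*2.+2)%N.
  by rewrite /dyadic_index truncn_lt_nat E// -doubleS -muln2 natrM mulrC ltr_pM2r.
move: H2; rewrite ltnS leq_eqVlt ltnS => /orP[/eqP->|H2]; first by right.
by left; apply/eqP; rewrite eqn_leq H2.
Qed.

Variables (A q : R) (g : R -> R).
Hypotheses (A0 : 0 <= A) (q01 : 0 <= q < 1).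
Hypothesis g_cont : {within `[0, +oo[, continuous g}.
Hypothesis g_incr : forall n k, (k < 2 ^ n)%N ->
  `|g (dyadic_point n k.+1) - g (dyadic_point n k)| <= A * q ^+ n.

(** Refining the level either keeps the dyadic floor of t or moves it by one step of the new level.
    The values of g along the floors thus have geometric increments and, by continuity, converge to
    g t. *)
Lemma dyadic_floor_increment n t : 0 <= t <= T ->
  `|g t - g (dyadic_floor n t)| <= A * q ^+ n / (1 - q).
Proof.
move=> /andP[t0 tT]; have /andP[q0 q1] := q01.
apply: (@geometric_increments_lim _ (fun n => g (dyadic_floor n t)) (g t) A q n A0 q01).
- move=> m; rewrite /dyadic_floor; case: (dyadic_indexS m t0) => E; rewrite E.
    by rewrite dyadic_point_half subrr normr0 mulr_ge0// exprn_ge0.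
  (* The successor of this number is itself an index, hence at most 2^(m + 1) because t <= T; so the
     step stays inside [0, T]. *)
  have Hk : ((dyadic_index m t).*2 < 2 ^ m.+1)%N.
    by rewrite -E; apply: dyadic_index_le.
  rewrite -(dyadic_point_half m (dyadic_index m t)).
  apply: le_trans (g_incr Hk) _; rewrite ler_wpM2l// exprS ler_piMl ?exprn_ge0 ?(ltW q1)//.
- have /subspace_continuousP/(_ t) := g_cont.
  rewrite /= in_itv/= t0 => /(_ isT) H.
  move=> B /H HB; have [N _ HN] := @dyadic_floor_cvg t t0 _ HB; exists N => // m /HN /=.
  by apply; rewrite /= in_itv/= andbT dyadic_floor_ge0.
Qed.

End dyadic.

(** * Dyadic chaining *)

Section dyadic_chaining.
Context {R : realType}.

(** With q = 2^(-la), 1 stands for the step between the floors of s and t and 2 / (1 - q) for the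
    chains at both ends; (2 / T)^la converts q^n into (t - s)^la when T / 2^(n + 1) < t - s. *)
Definition chaining_cst (T la : R) : R := (1 + 2 / (1 - 2 `^ (- la))) * (2 / T) `^ la.

Lemma powRN2_lt1 (la : R) : 0 < la -> 0 <= (2 : R) `^ (- la) < 1.
Proof.
move=> la0; rewrite powR_ge0/= powRN invf_lt1 ?powR_gt0//.
by rewrite /powR gt_eqF// -[ltLHS]expR0 ltr_expR mulr_gt0// ln_gt0// ltr1n.
Qed.

Lemma chaining_cst_ge0 (T la : R) : 0 < la -> 0 <= chaining_cst T la.
Proof.
move=> /powRN2_lt1/andP[_ h]; rewrite mulr_ge0 ?powR_ge0// addr_ge0// divr_ge0//.
by rewrite subr_ge0 ltW.
Qed.

Lemma dyadic_hoelder (T A la : R) (g : R -> R) : 0 < T -> 0 <= A -> 0 < la ->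
  {within `[0, +oo[, continuous g} ->
  (forall n k, (k < 2 ^ n)%N ->
    `|g (dyadic_point T n k.+1) - g (dyadic_point T n k)| <= A * (2 `^ (- la)) ^+ n) ->
  hoelder_on `[0, T] (A * chaining_cst T la) la g.
Proof.
move=> T0 A0 la0 gc gi.
have q01 := powRN2_lt1 la0; set q := 2 `^ (- la) in gi q01 *; have /andP[q0 q1] := q01.
apply: hoelder_on_ordered => // s t s0 st tT.
have t0 : 0 <= t by rewrite (le_trans s0 (ltW st)).
have sT : s <= T by rewrite (le_trans (ltW st)).
have ts0 : 0 < t - s by rewrite subr_gt0.
have ex : exists n, T / 2 ^+ n.+1 < t - s.
  exists (Num.truncn (T / (t - s))).
  rewrite ltr_pdivrMr ?exprn_gt0// mulrC -ltr_pdivrMr//.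
  apply: lt_trans (truncnS_gt _) _.
  by rewrite -natrX ltr_nat ltn_expl.
(* The least level works; if it is 0, the second inequality is just t - s <= T. *)
have {ex}[n nts nmin] : exists2 n, T / 2 ^+ n.+1 < t - s & t - s <= T / 2 ^+ n.
  have H := ex_minnP ex; case: H => -[|n] Hn Hmin; first by exists 0%N => //; rewrite expr0 divr1; lra.
  exists n.+1 => //; rewrite leNgt; apply/negP => /Hmin; by rewrite ltnn.
have Ht := dyadic_floor_increment T0 A0 q01 gc gi n (introT andP (conj t0 tT)).
have Hs := dyadic_floor_increment T0 A0 q01 gc gi n (introT andP (conj s0 sT)).
(* Since t - s <= T / 2^n, the two floors coincide or are neighbours. *)
have Hts : `|g (dyadic_floor T n t) - g (dyadic_floor T n s)| <= A * q ^+ n.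
  have /andP[s1 s2] := dyadic_index_itv T0 n s0; have /andP[t1 t2] := dyadic_index_itv T0 n t0.
  have : 2 ^+ n * (t / T) <= 2 ^+ n * (s / T) + 1.
    rewrite -lerBlDl -mulrBr -mulrBl mulrA ler_pdivrMr// mul1r mulrC.
    by rewrite -ler_pdivlMr// exprn_gt0.
  have : 2 ^+ n * (s / T) <= 2 ^+ n * (t / T).
    by rewrite ler_pM2l ?exprn_gt0// ler_pM2r ?invr_gt0// ltW.
  rewrite /dyadic_floor; set i := dyadic_index T n s in s1 s2 *; set j := dyadic_index T n t in t1 t2 *.
  move=> h1 h2.
  have ij : (i <= j)%N by rewrite -ltnS -(ltr_nat R) (le_lt_trans s1)// (le_lt_trans h1).
  have ji : (j < i.+2)%N.
    rewrite -(ltr_nat R) (le_lt_trans t1)// (le_lt_trans h2)//.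
    by rewrite -(natr1 i.+1) ltrD2r.
  move: ij; rewrite leq_eqVlt => /predU1P[<-|ij]; first by rewrite subrr normr0 mulr_ge0// exprn_ge0.
  have E : j = i.+1 by apply/eqP; rewrite eqn_leq ij -ltnS ji.
  rewrite E; apply: gi; rewrite -E; exact: dyadic_index_le.
have H : `|g t - g s| <= A * q ^+ n * (1 + 2 / (1 - q)).
  have -> : g t - g s = (g t - g (dyadic_floor T n t)) + (g (dyadic_floor T n t) - g (dyadic_floor T n s))
      - (g s - g (dyadic_floor T n s)) by ring.
  have := lerD (lerD Ht Hts) Hs.
  have -> : A * q ^+ n / (1 - q) + A * q ^+ n + A * q ^+ n / (1 - q) = A * q ^+ n * (1 + 2 / (1 - q)) by ring.
  apply: le_trans; apply: le_trans (ler_normB _ _) _; rewrite lerD2r; exact: ler_normD.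
apply: le_trans H _; rewrite /chaining_cst -/q -!mulrA ler_wpM2l//.
rewrite [leLHS]mulrC ler_wpM2l ?addr_ge0 ?divr_ge0 ?subr_ge0 ?(ltW q1)//.
rewrite -powRM ?divr_ge0 ?(ltW T0) ?(ltW ts0)//.
rewrite -powR_mulrn// /q -powRrM mulNr -mulrN mulrC powRrM.
rewrite -(powRrM 2) (mulrC (- n%:R)).
have -> : (2 : R) `^ (la * - n%:R) = (2 ^- n) `^ la.
  by rewrite mulrC powRrM powRN powR_mulrn.
apply: ge0_ler_powR; rewrite ?nnegrE ?(ltW la0) ?invr_ge0 ?exprn_ge0 ?mulr_ge0 ?invr_ge0 ?(ltW T0) ?(ltW ts0)//.
move: nts; rewrite exprS invfM mulrA ltr_pdivrMr ?exprn_gt0//.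
rewrite -[2 ^- n]mul1r ler_pdivrMr ?exprn_gt0// => h.
rewrite -(ler_pM2l T0) mulr1 (_ : T * _ = 2 * ((t - s) * 2 ^+ n)); last by field; exact: lt0r_neq0.
by rewrite -ler_pdivrMl// mulrC ltW.
Qed.

End dyadic_chaining.

(** * Moments of normal laws *)

Section normal_moments.
Context {R : realType}.
Local Notation mu := (@lebesgue_measure R).

Lemma ge0_integral_law d d' (T : measurableType d) (S : measurableType d')
    (P : {measure set T -> \bar R}) (nu : {measure set S -> \bar R})
    (Y : T -> S) (h : S -> \bar R) :
  measurable_fun setT Y ->
  (forall A : set S, measurable A -> P (Y @^-1` A) = nu A) ->
  measurable_fun setT h -> (forall y, 0 <= h y)%E ->
  (\int[P]_w h (Y w) = \int[nu]_y h y)%E.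
Proof.
move=> mY lawY mh h0.
pose mixin := isMeasurableFun.Build _ _ _ _ Y mY.
pose Ym : {mfun T >-> S} := HB.pack Y mixin.
rewrite -(@eq_measure_integral _ _ _ _ nu (pushforward P Ym))//; last first.
  by move=> A mA _; exact: lawY.
by rewrite (@ge0_integral_pushforward _ _ _ _ _ Y mY P setT h)// => y _; exact: h0.
Qed.

(** The explicit density and the abstract Radon-Nikodym derivative have the same integral over every
    measurable set, hence agree almost everywhere. *)
Lemma ge0_integral_normal_prob (m s : R) (h : R -> \bar R) : measurable_fun setT h ->
  (forall x, 0 <= h x)%E ->
  (\int[normal_prob m s]_x h x = \int[mu]_x (h x * (normal_pdf m s x)%:E))%E.
Proof.
move=> mh h0; have dom := normal_prob_dominates m s.
rewrite -(Radon_Nikodym_SigmaFinite.change_of_variables dom h0 measurableT mh).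
have fint := Radon_Nikodym_SigmaFinite.f_integrable dom.
have mf := measurable_int _ fint.
have mpdf : measurable_fun setT (EFin \o normal_pdf m s).
  by apply/measurable_EFinP; exact: measurable_normal_pdf.
apply: ae_eq_integral => //; [exact: emeasurable_funM|exact: emeasurable_funM|].
have : ae_eq mu setT (Radon_Nikodym_SigmaFinite.f (normal_prob m s) mu) (EFin \o normal_pdf m s).
  apply: integral_ae_eq => // E _ mE.
  by rewrite -Radon_Nikodym_SigmaFinite.f_integral.
by case=> N [mN N0 H]; exists N; split => // x /= nx; apply: H => /= hx; apply: nx => ?; rewrite hx.
Qed.

(* The integrand is twice the density of the normal law with deviation 2 s. *)
Lemma integral_normal_expsq (m s : R) : s != 0 ->
  (\int[normal_prob m s]_x (expR (3 * (x - m) ^+ 2 / (8 * s ^+ 2)))%:E = 2%:E)%E.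
Proof.
move=> s0.
have me : measurable_fun setT (fun x : R => (expR (3 * (x - m) ^+ 2 / (8 * s ^+ 2)))%:E).
  apply/measurable_EFinP; apply: measurableT_comp => //.
  apply: measurable_funM => //; apply: measurable_funM => //; apply: measurable_funX.
  exact: measurable_funB.
rewrite ge0_integral_normal_prob//.
have s20 : 2 * s != 0 by rewrite mulf_neq0.
under eq_integral => x _.
  rewrite -EFinM (_ : _ * _ = 2 * normal_pdf m (2 * s) x); last first.
    rewrite !normal_pdfE// /normal_fun [LHS]mulrCA -expRD [RHS]mulrA.
    rewrite (_ : _ + _ = - (x - m) ^+ 2 / ((2 * s) ^+ 2 *+ 2)); last by field.
    congr (_ * _).
    rewrite /normal_peak exprMn.
    have -> : 2 ^+ 2 * s ^+ 2 * pi *+ 2 = 2 ^+ 2 * (s ^+ 2 * pi *+ 2) :> R.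
      by ring.
    by rewrite sqrtrM ?sqr_ge0// sqrtr_sqr ger0_norm// invfM mulrA divff// mul1r.
  over.
under eq_integral do rewrite EFinM.
rewrite ge0_integralZl//; last 2 first.
- by apply/measurable_EFinP; exact: measurable_normal_pdf.
- by move=> x _; rewrite lee_fin normal_pdf_ge0.
by rewrite integral_normal_pdf mule1.
Qed.

Lemma normal_prob_itv_le (m s r : R) : s != 0 -> 0 <= r ->
  (normal_prob m s `[(- r)%R, r]%classic <= (normal_peak s * (2 * r))%:E)%E.
Proof.
move=> s0 r0; rewrite /normal_prob.
apply: (@le_trans _ _ (\int[mu]_(x in `[(- r)%R, r]) (normal_peak s)%:E)%E).
  apply: ge0_le_integral => //.
  - by move=> x _; rewrite lee_fin normal_pdf_ge0.
  - by apply/measurable_EFinP; apply: measurable_funTS; exact: measurable_normal_pdf.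
  - by move=> x _; rewrite lee_fin normal_pdf_ub.
rewrite integral_cst//= lebesgue_measure_itv/= lte_fin.
case: ifPn => [_|_]; last by rewrite mule0 lee_fin mulr_ge0 ?normal_peak_ge0// mulr_ge0.
by rewrite -EFinB -EFinM lee_fin opprK mulrDl mul1r.
Qed.

(* By Chebyshev [-2 sqrt v, 2 sqrt v] has mass at least 3/4, which bounds the
   peak of the density from below. *)
Lemma normal_prob_sq_moment (m s v : R) : s != 0 -> 0 < v ->
  (\int[normal_prob m s]_x (x ^+ 2)%:E = v%:E)%E -> s ^+ 2 <= 8 * v.
Proof.
move=> s0 v0 Ev; pose r := Num.sqrt v.
have r0 : 0 < r by rewrite sqrtr_gt0.
have r2 : r ^+ 2 = v by rewrite sqr_sqrtr// ltW.
pose I := `[- (2 * r), 2 * r]%classic : set R.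
have : (\int[normal_prob m s]_x 1%E <= \int[normal_prob m s]_x ((\1_I x)%:E + (4 * v)^-1%:E * (x ^+ 2)%:E))%E.
  apply: ge0_le_integral => //.
  - apply: emeasurable_funD; first by apply/measurable_EFinP/measurable_indic; exact: measurable_itv.
    by apply: emeasurable_funM => //; apply/measurable_EFinP; exact: measurable_funX.
  - move=> x _; rewrite -EFinM -EFinD lee_fin indicE /I mem_setE in_itv/=.
    case: (boolP (- (2 * r) <= x <= 2 * r)) => xI /=; first by rewrite lerDl mulr_ge0 ?sqr_ge0// invr_ge0 mulr_ge0// ltW.
    rewrite add0r mulrC ler_pdivlMr ?mulr_gt0// mul1r -r2.
    have -> : 4 * r ^+ 2 = (2 * r) ^+ 2 by ring.
    rewrite -[x ^+ 2]real_normK ?num_real// ler_pXn2r ?nnegrE ?mulr_ge0 ?(ltW r0)//.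
    by rewrite leNgt ltr_norml; apply: contra xI => /andP[a b]; rewrite !ltW.
rewrite integral_cst//= probability_setT mul1e ge0_integralD//; last 3 first.
- by apply/measurable_EFinP/measurable_indic; exact: measurable_itv.
- by move=> x _; rewrite -EFinM lee_fin mulr_ge0 ?sqr_ge0// invr_ge0 mulr_ge0// ltW.
- by apply: emeasurable_funM => //; apply/measurable_EFinP; exact: measurable_funX.
have mI : measurable I by exact: measurable_itv.
rewrite integral_indic// ?setIT ge0_integralZl//; last 3 first.
- by apply/measurable_EFinP; exact: measurable_funX.
- by move=> x _; rewrite lee_fin sqr_ge0.
- by rewrite lee_fin invr_ge0 mulr_ge0// ltW.
rewrite Ev -EFinM => /le_trans/(_ (leeD2r _ (normal_prob_itv_le m s0 _))).
move=> /(_ (mulr_ge0 (ler0n _ 2) (ltW r0))); rewrite -EFinD lee_fin.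
have -> : (4 * v)^-1 * v = 4^-1 by field; exact: lt0r_neq0.
pose w := s ^+ 2 * pi *+ 2.
have w0 : 0 < w by rewrite mulrn_wgt0// mulr_gt0 ?pi_gt0// exprn_even_gt0.
rewrite /normal_peak -/w => h.
have q0 : 0 < Num.sqrt w by rewrite sqrtr_gt0.
have {}h : 3 / 4 * Num.sqrt w <= 4 * r.
  rewrite -ler_pdivlMr// mulrC; rewrite mulrA in h; move: h.
  move: (_^-1) => z; lra.
have {}h : (3 / 4 * Num.sqrt w) ^+ 2 <= (4 * r) ^+ 2.
  by rewrite ler_pXn2r ?nnegrE ?mulr_ge0 ?(ltW q0) ?(ltW r0).
rewrite !exprMn sqr_sqrtr ?(ltW w0)// r2 /w in h.
have p2 : s ^+ 2 * 2 <= s ^+ 2 * pi by rewrite ler_wpM2l ?sqr_ge0 ?pi_ge2.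
move: h p2; rewrite -mulr_natr; move: (s ^+ 2 * pi) (s ^+ 2) => z y; lra.
Qed.

End normal_moments.

Section gaussian_moments.
Context d (Omega : measurableType d) (R : realType) (P : probability Omega R).

Lemma expR_half_le2 : expR (2^-1 : R) <= 2.
Proof.
rewrite -[2^-1]opprK expRN -[leRHS]invrK lef_pV2 ?posrE ?expR_gt0//.
by apply: le_trans (expR_ge1Dx _); lra.
Qed.

(* The mean is not assumed to vanish; it is at most of order sqrt v, since
   m^2 <= 2 y^2 + 2 (y - m)^2. *)
Lemma gaussian_exp_moment (Y : Omega -> R) (v k : R) : gaussian P Y -> 0 < v -> 360 * v <= k ->
  (\int[P]_w (Y w ^+ 2)%:E = v%:E)%E ->
  (\int[P]_w (expR (Y w ^+ 2 / k))%:E <= 4%:E)%E.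
Proof.
move=> [mY [m [s lawY]]] v0 vk.
have k0 : 0 < k by apply: lt_le_trans vk; rewrite mulr_gt0.
have vk2 : v <= 2^-1 * k by clear -vk v0; lra.
have vk4 : 720 * v <= 2 * k by clear -vk v0; lra.
clear vk; have mh : measurable_fun setT (fun y : R => (expR (y ^+ 2 / k))%:E).
  apply/measurable_EFinP; apply: measurableT_comp => //.
  by apply: measurable_funM => //; exact: measurable_funX.
have msq : measurable_fun setT (fun y : R => (y ^+ 2)%:E).
  by apply/measurable_EFinP; exact: measurable_funX.
have sq0 (y : R) : (0 <= (y ^+ 2)%:E)%E by rewrite lee_fin sqr_ge0.
(* For a Dirac law the hypothesis on the second moment reads m^2 = v, and v / k <= 1/2. *)
have [s0|s0] := eqVneq s 0.
  have law (A : set R) : measurable A -> P (Y @^-1` A) = dirac m A by move=> /lawY; rewrite s0 eqxx.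
  rewrite (ge0_integral_law mY law msq sq0).
  rewrite (ge0_integral_law (h := fun y : R => (expR (y ^+ 2 / k))%:E) mY law)//.
  rewrite !integral_dirac// !diracT !mul1e => -[mv].
  rewrite mv lee_fin; apply: le_trans (_ : expR 2^-1 <= _).
    by rewrite ler_expR ler_pdivrMr.
  by apply: le_trans expR_half_le2 _; rewrite ler_nat.
have law (A : set (measurableTypeR R)) : measurable A -> P (Y @^-1` A) = normal_prob m s A.
  by move=> /(lawY (A : set R)); rewrite (negbTE s0).
rewrite (@ge0_integral_law R _ _ Omega (measurableTypeR R) P (normal_prob m s) Y _ mY law msq sq0).
rewrite (@ge0_integral_law R _ _ Omega (measurableTypeR R) P (normal_prob m s) Y
  (fun y : R => (expR (y ^+ 2 / k))%:E) mY law)//.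
move=> Ev; have s8 := normal_prob_sq_moment s0 v0 Ev.
have s20 : 0 < s ^+ 2 by rewrite exprn_even_gt0.
pose e (x : R) := 3 * (x - m) ^+ 2 / (8 * s ^+ 2).
have e0 x : 0 <= e x by rewrite /e divr_ge0// mulr_ge0// sqr_ge0.
have me : measurable_fun setT (fun x : R => (expR (e x))%:E).
  apply/measurable_EFinP; apply: measurableT_comp => //.
  apply: measurable_funM => //; apply: measurable_funM => //; apply: measurable_funX.
  exact: measurable_funB.
have Ee : (\int[normal_prob m s]_x (expR (e x))%:E = 2%:E)%E by exact: integral_normal_expsq.
have me2 (x : R) : (x - m) ^+ 2 = (8 / 3 * s ^+ 2) * e x.
  by rewrite /e; field.
have k16 : 0 <= 16 / 3 * s ^+ 2 by rewrite mulr_ge0 ?divr_ge0 ?(ltW s20).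
(* Integrate, using e x <= exp(e x) with mean 2 and s^2 <= 8 v: this gives 2 v + (16/3) (8 v) 2,
   which is below 90 v. *)
have m90 : m ^+ 2 <= 90 * v.
  have : (\int[normal_prob m s]_x (m ^+ 2)%:E <=
     \int[normal_prob m s]_x (2%:E * (x ^+ 2)%:E + (16 / 3 * s ^+ 2)%:E * (expR (e x))%:E))%E.
    apply: ge0_le_integral => //.
    - by apply: emeasurable_funD; apply: emeasurable_funM.
    - move=> x _; rewrite -!EFinM -EFinD lee_fin.
      apply: (@le_trans _ _ (2 * x ^+ 2 + 2 * (x - m) ^+ 2)).
        by have := sqr_ge0 (x + (x - m)); rewrite sqrrD; have := sqr_ge0 (x - m - x); lra.
      rewrite lerD2l me2 mulrA (_ : 2 * (8 / 3 * s ^+ 2) = 16 / 3 * s ^+ 2); last by field.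
      by rewrite ler_wpM2l// (le_trans _ (expR_ge1Dx _))// lerDr.
  rewrite integral_cst//= probability_setT mule1 ge0_integralD//; last 4 first.
  - by move=> x _; rewrite -EFinM lee_fin mulr_ge0// sqr_ge0.
  - by apply: emeasurable_funM.
  - by move=> x _; rewrite -EFinM lee_fin mulr_ge0 ?expR_ge0.
  - by apply: emeasurable_funM.
  rewrite !ge0_integralZl//.
  by rewrite Ev Ee -!EFinM -EFinD lee_fin; lra.
apply: (@le_trans _ _ (\int[normal_prob m s]_x (2%:E * (expR (e x))%:E))%E); last first.
  by rewrite ge0_integralZl// Ee -EFinM lee_fin; lra.
apply: ge0_le_integral => //.
  by apply: emeasurable_funM.
(* Here k >= 360 v = 4 (90 v) makes 2 m^2 / k <= 1/2, while 2 (x - m)^2 / k <= (128/1080) e x <= e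
   x. The factor exp(1/2) <= 2 and the mean 2 of exp(e x) give the bound 4. *)
move=> x _; rewrite -EFinM lee_fin; apply: le_trans (_ : expR (2^-1 + e x) <= _); last first.
  by rewrite expRD ler_wpM2r ?expR_ge0 ?expR_half_le2.
rewrite ler_expR ler_pdivrMr//.
apply: (@le_trans _ _ (2 * (x - m) ^+ 2 + 2 * m ^+ 2)).
  by have := sqr_ge0 (x - m - m); rewrite !sqrrD; lra.
have E1 : (x - m) ^+ 2 <= 64 / 3 * (v * e x).
  by rewrite me2; have := ler_wpM2r (e0 x) s8; move: (e x) (s ^+ 2) => z1 z2; lra.
have E2 := ler_wpM2r (e0 x) vk4; have E3 := mulr_ge0 (ltW v0) (e0 x).
by move: m90 vk4 E1 E2 E3; move: (e x) (m ^+ 2) ((x - m) ^+ 2) => z1 z2 z3; clear; lra.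
Qed.

End gaussian_moments.

Section exponential_series.
Context d (Omega : measurableType d) (R : realType) (P : probability Omega R).

(** The weight 4^-n against the 2^n terms of level n leaves 4 (1/2)^n in mean, which sums to 8. Each
    weighted term is then below the sum on every path, not merely almost surely. *)
Lemma exp_series (xi : nat -> nat -> Omega -> R) :
  (forall n k, measurable_fun setT (xi n k)) ->
  (forall n k, (k < 2 ^ n)%N -> (\int[P]_w (expR (xi n k w))%:E <= 4%:E)%E) ->
  exists S : Omega -> \bar R, [/\ measurable_fun setT S, forall w, (0 <= S w)%E,
    (\int[P]_w S w < +oo)%E &
    forall w n k, (k < 2 ^ n)%N -> ((expR (xi n k w) / 4 ^+ n)%:E <= S w)%E].
Proof.
move=> mxi Hxi.
have mexp n k : measurable_fun setT (fun w => (expR (xi n k w))%:E).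
  by apply/measurable_EFinP; apply: measurableT_comp.
have exp0 n k w : (0 <= (expR (xi n k w))%:E)%E by rewrite lee_fin expR_ge0.
have i40 n : 0 <= (4 ^+ n)^-1 :> R by rewrite invr_ge0 exprn_ge0.
pose f n w := ((4 ^+ n)^-1%:E * \sum_(0 <= k < 2 ^ n) (expR (xi n k w))%:E)%E.
have f0 n w : (0 <= f n w)%E by rewrite mule_ge0 ?lee_fin// sume_ge0.
have mf n : measurable_fun setT (f n).
  by apply: emeasurable_funM => //; apply: emeasurable_sum.
exists (fun w => \sum_(n <oo) f n w)%E; split.
- by apply: ge0_emeasurable_sum.
- by move=> w; exact: nneseries_ge0.
- rewrite integral_nneseries//.
  apply: (@le_lt_trans _ _ 8%:E); last by rewrite ltry.
  have If n : (\int[P]_w f n w <= (4 * (1 / 2) ^+ n)%:E)%E.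
    rewrite ge0_integralZl//; last 2 first.
    - exact: emeasurable_sum.
    - by move=> w _; exact: sume_ge0.
    rewrite ge0_integral_sum//.
    apply: (@le_trans _ _ ((4 ^+ n)^-1%:E * \sum_(0 <= k < 2 ^ n) 4%:E)%E).
      rewrite lee_wpmul2l ?lee_fin//.
      rewrite big_nat [leRHS]big_nat; apply: lee_sum => k /andP[_ kn]; exact: Hxi.
    rewrite sumEFin -EFinM lee_fin sumr_const_nat subn0 -[_ *+ (2 ^ n)]mulr_natl natrX.
    rewrite (_ : 4 ^+ n = 2 ^+ n * 2 ^+ n); last by rewrite -exprMn -natrM.
    rewrite expr_div_n expr1n mulrA invfM -(mulrA (_^-1)) mulVf ?expf_neq0// mulr1 mulrC mul1r//.
  apply: lime_le; first by apply: is_cvg_nneseries => n _ _; exact: integral_ge0.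
  apply: nearW => N.
  apply: (@le_trans _ _ (\sum_(0 <= n < N) (4 * (1 / 2) ^+ n)%:E)%E); first exact: lee_sum.
  rewrite sumEFin lee_fin; apply: le_trans (geometric_sum_le _ _ _) _ => //.
    by apply/andP; split; lra.
  by rewrite ler_pdivrMr; lra.
- move=> w n k kn.
  apply: (@le_trans _ _ (f n w)).
    rewrite /f mulrC EFinM lee_wpmul2l ?lee_fin//.
    rewrite (bigD1_seq k)/= ?iota_uniq ?mem_index_iota//.
    by rewrite leeDl// sume_ge0.
  apply: le_trans (nneseries_lim_ge n.+1 (fun m _ _ => f0 m w)).
  by rewrite big_nat_recr//= leeDr// sume_ge0.
Qed.

End exponential_series.

(** * Increments of fractional Brownian motion *)

Section fbm_increments.
Context d (Omega : measurableType d) (R : realType) (P : probability Omega R).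
Variables (H : R) (B : R -> Omega -> R).
Hypotheses (H0 : 0 < H) (B_fbm : continuous_fbm P H B).

Lemma fbm_increment_gaussian s t : 0 <= s -> 0 <= t -> gaussian P (fun w => B t w - B s w).
Proof.
move=> s0 t0.
have := fbm_gaussian B_fbm (t := fun i : 'I_2 => if i == ord0 then t else s)
   (fun i : 'I_2 => if i == ord0 then 1 else -1).
move=> /(_ _); rewrite (_ : (fun w => _) = (fun w => B t w - B s w)); last first.
  by apply/funext => w; rewrite !big_ord_recl big_ord0 /= mul1r mulN1r addr0.
by apply => i; case: ifP.
Qed.

Lemma fbm_measurable t : 0 <= t -> measurable_fun setT (B t).
Proof.
move=> t0; have := fbm_gaussian B_fbm (t := fun i : 'I_1 => t) (fun i : 'I_1 => 1) (fun=> t0).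
move=> [+ _]; rewrite (_ : (fun w => _) = B t)//.
by apply/funext => w; rewrite big_ord1 mul1r.
Qed.

Lemma fbm_increment_sq s t : 0 <= s -> 0 <= t ->
  (\int[P]_w ((B t w - B s w) ^+ 2)%:E = (`|t - s| `^ (2 * H))%:E)%E.
Proof.
move=> s0 t0.
have cov u v : 0 <= u -> 0 <= v -> (\int[P]_w (B v w * B u w)%:E =
    (2^-1 * (u `^ (2 * H) + v `^ (2 * H) - `|v - u| `^ (2 * H)))%:E)%E.
  by move=> u0 v0; rewrite -(fbm_covariance B_fbm u0 v0) unlock.
have var u : 0 <= u -> (\int[P]_w (B u w * B u w)%:E = (u `^ (2 * H))%:E)%E.
  move=> u0; rewrite cov// subrr normr0 powR0 ?mulf_neq0 ?gt_eqF//.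
  by congr (_%:E); field.
have mM u v : 0 <= u -> 0 <= v -> measurable_fun setT (fun w => (B v w * B u w)%:E).
  by move=> u0 v0; apply/measurable_EFinP; apply: measurable_funM; exact: fbm_measurable.
have isq u : 0 <= u -> P.-integrable setT (fun w => (B u w * B u w)%:E).
  move=> u0; apply/integrableP; split; first exact: mM.
  under eq_integral => w _ do rewrite gee0_abs ?lee_fin -?expr2 ?sqr_ge0// expr2.
  by rewrite var// ltry.
have iD := integrableD measurableT (isq s s0) (isq t t0).
have ic : P.-integrable setT (fun w => (B t w * B s w)%:E).
  apply: le_integrable iD => //; first exact: mM.
  move=> w _; rewrite -[X in (_ <= X)%E]/(`|(B s w * B s w + B t w * B t w)%:E|%E).
  rewrite lee_fin [leRHS]ger0_norm; last by rewrite addr_ge0// -expr2 sqr_ge0.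
  rewrite ler_norml; apply/andP; split.
    by have := sqr_ge0 (B s w + B t w); have := sqr_ge0 (B s w); have := sqr_ge0 (B t w); rewrite sqrrD; lra.
  by have := sqr_ge0 (B s w - B t w); have := sqr_ge0 (B s w); have := sqr_ge0 (B t w); rewrite sqrrB; lra.
have ic2 := integrableZl measurableT (- 2) ic.
transitivity (\int[P]_w (((B s w * B s w)%:E + (B t w * B t w)%:E) + (- 2)%:E * (B t w * B s w)%:E))%E.
  by apply: eq_integral => w _; rewrite -EFinM -!EFinD; congr (_%:E); ring.
rewrite integralD// integralD//; [|exact: isq|exact: isq].
rewrite integralZl// !var// cov// -EFinM -!EFinD; congr (_%:E).
by field.
Qed.

End fbm_increments.

(** * From exponential bounds on increments to a Hoelder constant *)

Section dyadic_path.
Context {R : realType}.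

Lemma ge0_le_sqr (x y : R) : 0 <= y -> x ^+ 2 <= y ^+ 2 -> `|x| <= y.
Proof.
move=> y0 xy; rewrite -(ler_pXn2r (n := 2))// ?nnegrE//.
by rewrite real_normK ?num_real.
Qed.

(** With D = e ln 2, the inequality exp(n D) >= 1 + n D absorbs the linear factor. *)
Lemma linear_geometric_bound (e : R) n : 0 < e ->
  (1 + 3 * n%:R) * (2 `^ (- e)) ^+ n <= 1 + 3 / (e * ln 2).
Proof.
move=> e0; pose D := e * ln 2.
have D0 : 0 < D by rewrite mulr_gt0// ln_gt0// ltr1n.
have -> : (2 : R) `^ (- e) ^+ n = (expR (n%:R * D))^-1.
  by rewrite powRN /powR gt_eqF// exprVn -expRM_natl.
rewrite ler_pdivrMr ?expR_gt0//.
apply: (@le_trans _ _ ((1 + 3 / D) * (1 + n%:R * D))).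
  have -> : (1 + 3 / D) * (1 + n%:R * D) = (1 + 3 * n%:R) + (n%:R * D + 3 / D).
    by field; exact: lt0r_neq0.
  by rewrite lerDl addr_ge0//; [rewrite mulr_ge0// ltW|rewrite divr_ge0// ltW].
by rewrite ler_wpM2l ?expR_ge1Dx// addr_ge0// divr_ge0// ltW.
Qed.

Lemma powR_exprVn (x b : R) n : 0 <= x -> (x ^- n) `^ b = (x `^ (- b)) ^+ n.
Proof.
move=> x0; rewrite -powR_invn// -powRrM -[RHS]powR_mulrn ?powR_ge0// -powRrM.
by congr (_ `^ _); ring.
Qed.

(** Taking logarithms, the squared increment of level n is at most k0 (T / 2^n)^(2 H) (ln s + n ln
    4). Of the decay 2^(-2 H n), the part 2^(-2 la n) is what chaining asks for, and the spare 2^(-2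
    (H - la) n) absorbs the growth in n. *)
Lemma dyadic_exp_hoelder (k0 T H la : R) : 0 < k0 -> 0 < T -> 0 < la -> la < H ->
  exists2 c2 : R, 1 <= c2 & forall (g : R -> R) (s : R),
    {within `[0, +oo[, continuous g} -> 1 <= s ->
    (forall n k, (k < 2 ^ n)%N ->
       expR ((g (dyadic_point T n k.+1) - g (dyadic_point T n k)) ^+ 2 /
             (k0 * (T / 2 ^+ n) `^ (2 * H))) / 4 ^+ n <= s) ->
    hoelder_on `[0, T] (Num.sqrt (c2 * (1 + ln s))) la g.
Proof.
move=> k00 T0 la0 laH; pose e := 2 * (H - la).
have e0 : 0 < e by rewrite mulr_gt0// subr_gt0.
pose m := k0 * T `^ (2 * H).
have m0 : 0 <= m by rewrite mulr_ge0 ?powR_ge0 ?(ltW k00).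
pose C3 := 1 + 3 / (e * ln 2).
have ln2 : 0 < ln 2 :> R by rewrite ln_gt0// ltr1n.
have C30 : 0 <= C3 by rewrite addr_ge0// divr_ge0// mulr_ge0// ltW.
pose a0 := m * C3.
have a00 : 0 <= a0 by exact: mulr_ge0.
have ch0 := chaining_cst_ge0 T la0; set ch := chaining_cst T la in ch0.
exists (1 + a0 * ch ^+ 2); first by rewrite lerDl mulr_ge0// sqr_ge0.
move=> g s gc s1 Hs.
have s0 : 0 < s by exact: lt_le_trans s1.
have ls0 : 0 <= ln s by exact: ln_ge0.
have L0 : 0 <= 1 + ln s by rewrite addr_ge0.
pose A := Num.sqrt (a0 * (1 + ln s)).
have A0 : 0 <= A by exact: sqrtr_ge0.
have A2 : A ^+ 2 = a0 * (1 + ln s) by rewrite sqr_sqrtr// mulr_ge0.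
have incr n k : (k < 2 ^ n)%N ->
    `|g (dyadic_point T n k.+1) - g (dyadic_point T n k)| <= A * (2 `^ (- la)) ^+ n.
  move=> kn; have {Hs} := Hs n k kn; set x := g _ - g _ => Hs.
  have vE : k0 * (T / 2 ^+ n) `^ (2 * H) = m * (2 `^ (- (2 * H))) ^+ n.
    rewrite powRM ?(ltW T0) ?invr_ge0 ?exprn_ge0// mulrA; congr (_ * _).
    exact: powR_exprVn.
  rewrite vE in Hs.
  have m0' : 0 < m by rewrite mulr_gt0// powR_gt0.
  have v0 : 0 < m * (2 `^ (- (2 * H))) ^+ n by rewrite mulr_gt0// exprn_gt0// powR_gt0.
  apply: ge0_le_sqr; first by rewrite mulr_ge0// exprn_ge0// powR_ge0.
  move: Hs; rewrite ler_pdivrMr ?exprn_gt0// -[s * _]lnK; last first.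
    by rewrite posrE mulr_gt0// exprn_gt0.
  rewrite ler_expR ler_pdivrMr// lnM ?posrE ?exprn_gt0// lnXn// => h.
  apply: le_trans h _.
  (* The crude bound 3 for ln 4 is the slope in [linear_geometric_bound]. *)
  have l4 : ln 4 <= 3 :> R.
    apply: le_trans (_ : ln (1 + 3) <= _); first by rewrite (_ : 1 + 3 = 4)//; lra.
    by apply: le_ln1Dx; lra.
  have h1 : ln s + ln 4 *+ n <= (1 + 3 * n%:R) * (1 + ln s).
    rewrite -[_ *+ n]mulr_natr.
    have a1 : ln 4 * n%:R <= 3 * n%:R :> R by rewrite ler_wpM2r.
    have a2 : 0 <= 3 * n%:R * ln s by rewrite !mulr_ge0.
    by lra.
  apply: (@le_trans _ _ ((1 + 3 * n%:R) * (1 + ln s) * (m * (2 `^ (- (2 * H))) ^+ n))).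
    by rewrite ler_pM2r.
  have -> : (2 : R) `^ (- (2 * H)) = 2 `^ (- e) * (2 `^ (- la)) ^+ 2.
    rewrite -[_ ^+ 2]powR_mulrn ?powR_ge0// -powRrM -powRD; last by rewrite pnatr_eq0 implybT.
    by congr (_ `^ _); rewrite /e; ring.
  rewrite exprMn [(A * _) ^+ 2]exprMn A2 /a0.
  rewrite (_ : _ * _ * (m * _) = m * ((1 + 3 * n%:R) * (2 `^ (- e)) ^+ n) * (1 + ln s) * ((2 `^ (- la)) ^+ 2) ^+ n); last by ring.
  rewrite [(_ ^+ n) ^+ 2]exprAC ler_wpM2r ?exprn_ge0 ?powR_ge0// ler_wpM2r// ler_wpM2l//.
  exact: linear_geometric_bound.
have HH := dyadic_hoelder T0 A0 la0 gc incr.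
move=> u v uI vI; apply: le_trans (HH u v uI vI) _.
rewrite ler_wpM2r ?powR_ge0// -/ch -[A * ch]ger0_norm; last exact: mulr_ge0.
apply: ge0_le_sqr; first exact: sqrtr_ge0.
have q0 : 0 <= a0 * ch ^+ 2 by rewrite mulr_ge0// sqr_ge0.
rewrite sqr_sqrtr; last by rewrite mulr_ge0// addr_ge0.
rewrite exprMn A2 mulrAC ler_wpM2r// lerDr//.
Qed.

(** The threshold a^(1 / (1 - th)) is the point where a y^th meets y: above it y dominates, below it
    the value at the threshold does. *)
Lemma powR_sublinear (a th y : R) : 0 <= a -> 0 < th < 1 -> 0 < y ->
  a * y `^ th <= y + a `^ (1 - th)^-1.
Proof.
move=> a0 /andP[th0 th1] y0; have th10 : 0 < 1 - th by rewrite subr_gt0.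
have [ya|ya] := leP (a `^ (1 - th)^-1) y.
  rewrite -[leLHS]addr0; apply: lerD; last exact: powR_ge0.
  have h : a <= y `^ (1 - th).
    have E : a = (a `^ (1 - th)^-1) `^ (1 - th).
      by rewrite -powRrM mulVf ?(lt0r_neq0 th10)// powRr1.
    rewrite {1}E.
    by apply: ge0_ler_powR; rewrite ?nnegrE ?powR_ge0 ?(ltW th10) ?(ltW y0).
  apply: (@le_trans _ _ (y `^ (1 - th) * y `^ th)); first by rewrite ler_wpM2r// powR_ge0.
  by rewrite -powRD ?subrK ?powRr1 ?(ltW y0)// (gt_eqF y0) implybT.
rewrite -[leLHS]add0r; apply: lerD; first exact: ltW.
move: a0; rewrite le_eqVlt => /predU1P[<-|a0]; first by rewrite mul0r powR_ge0.
apply: (@le_trans _ _ (a * (a `^ (1 - th)^-1) `^ th)).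
  rewrite ler_wpM2l ?(ltW a0)//; apply: ge0_ler_powR; rewrite ?nnegrE ?powR_ge0 ?(ltW th0) ?(ltW y0)//.
  exact: ltW.
rewrite -powRrM -[X in X * _](powRr1 (ltW a0)) -powRD; last by rewrite (gt_eqF a0) implybT.
rewrite le_eqVlt; apply/orP; left; apply/eqP; congr (_ `^ _).
by field; exact: lt0r_neq0.
Qed.

(** The exponent is a constant times (1 + ln s)^th with th = 1 / (2 la). As la > 1/2, th < 1, so the
    exponent is at most ln s plus a constant; a single power of s suffices for every a. *)
Lemma exp_hoelder_cst_bound (c2 a la : R) : 1 <= c2 -> 0 <= a -> 2^-1 < la ->
  exists2 Cst : R, 0 <= Cst & forall s, 1 <= s ->
    expR (a * Num.sqrt (c2 * (1 + ln s)) `^ la^-1) <= Cst * s.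
Proof.
move=> c21 a0 la2; have la0 : 0 < la by apply: lt_trans la2.
pose th := (2 * la)^-1.
have th01 : 0 < th < 1.
  by rewrite invr_gt0 mulr_gt0//= invf_lt1 ?mulr_gt0//; lra.
have c20 : 0 <= c2 by exact: le_trans c21.
pose b := a * c2 `^ th.
have b0 : 0 <= b by rewrite mulr_ge0// powR_ge0.
exists (expR (1 + b `^ (1 - th)^-1)); first exact: expR_ge0.
move=> s s1; have s0 : 0 < s by exact: lt_le_trans s1.
have ls0 : 0 <= ln s by exact: ln_ge0.
have L0 : 0 < 1 + ln s by rewrite ltr_pwDl.
have -> : expR (1 + b `^ (1 - th)^-1) * s = expR (1 + b `^ (1 - th)^-1 + ln s).
  by rewrite [RHS]expRD lnK.
rewrite ler_expR.
have -> : Num.sqrt (c2 * (1 + ln s)) `^ la^-1 = c2 `^ th * (1 + ln s) `^ th.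
  rewrite -powRM ?(ltW L0)// -powR12_sqrt ?mulr_ge0 ?(ltW L0)// -powRrM.
  by congr (_ `^ _); rewrite /th invfM.
rewrite mulrA -/b; apply: le_trans (powR_sublinear b0 th01 L0) _.
by rewrite le_eqVlt; apply/orP; left; apply/eqP; ring.
Qed.

End dyadic_path.

(** * Measurability of the norms *)

Section frac_norm_measurable.
Context d (Omega : measurableType d) (R : realType).
Local Notation mu := (@lebesgue_measure R).
Variables (T al : R).
Hypothesis T0 : 0 < T.

(** One sequence through all dyadic points of [0, T], so that suprema over [0, T] become countable
    ones, as [esups] needs. [Num.min] and the default 0 keep every term in [0, T]. *)
Definition dyadic_enum (j : nat) : R :=
  if unpickle j is Some (n, k) then Num.min (dyadic_point T n k) T else 0.

Lemma dyadic_enum_itv j : 0 <= dyadic_enum j <= T.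
Proof.
rewrite /dyadic_enum; case: (unpickle j) => [[n k]|]; last by rewrite lexx ltW.
by rewrite le_min (dyadic_point_ge0 T0) ge_min lexx orbT (ltW T0).
Qed.

Lemma dyadic_floor_enum n t : 0 <= t <= T ->
  dyadic_floor T n t = dyadic_enum (pickle (n, dyadic_index T n t)).
Proof.
move=> /andP[t0 tT]; rewrite /dyadic_enum pickleK min_l//.
by apply: (dyadic_point_leT T0); exact: dyadic_index_le.
Qed.

(* The hypothesis holds for lower semicontinuous functions, such as the fractional
   integral s |-> int_0^s of a continuous path, by Fatou's lemma. *)
Lemma ereal_sup_dyadic (phi : R -> \bar R) :
  (forall t, 0 <= t <= T -> forall M, (forall n, (phi (dyadic_floor T n t) <= M)%E) -> (phi t <= M)%E) ->
  ereal_sup [set phi s | s in `[0, T]] = esups (phi \o dyadic_enum) 0.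
Proof.
move=> lsc; apply/eqP; rewrite eq_le; apply/andP; split.
  apply: ge_ereal_sup => _ /= [t tI <-]; rewrite in_itv/= in tI.
  apply: lsc => // n; rewrite (dyadic_floor_enum n tI).
  by apply: ereal_sup_ubound; exists (pickle (n, dyadic_index T n t)).
apply: ge_ereal_sup => _ /= [j _ <-]; apply: ereal_sup_ubound.
by exists (dyadic_enum j) => //=; rewrite in_itv/= dyadic_enum_itv.
Qed.

Lemma frac_integral_lsc (f : R -> R) t (M : \bar R) : continuous f -> 0 <= t <= T ->
  (forall n, (\int[mu]_u frac_integrand al f (dyadic_floor T n t) u <= M)%E) ->
  (\int[mu]_u frac_integrand al f t u <= M)%E.
Proof.
move=> cf /andP[t0 tT] HM; have mf := continuous_measurable_fun cf.
pose k n u := frac_integrand al f (dyadic_floor T n t) u.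
have dc := dyadic_floor_cvg T0 t0.
have liminf u : (frac_integrand al f t u <= limn_einf (k^~ u))%E.
  have pos : (0 <= limn_einf (k^~ u))%E.
    rewrite limn_einf_lim; apply: lime_ge; first exact: is_cvg_einfs.
    by apply: nearW => n; apply: le_ereal_inf_tmp => _ /= [m _ <-]; exact: frac_integrand_ge0.
  rewrite {1}/frac_integrand; case: ifPn => // /andP[u0 ut].
  have H : k n u @[n --> \oo] --> (`|f t - f u| * (t - u) `^ (- (1 + al)))%:E.
    have H1 : (`|f (dyadic_floor T n t) - f u| * (dyadic_floor T n t - u) `^ (- (1 + al)))%:E
        @[n --> \oo] --> (`|f t - f u| * (t - u) `^ (- (1 + al)))%:E.
      apply: cvg_EFin; first exact: nearW.
      apply: cvgM.
        apply: cvg_norm; apply: cvgB; last exact: cvg_cst.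
        exact: (cvg_comp _ _ dc (cf t)).
      have dcu : dyadic_floor T n t - u @[n --> \oo] --> t - u by apply: cvgB => //; exact: cvg_cst.
      have tu0 : 0 < t - u by rewrite subr_gt0.
      have pc := @powR_continuous_at R (- (1 + al)) (t - u) tu0.
      exact: (cvg_comp (fun n => dyadic_floor T n t - u) (fun p : R => p `^ (- (1 + al))) dcu pc).
    (* The floors tend to t > u, so the test u < s of the integrand eventually succeeds. *)
    apply: cvg_trans H1; apply: near_eq_cvg; near=> n.
    rewrite /k /frac_integrand u0 /=; case: ifPn => //; rewrite -leNgt => h; exfalso.
    move: h; apply/negP; rewrite -ltNge; near: n.
    exact: (cvgr_gt _ dc).
  by rewrite is_cvg_limn_einfE ?(cvg_lim _ H)//; apply: cvgP H.
apply: (@le_trans _ _ (\int[mu]_u limn_einf (k^~ u))%E).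
  apply: ge0_le_integral => //.
  - by move=> u _; exact: frac_integrand_ge0.
  - exact: measurable_frac_integrand.
  - rewrite [X in measurable_fun _ X](_ : _ = fun u => (- limn_esup (fun n => - k n u))%E)//.
    apply: measurableT_comp => //; apply: measurable_fun_limn_esup => n.
    by apply: measurableT_comp => //; exact: measurable_frac_integrand.
apply: le_trans (fatou _ _ _ _) _ => //.
- by move=> n; exact: measurable_frac_integrand.
- by move=> n u _; exact: frac_integrand_ge0.
rewrite limn_einf_lim; apply: lime_le; first exact: is_cvg_einfs.
apply: nearW => n; apply: le_trans (HM n).
by apply: ereal_inf_lbound; exists n => //=.
Unshelve. all: by end_near. Qed.

Lemma sup_lsc (f : R -> R) t (M : \bar R) : continuous f -> 0 <= t <= T ->
  (forall n, (`|f (dyadic_floor T n t)|%:E <= M)%E) -> (`|f t|%:E <= M)%E.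
Proof.
move=> cf /andP[t0 _] HM.
have H : `|f (dyadic_floor T n t)|%:E @[n --> \oo] --> `|f t|%:E.
  apply: cvg_EFin; first exact: nearW.
  apply: cvg_norm; exact: (cvg_comp _ _ (dyadic_floor_cvg T0 t0) (cf t)).
rewrite -(cvg_lim _ H)//; apply: lime_le; first exact: cvgP H.
exact: nearW.
Qed.

Variable x : R -> Omega -> R.
Hypothesis mx : forall t, measurable_fun setT (x t).
Hypothesis cx : forall w, continuous (fun t => x t w).

Lemma measurable_sup_norm : measurable_fun setT (fun w => sup_norm T (fun t => x t w)).
Proof.
rewrite (_ : (fun w => _) = (fun w => esups (fun j => `|x (dyadic_enum j) w|%:E) 0)); last first.
  apply/funext => w; rewrite /sup_norm (@ereal_sup_dyadic (fun t => `|x t w|%:E))//.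
  by move=> t tI M HM; apply: (@sup_lsc (fun t => x t w)).
apply: measurable_fun_esups => j.
by apply/measurable_EFinP; exact: measurableT_comp.
Qed.

(** Joint measurability: by continuity the process is the pointwise limit of the step processes that
    sample it at dyadic floors, each a finite sum of products of measurable functions of w and of
    time. *)
Lemma measurable_process : measurable_fun setT (fun z : Omega * R => x (clamp 0 T z.2) z.1).
Proof.
have mc : measurable_fun setT (fun z : Omega * R => clamp 0 T z.2).
  apply: (measurableT_comp (f := clamp 0 T)); last exact: measurable_snd.
  by apply: measurable_maxr => //; exact: measurable_minr.
pose y n (z : Omega * R) := 2 ^+ n * (clamp 0 T z.2 / T).
have my n : measurable_fun setT (y n).
  by apply: measurable_funM => //; exact: measurable_funM.
(* There are [(2 ^ n).+1] terms because the time T has index 2^n. *)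
pose g n (z : Omega * R) : R := \sum_(0 <= k < (2 ^ n).+1)
   (if k%:R <= y n z < k.+1%:R then x (dyadic_point T n k) z.1 else 0).
have cI z : 0 <= clamp 0 T z <= T by have := clamp_in z (ltW T0); rewrite in_itv.
apply: (@measurable_fun_cvg _ _ _ _ g).
- move=> n; apply: measurable_sum => k; apply: measurable_fun_ifT => //.
    by apply: measurable_and; [exact: measurable_fun_ler|exact: measurable_fun_ltr].
  by apply: (measurableT_comp (mx _)); exact: measurable_fst.
- move=> z _; have /andP[c0 cT] := cI z.2.
  rewrite (_ : g^~ z = fun n => x (dyadic_floor T n (clamp 0 T z.2)) z.1).
    exact: (cvg_comp (fun n => dyadic_floor T n (clamp 0 T z.2)) (fun t => x t z.1)
      (dyadic_floor_cvg T0 c0) (@cx z.1 _)).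
  apply/funext => n; rewrite /g; set i := dyadic_index T n (clamp 0 T z.2).
  have iI := dyadic_index_itv T0 n c0.
  have iin : i \in index_iota 0 (2 ^ n).+1.
    by rewrite mem_index_iota/= ltnS; exact: dyadic_index_le.
  rewrite (bigD1_seq i iin) ?iota_uniq//=.
  rewrite /y iI big1 ?addr0// => k ki; case: ifP => // /truncn_def ik.
  by move: ki; rewrite -ik eqxx.
Qed.

Lemma measurable_frac_sup_norm : measurable_fun setT (fun w => frac_sup_norm al T (fun t => x t w)).
Proof.
rewrite /frac_sup_norm; apply: emeasurable_funD; first exact: measurable_sup_norm.
rewrite (_ : (fun w => _) = (fun w => esups (fun j => \int[mu]_u frac_integrand al (fun t => x t w) (dyadic_enum j) u)%E 0%N)); last first.
  apply/funext => w.
  rewrite -(@ereal_sup_dyadic (fun s => \int[mu]_u frac_integrand al (fun t => x t w) s u)%E).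
    by congr ereal_sup; apply/seteqP; split => _ /= [s sI <-]; exists s => //; rewrite integral_frac_integrand.
  by move=> t tI M HM; exact: (@frac_integral_lsc (fun t => x t w)).
apply: measurable_fun_esups => j; set s := dyadic_enum j.
have /andP[s0 sT] : 0 <= s <= T by exact: dyadic_enum_itv.
rewrite (_ : (fun w => _) = (fun w => \int[mu]_u (if (0 < u < s)%R then
    (`|x s w - x (clamp 0 T u) w| * (s - u) `^ (- (1 + al)))%R%:E else 0))%E); last first.
  apply/funext => w; apply: eq_integral => u _; rewrite /frac_integrand; case: ifP => // /andP[u0 us].
  by rewrite clamp_id// (ltW u0) (le_trans (ltW us)).
apply: (@measurable_integral1 _ _ _ (fun z : Omega * R => if 0 < z.2 < s then
    (`|x s z.1 - x (clamp 0 T z.2) z.1| * (s - z.2) `^ (- (1 + al)))%:E else 0%E)).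
  apply: measurable_fun_ifT => //.
    by apply: measurable_and; apply: measurable_fun_ltr => //; exact: measurable_snd.
  apply/measurable_EFinP; apply: measurable_funM.
    apply: measurableT_comp => //; apply: measurable_funB; last exact: measurable_process.
    by apply: (measurableT_comp (mx _)); exact: measurable_fst.
  by apply: (measurableT_comp (measurable_powR_sub al s)); exact: measurable_snd.
by move=> z; case: ifP => // _; rewrite lee_fin mulr_ge0 ?powR_ge0.
Qed.

End frac_norm_measurable.

Section norms.
Context {R : realType}.
Local Notation mu := (@lebesgue_measure R).

Lemma sup_norm_congr (T : R) (f g : R -> R) :
  (forall t, 0 <= t <= T -> f t = g t) -> sup_norm T f = sup_norm T g.
Proof.
move=> fg; congr ereal_sup; apply/seteqP.
by split => _ /= [s sI <-]; exists s => //; rewrite in_itv/= in sI; rewrite fg.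
Qed.

Lemma frac_sup_norm_congr (al T : R) (f g : R -> R) :
  (forall t, 0 <= t <= T -> f t = g t) -> frac_sup_norm al T f = frac_sup_norm al T g.
Proof.
move=> fg; rewrite /frac_sup_norm (sup_norm_congr fg); congr (_ + ereal_sup _)%E.
have E s : 0 <= s <= T -> (\int[mu]_(u in `]0%R, s[) (`|f s - f u| / (s - u) `^ (1 + al))%:E =
    \int[mu]_(u in `]0%R, s[) (`|g s - g u| / (s - u) `^ (1 + al))%:E)%E.
  move=> sI; apply: eq_integral => u; rewrite inE/= in_itv/= => /andP[u0 us].
  have /andP[_ sT] := sI.
  by rewrite (fg s)// (fg u)// (ltW u0) (le_trans (ltW us)).
by apply/seteqP; split => _ /= [s sI <-]; exists s => //; rewrite in_itv/= in sI; rewrite E.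
Qed.

Lemma sup_norm_ge0 (T : R) (f : R -> R) : 0 <= T -> (0 <= sup_norm T f)%E.
Proof.
move=> T0; apply: le_trans (_ : (`|f 0|%:E <= _)%E); first by rewrite lee_fin.
by apply: ereal_sup_ubound; exists 0 => //=; rewrite in_itv/= lexx.
Qed.

Lemma sup_norm_le_frac (al T : R) (f : R -> R) : 0 <= T -> (sup_norm T f <= frac_sup_norm al T f)%E.
Proof.
move=> T0; rewrite /frac_sup_norm leeDl//.
apply: (@le_trans _ _ (\int[mu]_(u in `]0%R, 0%R[) (`|f 0%R - f u| / (0%R - u) `^ (1 + al))%:E)%E).
  by rewrite set_itvoo0 integral_set0.
by apply: ereal_sup_ubound; exists 0 => //=; rewrite in_itv/= lexx.
Qed.

Lemma hoelder_on_weaken (T K h h' : R) (f : R -> R) : 0 < T -> 0 <= K -> 0 < h' -> h' <= h ->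
  hoelder_on `[0, T] K h f -> hoelder_on `[0, T] (K * T `^ (h - h')) h' f.
Proof.
move=> T0 K0 h'0 hh H s t sI tI; apply: le_trans (H s t sI tI) _.
rewrite -mulrA ler_wpM2l//.
have [->|st0] := eqVneq s t.
  by rewrite subrr normr0 !powR0 ?mulr0 ?gt_eqF// (lt_le_trans h'0).
have -> : `|s - t| `^ h = `|s - t| `^ (h - h') * `|s - t| `^ h'.
  by rewrite -powRD ?subrK// normr_eq0 subr_eq0 (negbTE st0) implybT.
rewrite ler_wpM2r ?powR_ge0//; apply: ge0_ler_powR; rewrite ?nnegrE ?(ltW T0) ?subr_ge0//.
move: sI tI; rewrite /= !in_itv/= => /andP[? ?] /andP[? ?].
by rewrite ler_norml; apply/andP; split; lra.
Qed.

End norms.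

Section sde_moments.
Context {R : realType} {d : measure_display} {Omega : measurableType d}.
Variable P : probability Omega R.

(** X is continuous only almost surely and only on [0, T]. Setting it to 0 on the exceptional null
    set and freezing it outside [0, T] gives a process to which the measurability lemmas apply. *)
Lemma ae_process_continuous_version (T h : R) (X : R -> Omega -> R) : 0 < T -> 0 < h ->
  (forall t, 0 <= t <= T -> measurable_fun setT (X t)) ->
  {ae P, forall w, exists2 K : R, 0 <= K & hoelder_on `[0, T] K h (fun t => X t w)} ->
  exists Y : R -> Omega -> R, [/\ forall t, measurable_fun setT (Y t),
    forall w, continuous (fun t => Y t w) &
    {ae P, forall w, forall t, 0 <= t <= T -> Y t w = X t w}].
Proof.
move=> T0 h0 mX [Z [mZ Z0 HZ]].
exists (fun t w => X (clamp 0 T t) w * \1_(~` Z) w); split.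
- move=> t; apply: measurable_funM; last exact/measurable_indic/measurableC.
  by apply: mX; have := clamp_in t (ltW T0); rewrite in_itv.
- move=> w; case: (pselect (Z w)) => [Zw|nZw].
    rewrite (_ : (fun t => _) = cst 0); first exact: cst_continuous.
    by apply/funext => t; rewrite indicE memNset ?mulr0// => -[].
  have [K K00 HK] : exists2 K : R, 0 <= K & hoelder_on `[0, T] K h (fun t => X t w).
    by apply: contrapT => /HZ.
  rewrite (_ : (fun t => _) = (fun t => X t w) \o clamp 0 T); last first.
    by apply/funext => t; rewrite indicE mem_set ?mulr1.
  apply: (@hoelder_continuous _ K h) => //.
  exact: (hoelder_clamp (ltW T0)).
- exists Z; split => // w /= nH; apply: contrapT => nZw; apply: nH => t tI.
  by rewrite clamp_id// indicE mem_set ?mulr1.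
Qed.

Lemma integrable_poweR_dominated (N : Omega -> \bar R) (S : Omega -> \bar R) (p Cst : R) :
  0 < p -> 0 <= Cst -> measurable_fun setT N ->
  measurable_fun setT S -> (forall w, 0 <= S w)%E -> (\int[P]_w S w < +oo)%E ->
  {ae P, forall w, (N w `^ p <= Cst%:E * S w)%E} ->
  P.-integrable setT (fun w => N w `^ p)%E.
Proof.
move=> p0 C0 mN mS S0 IS NS.
have mNp : measurable_fun setT (fun w => N w `^ p)%E.
  exact: (measurableT_comp (measurable_poweR p) mN).
apply/integrableP; split => //.
under eq_integral => w _ do rewrite gee0_abs ?poweR_ge0//.
apply: (@le_lt_trans _ _ (\int[P]_w (Cst%:E * S w))%E).
  apply: ae_ge0_le_integral => //.
  - by move=> w _; rewrite poweR_ge0.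
  - by move=> w _; rewrite mule_ge0// lee_fin.
  - exact: emeasurable_funM.
  - by case: NS => Z [mZ Z0 HZ]; exists Z; split => // w /= nw; apply: HZ => /= h; apply: nw.
by rewrite ge0_integralZl//; apply: lte_mul_pinfty => //; rewrite lee_fin.
Qed.

End sde_moments.

(** * Moments of the solution *)

Section pathwise_bound.
Context {R : realType}.
Local Notation mu := (@lebesgue_measure R).

(** Stated for one path, so that [Cst] is fixed before g, x and s: here s stands for the value of
    the random series at w, and K0, of which no moment is known, does not enter [Cst]. *)
Lemma sde_path_moment_bound (T H alpha x0 C beta ga la p : R) (a c : R -> R -> R) :
  0 < T -> 0 < C -> 0 < ga -> ga <= beta -> ga <= la -> la <= 1 -> 1 < ga + la ->
  2^-1 < la -> la < H -> alpha < la -> 0 < p ->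
  (forall t y, 0 <= t <= T -> `|a t y| <= C * (1 + `|y|)) ->
  (forall t y, 0 <= t <= T -> `|c t y| <= C * (1 + `|y|)) ->
  (forall s t y z, 0 <= s <= T -> 0 <= t <= T ->
     `|c s y - c t z| <= C * `|s - t| `^ beta + C * `|y - z|) ->
  exists2 Cst : R, 0 < Cst & forall (g x : R -> R) (s K0 : R),
    {within `[0, +oo[, continuous g} -> 1 <= s ->
    (forall n k, (k < 2 ^ n)%N ->
       expR ((g (dyadic_point T n k.+1) - g (dyadic_point T n k)) ^+ 2 /
             (360 * (T / 2 ^+ n) `^ (2 * H))) / 4 ^+ n <= s) ->
    0 <= K0 -> hoelder_on `[0, T] K0 ga x ->
    (forall t, 0 <= t <= T -> mu.-integrable `[0, t] (fun s => (a s (x s))%:E) /\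
       exists2 v : R, is_gls_integral 0 t (fun s => c s (x s)) g v &
       x t = x0 + \int[mu]_(s in `[0, t]) a s (x s) + v) ->
    (frac_sup_norm alpha T x `^ p <= (Cst * s)%:E)%E.
Proof.
move=> T0 C0 ga0 gab gala la1 gala1 la2 laH alla p0 aC cC cH.
have la0 : 0 < la by exact: lt_le_trans gala.
pose S2 := (1 + sewing_cst (ga + la)) * (C * (1 + T `^ (beta - ga))).
have S20 : 0 < S2.
  rewrite mulr_gt0// ?mulr_gt0// ?ltr_pwDl ?powR_ge0//.
  by rewrite ltW// sewing_cst_gt0.
have [c3 c30 Hc3] := young_increments_exp x0 (ltW T0) C0 S20 ga0 gala la1.
have k0 : 0 < 360 :> R by rewrite ltr0n.
have [c2 c21 Hc2] := dyadic_exp_hoelder k0 T0 la0 laH.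
have [C4 C40 HC4] := exp_hoelder_cst_bound c21 (mulr_ge0 (ltW p0) c30) la2.
pose T1 := 1 + T `^ (la - alpha) / (la - alpha).
have T10 : 0 < T1 by rewrite ltr_pwDl// divr_ge0 ?powR_ge0// subr_ge0 ltW.
(* The added 1 makes the constant positive, so that its product with an infinite value of the series
   is still infinite. *)
exists ((C4 + 1) * T1 `^ p); first by rewrite mulr_gt0 ?powR_gt0// ltr_wpDl.
move=> g x s K0 gc s1 Hs K00 xK xE.
pose K := Num.sqrt (c2 * (1 + ln s)).
have gK : hoelder_on `[0, T] K la g by exact: Hc2.
have K1 : 1 <= K.
  rewrite -[leLHS]sqrtr1 ler_sqrt; last first.
    by rewrite mulr_ge0 ?(le_trans _ c21)// addr_ge0// ln_ge0.
  by rewrite -[leLHS]mulr1 ler_pM// lerDl ln_ge0.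
have K0' : 0 <= K by exact: le_trans K1.
have Y := sde_young_increments T0 C0 ga0 gab la0 gala1 K00 K0' aC cC cH xK gK xE.
have x00 : x 0 = x0.
  by have [|_] := xE 0; [rewrite lexx ltW|exact: sde_path_start].
have [xsup xhol] := Hc3 K K0 x K1 Y K00 xK x00.
set E := expR (c3 * K `^ la^-1) in xsup xhol.
have xs t : 0 <= t <= T -> `|x t| <= E by move=> /xsup; apply: le_trans; rewrite lerDr.
have NE := frac_sup_norm_le T0 (expR_ge0 _) alla la0 xs xhol.
have N0 : (0 <= frac_sup_norm alpha T x)%E.
  by apply: le_trans (sup_norm_le_frac alpha x (ltW T0)); apply: sup_norm_ge0; exact: ltW.
have E1 : E + E * (T `^ (la - alpha) / (la - alpha)) = E * T1 by rewrite /T1 mulrDr mulr1.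
rewrite E1 in NE.
apply: (@le_trans _ _ ((E * T1)%:E `^ p)%E).
  apply: gt0_ler_poweR => //; first exact: ltW.
  - by rewrite in_itv/= N0 leey.
  - by rewrite in_itv/= leey lee_fin mulr_ge0 ?expR_ge0 ?(ltW T10).
rewrite poweR_EFin lee_fin powRM ?expR_ge0 ?(ltW T10)// mulrAC ler_wpM2r ?powR_ge0//.
rewrite /E -expRM mulrC mulrA.
apply: le_trans (HC4 s s1) _; rewrite mulrDl lerDl mul1r; exact: le_trans s1.
Qed.

End pathwise_bound.

Lemma gaussian_dyadic_series (R : realType) d (Omega : measurableType d)
    (P : probability Omega R) (T H : R) (B : R -> Omega -> R) :
  0 < T -> 0 < H -> continuous_fbm P H B ->
  exists S : Omega -> \bar R, [/\ measurable_fun setT S, forall w, (0 <= S w)%E,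
    (\int[P]_w S w < +oo)%E &
    forall w n k, (k < 2 ^ n)%N ->
      ((expR ((B (dyadic_point T n k.+1) w - B (dyadic_point T n k) w) ^+ 2 /
        (360 * (T / 2 ^+ n) `^ (2 * H))) / 4 ^+ n)%:E <= S w)%E].
Proof.
move=> T0 H0 fbm.
apply: (@exp_series _ _ _ P (fun n k w => (B (dyadic_point T n k.+1) w - B (dyadic_point T n k) w) ^+ 2 /
        (360 * (T / 2 ^+ n) `^ (2 * H)))).
  move=> n k; apply: measurable_funM => //; apply: measurable_funX.
  by apply: measurable_funB; apply: (fbm_measurable fbm); exact: dyadic_point_ge0.
move=> n k _; have p0 j := dyadic_point_ge0 T0 n j.
have h0 : 0 < T / 2 ^+ n by rewrite divr_gt0// exprn_gt0.
apply: (gaussian_exp_moment (fbm_increment_gaussian fbm (p0 k) (p0 k.+1))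
  (powR_gt0 (2 * H) h0) (lexx _)).
rewrite (fbm_increment_sq H0 fbm (p0 k) (p0 k.+1)).
by rewrite dyadic_pointS addrAC subrr add0r gtr0_norm.
Qed.

Lemma expR_ge1 (R : realType) (x : R) : 0 <= x -> 1 <= expR x.
Proof. by move=> x0; apply: le_trans (expR_ge1Dx x); rewrite lerDl. Qed.

Unset Implicit Arguments.

Theorem corollary4p3 (R : realType) (d : measure_display)
    (Omega : measurableType d) (P : probability Omega R)
    (P_complete : measure_is_complete P)
    (F : R -> set (set Omega)) (F_usual : usual_filtration P F)
    (T H alpha x0 : R) (T_gt0 : 0 < T) (H_range : 2^-1 < H < 1)
    (alpha_range : 1 - H < alpha < 2^-1)
    (a c : R -> R -> R)
    (c_derivable : forall t x, t \in `[0, T] -> derivable (c t) x 1)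
    (C beta : R) (C_gt0 : 0 < C) (beta_range : 1 - H < beta < 1)
    (growth : forall t x, t \in `[0, T] ->
       `|a t x| + `|c t x| <= C * (1 + `|x|) /\ `|derive1 (c t) x| <= C)
    (lipschitz : forall t x1 x2, t \in `[0, T] ->
       `|a t x1 - a t x2| + `|derive1 (c t) x1 - derive1 (c t) x2|
         <= C * `|x1 - x2|)
    (time_hoelder : forall s t x, s \in `[0, T] -> t \in `[0, T] ->
       `|a s x - a t x| + `|c s x - c t x|
         + `|derive1 (c s) x - derive1 (c t) x| <= C * `|s - t| `^ beta)
    (B : R -> Omega -> R) (B_adapted : adapted F `[0, +oo[ B)
    (B_fbm : continuous_fbm P H B)
    (X : R -> Omega -> R) (X_solution : sde_solution P F B T H x0 a c X)
    (p : R) (p_gt0 : 0 < p) :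
  P.-integrable setT
    (fun w => (frac_sup_norm alpha T (fun t => X t w) `^ p)%E) /\
  P.-integrable setT
    (fun w => (sup_norm T (fun t => X t w) `^ p)%E).
Proof.
have /andP[H2 H1] := H_range; have /andP[al1 al2] := alpha_range.
have /andP[be1 be2] := beta_range.
have [kappa /andP[ka1 ka2] Xhol] := solution_hoelder X_solution.
(* The cap at 1/2 gives ga <= 1/2 <= 1 - ga, so any exponent above 1 - ga exceeds both 1/2 and
   ga. *)
pose ga := Num.min beta (Num.min kappa 2^-1).
have ga_beta : ga <= beta by rewrite ge_min lexx.
have ga_kappa : ga <= kappa by rewrite !ge_min lexx orbT.
have ga_half : ga <= 2^-1 by rewrite !ge_min lexx !orbT.
have ga_H : 1 - H < ga by rewrite !lt_min be1 ka1/=; lra.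
have ga0 : 0 < ga by lra.
(* The midpoint of 1 - ga and H, which are in this order because ga > 1 - H. *)
pose la := ((1 - ga) + H) / 2.
have la_H : la < H by rewrite /la; lra.
have la_half : 2^-1 < la by rewrite /la; lra.
have la_ga : 1 < ga + la by rewrite /la; lra.
have H0 : 0 < H by lra.
have mem t : 0 <= t <= T -> t \in `[0, T] by rewrite in_itv.
have aC t y : 0 <= t <= T -> `|a t y| <= C * (1 + `|y|).
  by move=> /mem/(growth t y)[h _]; apply: le_trans h; rewrite lerDl.
have cC t y : 0 <= t <= T -> `|c t y| <= C * (1 + `|y|).
  by move=> /mem/(growth t y)[h _]; apply: le_trans h; rewrite lerDr.
have cH s t y z : 0 <= s <= T -> 0 <= t <= T ->
    `|c s y - c t z| <= C * `|s - t| `^ beta + C * `|y - z|.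
  move=> /mem sI /mem tI; rewrite (_ : _ - _ = (c s y - c t y) + (c t y - c t z)); last by ring.
  apply: le_trans (ler_normD _ _) _; apply: lerD.
    apply: le_trans (time_hoelder s t y sI tI).
    by rewrite -addrA addrCA lerDl addr_ge0.
  apply: lipschitz_of_derive1 => u; first exact: c_derivable.
  by have [_] := growth t u tI.
have [Cst C0 HC] := sde_path_moment_bound x0 T_gt0 C_gt0 ga0 ga_beta
  (le_trans ga_half (ltW la_half)) (ltW (lt_trans la_H H1)) la_ga la_half la_H
  (lt_trans al2 la_half) p_gt0 aC cC cH.
have [S [mS S0 IS HS]] := gaussian_dyadic_series T_gt0 H0 B_fbm.
have Xhol' : {ae P, forall w, exists2 K : R, 0 <= K & hoelder_on `[0, T] K ga (fun t => X t w)}.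
  apply: filterS Xhol => w [K HK]; exists (`|K| * T `^ (kappa - ga)).
    by rewrite mulr_ge0 ?powR_ge0.
  apply: hoelder_on_weaken => // s t sI tI; apply: le_trans (HK s t sI tI) _.
  by rewrite ler_wpM2r ?powR_ge0// ler_norm.
have bound : {ae P, forall w, (frac_sup_norm alpha T (fun t => X t w) `^ p <= Cst%:E * S w)%E}.
  have := solution_equation X_solution; apply: filterS2 Xhol' => w [K K0 HK] Heq.
  (* The term of level 0 alone is the exponential of a nonnegative number. *)
  have S1 : (1%:E <= S w)%E.
    apply: le_trans (HS w 0%N 0%N isT).
    rewrite lee_fin expr0 divr1; apply: expR_ge1.
    exact: (divr_ge0 (sqr_ge0 _) (mulr_ge0 (ler0n _ 360) (powR_ge0 _ _))).
  case E : (S w) S1 => [s| |] //=.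
    move=> s1; rewrite -EFinM; apply: (HC (fun t => B t w) _ s K) => //.
    - exact: fbm_continuous B_fbm w.
    - by move=> n k kn; rewrite -lee_fin -E; exact: HS.
  (* Where the series diverges the right-hand side is +oo and the bound is void; its finite mean
     makes this event null. *)
  by move=> _; rewrite gt0_muley ?leey// lte_fin.
have mX t : 0 <= t <= T -> measurable_fun setT (X t).
  move=> tI _ A mA; rewrite setTI; have /andP[t0 _] := tI.
  apply: (filtration_measurable F_usual t0).
  by apply: (solution_adapted X_solution) => //; exact: mem.
have [Y [mY cY YX]] := ae_process_continuous_version T_gt0 ga0 mX Xhol'.
(* Measurability is known for Y; completeness of P carries it to X, which agrees with Y almost
   surely. *)
have mfrac : measurable_fun setT (fun w => frac_sup_norm alpha T (fun t => X t w)).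
  apply: (ae_measurable_fun P_complete _ (measurable_frac_sup_norm alpha T_gt0 mY cY)).
  by apply: filterS YX => w YXw _; exact: frac_sup_norm_congr.
have msup : measurable_fun setT (fun w => sup_norm T (fun t => X t w)).
  apply: (ae_measurable_fun P_complete _ (measurable_sup_norm T_gt0 mY cY)).
  by apply: filterS YX => w YXw _; exact: sup_norm_congr.
have T0 := ltW T_gt0.
split; apply: (integrable_poweR_dominated p_gt0 (ltW C0) _ mS S0 IS) => //.
apply: filterS bound => w; apply: le_trans.
apply: gt0_ler_poweR; first exact: ltW.
- by rewrite in_itv/= leey sup_norm_ge0.
- by rewrite in_itv/= leey (le_trans (sup_norm_ge0 _ T0) (sup_norm_le_frac alpha _ T0)).
- exact: sup_norm_le_frac.
Qed.
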